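(* Let $\mu$ be a positive finite Borel measure supported on a compact subset of $\frac12Q_0$, where $Q_0\subset\mathbb{R}^d$ is a unit cube, and suppose $\mu(B(x,r))\le r^m$ for all $x\in\mathbb{R}^d$, $r>0$. Let $T$ be a Calderón–Zygmund operator of order $m$ in $\mathbb{R}^d$ (with respect to $\mu$), with smoothness exponent $\varepsilon$ of its kernel, and suppose that for all cubes $Q\subset\mathbb{R}^d$ $$\|T1_Q\|_{L^2(\mu)}^2\le C_0\,\mu(Q),\qquad \|T^*1_Q\|_{L^2(\mu)}^2\le C_0\,\mu(Q).$$ Then $\|T\|_{L^2(\mu)\to L^2(\mu)}\le C(C_0,d,m,\varepsilon)$, a constant depending only on $C_0,d,m,\varepsilon$.
   Context: A Calderón–Zygmund kernel of order $m>0$ in $\mathbb{R}^d$ is a function $K(x,y)$, $x\ne y$, such that for some $\varepsilon>0$ and a constant $A$: $|K(x,y)|\le |x-y|^{-m}$; $|K(x,y)-K(x',y)|\le \frac{|x-x'|^\varepsilon}{|x-y|^{m+\varepsilon}}$ whenever $|x-y|\ge A|x-x'|$; $|K(x,y)-K(x,y')|\le \frac{|y-y'|^\varepsilon}{|x-y|^{m+\varepsilon}}$ whenever $|x-y|\ge A|y-y'|$. The constant $A$ is regarded as fixed once and for all (constants may depend on it). A Calderón–Zygmund operator of order $m$ is a (qualitatively) bounded linear operator $T:L^2(\mu)\to L^2(\mu)$ such that $Tf(x)=\int K(x,y)f(y)\,d\mu(y)$ for $x\notin\operatorname{supp} f$, $f\in C_0^\infty$, with such a kernel $K$. The point of the statement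 is that the bound on the norm does not depend on the a priori norm of $T$. $T^*$ is the adjoint in $L^2(\mu)$; $\frac12Q_0$ is the cube concentric with $Q_0$ of half the side length. *)

(* Defs.v *)
From HB Require Import structures.
From mathcomp Require Import all_boot all_order all_algebra.
From mathcomp Require Import all_classical all_reals all_analysis.
From mathcomp Require Export complex.

Set Implicit Arguments.
Unset Strict Implicit.
Unset Printing Implicit Defensive.

Import Order.TTheory GRing.Theory Num.Theory.
Import numFieldNormedType.Exports.
Local Open Scope classical_set_scope.
Local Open Scope ring_scope.
Local Open Scope complex_scope.

Section EuclideanSpace.
Context {R : realType} {d : nat}.

(* The library norm on 'rV[R]_d is the sup norm; it induces the same topology
   as the Euclidean one, which is the one used for kernels and balls. *)
Definition enorm (x : 'rV[R]_d) : R := Num.sqrt (\sum_(i < d) x ord0 i ^+ 2).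

Definition eball (x : 'rV[R]_d) (r : R) : set 'rV[R]_d :=
  [set y | enorm (y - x) < r].

(* Closed cube with sides parallel to the axes, centre c and side length l. *)
Definition cube (c : 'rV[R]_d) (l : R) : set 'rV[R]_d :=
  [set x | forall i, `|x ord0 i - c ord0 i| <= l / 2].

Fixpoint continuously_differentiable (n : nat) (f : 'rV[R]_d -> R) : Prop :=
  if n is n'.+1 then
    continuous f /\
    forall i : 'I_d,
      (forall x, derivable f x (delta_mx ord0 i)) /\
      continuously_differentiable n' (fun x => 'D_(delta_mx ord0 i) f x)
  else continuous f.

Definition smooth (f : 'rV[R]_d -> R) : Prop :=
  forall n, continuously_differentiable n f.

Definition supp (f : 'rV[R]_d -> R[i]) : set 'rV[R]_d :=
  closure [set x | f x != 0].

Definition test_function (f : 'rV[R]_d -> R[i]) : Prop :=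
  [/\ smooth (fun x => complex.Re (f x)), smooth (fun x => complex.Im (f x)) &
      compact (supp f)].

(* A function of (x, y) with x != y is encoded by a total K whose values on the
   diagonal are irrelevant. The side conditions x' != y and y' != x below only
   say that (x', y) and (x, y') are in the domain; they are automatic when
   1 < A. *)
Record calderon_zygmund_kernel (A m eps : R)
    (K : 'rV[R]_d -> 'rV[R]_d -> R[i]) : Prop := CalderonZygmundKernel {
  cz_size : forall x y, x != y ->
    Normc.normc (K x y) <= enorm (x - y) `^ (- m);
  cz_smooth_l : forall x x' y, x != y -> x' != y ->
    A * enorm (x - x') <= enorm (x - y) ->
    Normc.normc (K x y - K x' y)
      <= enorm (x - x') `^ eps / enorm (x - y) `^ (m + eps);
  cz_smooth_r : forall x y y', x != y -> x != y' ->
    A * enorm (y - y') <= enorm (x - y) ->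
    Normc.normc (K x y - K x y')
      <= enorm (y - y') `^ eps / enorm (x - y) `^ (m + eps)
}.

End EuclideanSpace.

(* R^d with its Borel sigma-algebra; convertible to 'rV[R]_d. *)
Notation borelRd R d := (g_sigma_algebraType (@open 'rV[R]_d)).

Definition Cindic {R : realType} {T : Type} (Q : set T) : T -> R[i] :=
  fun x => (\1_Q x : R)%:C.

Section ComplexL2.
Context {d : measure_display} {T : measurableType d} {R : realType}.
Variable mu : {measure set T -> \bar R}.
Implicit Types (f g : T -> R[i]) (U V : (T -> R[i]) -> T -> R[i]).

(* Elements of L^2(mu; C) are handled through representatives. *)
Definition in_L2 f : Prop :=
  (fun x => complex.Re (f x)) \in Lfun mu 2%:E /\
  (fun x => complex.Im (f x)) \in Lfun mu 2%:E.

Definition L2norm f : \bar R :=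
  ('N[mu]_2%:E [EFin \o (@Normc.normc R \o f)])%E.

Definition Cintegral f : R[i] :=
  (\int[mu]_x complex.Re (f x)) +i* (\int[mu]_x complex.Im (f x)).

Definition L2dot f g : R[i] := Cintegral (fun x => f x * (g x)^*).

Definition L2opnorm U : \bar R :=
  ereal_sup [set L2norm (U f) | f in [set f | in_L2 f /\ (L2norm f <= 1)%E]].

Record L2_bounded_operator U : Prop := L2BoundedOperator {
  L2op_stable : forall f, in_L2 f -> in_L2 (U f);
  L2op_ae : forall f g, in_L2 f -> in_L2 g ->
    {ae mu, forall x, f x = g x} -> {ae mu, forall x, U f x = U g x};
  L2op_linear : forall (a : R[i]) f g, in_L2 f -> in_L2 g ->
    {ae mu, forall x, U (fun z => a * f z + g z) x = a * U f x + U g x};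
  L2op_bounded : (L2opnorm U < +oo)%E
}.

(* V represents the adjoint of U, which is unique up to mu-a.e. equality. *)
Definition L2_adjoint U V : Prop :=
  (forall g, in_L2 g -> in_L2 (V g)) /\
  (forall f g, in_L2 f -> in_L2 g -> L2dot (U f) g = L2dot f (V g)).

End ComplexL2.

(* U f is only defined mu-a.e., hence so is the kernel representation off the
   support. The integrand is continuous with compact support when x lies
   outside supp f, so Cintegral is a genuine integral there. *)
Record calderon_zygmund_operator {R : realType} {d : nat} (A m eps : R)
    (mu : {measure set (borelRd R d) -> \bar R})
    (U : ('rV[R]_d -> R[i]) -> 'rV[R]_d -> R[i]) : Prop :=
  CalderonZygmundOperator {
  czo_bounded : L2_bounded_operator mu U;
  czo_kernel : exists2 K : 'rV[R]_d -> 'rV[R]_d -> R[i],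
    calderon_zygmund_kernel A m eps K &
    forall f, test_function f ->
      {ae mu, forall x, ~ supp f x ->
         U f x = Cintegral mu (fun y => K x y * f y)}
}.

(* Main.v *)
(** The finite a priori norm lets one run the Nazarov-Treil-Volberg averaging
argument on finite matrices with constants that do not see the matrix size.

On the cells of side [2^-n], pairing [T 1_cell] with [1_cell'] gives a matrix [B]
which, by the smoothness of the kernel, is close to a function of one variable
away from the diagonal, while testing on cubes bounds [B] on indicators of the
cubes of every translated dyadic lattice. Expand both arguments into martingale
differences of one such lattice. For two differences at levels [k <= l] whose
lower cube is good, i.e. relatively far from the boundaries of all much larger
cubes, either [k] and [l] are comparable, and then nearby cubes are handled by
testing and distant ones by Schur's test; or [l] is much larger, and then the
upper difference is constant around the lower cube up to a decaying error, which
leaves a paraproduct controlled by the Carleson embedding theorem. So [B] is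
bounded by a constant [C] on functions with only good differences. Averaging over
the lattice, some translate makes the bad parts of both arguments at most a
quarter of their norms, so an a priori bound [N] improves to [C + N / 2]; iterating
removes [N].

The limit [n -> oo] only needs that step functions on the cells are dense in
[L^2(mu)]. Real and imaginary parts of [T] on real functions are treated
separately. *)

Require Import Defs.
From HB Require Import structures.
From mathcomp Require Import all_boot all_order all_algebra.
From mathcomp Require Import all_classical all_reals all_analysis.
From mathcomp Require Import measurable_realfun complex.
From mathcomp Require Import ring lra zify.
Set Implicit Arguments.
Unset Strict Implicit.
Unset Printing Implicit Defensive.
Import Order.TTheory GRing.Theory Num.Theory.
Import numFieldNormedType.Exports.
Local Open Scope ring_scope.

(** Nothing bounds [mu] from below, so neighbouring cubes need not have comparable mass, and
    [|x - y| ^ -m] need not be integrable near the diagonal. Neighbours are therefore only reached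
    through [|<T 1_Q, 1_Q'>| <= sqrt (C0 mu Q mu Q')], which the tests give by Cauchy-Schwarz. What
    makes the averaging work is independence: a difference at level [k] sees the lattice only up to
    level [k.+1], whereas the goodness of its cube is decided by larger levels, and translating by
    multiples of [2 ^ k.+1] changes the latter but not the former. The margin of [2 ^ ((l - k) / 2)]
    lower sides demanded from the ancestor of level [l] balances two needs: it fails for a
    proportion [O(2 ^ (- (l - k) / 2))] of the translates, and it leaves a kernel error
    [O(2 ^ (- eps (l - k) / 2))], so that both sum over [l]. Lengths are counted in meshes
    [h = 2 ^ -n] and masses are divided by [h ^ m]; in these units growth and smoothness take the
    same form for every [n]. *)

Ltac nat_lia :=
  repeat match goal with H : ?T |- _ =>
    lazymatch T with
    | nat => fail | ordinal _ => fail | is_true (leq _ _) => fail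
    | @eq nat _ _ => fail | @eq bool _ _ => fail
    | _ => clear H
    end
  end; lia.

(** * Cauchy-Schwarz and Schur's test for finite sums *)

Section WeightedSums.
Context {R : rcfType}.

Lemma sum_cauchy_schwarz (I : Type) (r : seq I) (P : pred I) (F G : I -> R) :
  (\sum_(i <- r | P i) F i * G i) ^+ 2 <=
  (\sum_(i <- r | P i) F i ^+ 2) * (\sum_(i <- r | P i) G i ^+ 2).
Proof.
set A := \sum_(i <- r | P i) F i ^+ 2; set B := \sum_(i <- r | P i) _.
set C := \sum_(i <- r | P i) G i ^+ 2.
have A0 : 0 <= A by apply: sumr_ge0 => i _; apply: sqr_ge0.
have C0 : 0 <= C by apply: sumr_ge0 => i _; apply: sqr_ge0.
have key (a b : R) : 0 <= a ^+ 2 * A + 2 * a * b * B + b ^+ 2 * C.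
  suff -> : a ^+ 2 * A + 2 * a * b * B + b ^+ 2 * C =
            \sum_(i <- r | P i) (a * F i + b * G i) ^+ 2.
    by apply: sumr_ge0 => i _; apply: sqr_ge0.
  rewrite !mulr_sumr -!big_split; apply: eq_bigr => i _ /=; ring.
(* At [(C, - B)] the quadratic form is [C (A C - B ^ 2)]. In the degenerate case [C = 0] the point
   [(B, - (1 + A))] gives [- (A + 2) B ^ 2 >= 0], hence [B = 0]. *)
have [C1|] := ltP 0 C.
  have := key C (- B); nra.
move=> C1; have {C1} C00 : C = 0 by lra.
have := key B (- (1 + A)); have := key 1 (- B); rewrite C00; nra.
Qed.

Lemma sum_cauchy_schwarz_sqrt (I : Type) (r : seq I) (P : pred I) (F G : I -> R) :
  \sum_(i <- r | P i) F i * G i <=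
  Num.sqrt (\sum_(i <- r | P i) F i ^+ 2) * Num.sqrt (\sum_(i <- r | P i) G i ^+ 2).
Proof.
rewrite -sqrtrM; last by apply: sumr_ge0 => i _; apply: sqr_ge0.
apply: (le_trans (ler_norm _)); rewrite -sqrtr_sqr; apply: ler_wsqrtr.
exact: sum_cauchy_schwarz.
Qed.

(** Each entry is at most the geometric mean of a matrix with controlled rows and one with
    controlled columns, and Cauchy-Schwarz is applied over all pairs at once. Two majorants are
    allowed because for neighbouring cubes the row and the column bound come from different
    weights. *)
Lemma sum_schur (I J : finType) (T M1 M2 : I -> J -> R) (a w : I -> R)
    (b w' : J -> R) (C : R) :
  0 <= C -> (forall i j, 0 <= M1 i j) -> (forall i j, 0 <= M2 i j) ->
  (forall i j, T i j ^+ 2 <= (a i ^+ 2 * M1 i j) * (b j ^+ 2 * M2 i j)) ->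
  (forall i, \sum_j M1 i j <= C * w i) ->
  (forall j, \sum_i M2 i j <= C * w' j) ->
  \sum_i \sum_j `|T i j| <=
    C * (Num.sqrt (\sum_i w i * a i ^+ 2) * Num.sqrt (\sum_j w' j * b j ^+ 2)).
Proof.
move=> C0 M10 M20 hT h1 h2.
pose P (p : I * J) := a p.1 ^+ 2 * M1 p.1 p.2.
pose Q (p : I * J) := b p.2 ^+ 2 * M2 p.1 p.2.
have P0 p : 0 <= P p by rewrite mulr_ge0 ?sqr_ge0.
have Q0 p : 0 <= Q p by rewrite mulr_ge0 ?sqr_ge0.
have SP : \sum_p P p <= C * \sum_i w i * a i ^+ 2.
  rewrite (eq_bigr (fun p => a p.1 ^+ 2 * M1 p.1 p.2)) //.
  rewrite -(pair_bigA _ (fun i j => a i ^+ 2 * M1 i j)) /= mulr_sumr.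
  apply: ler_sum => i _; rewrite -mulr_sumr mulrA mulrC.
  by apply: ler_wpM2r; rewrite ?sqr_ge0.
have SQ : \sum_p Q p <= C * \sum_j w' j * b j ^+ 2.
  rewrite (eq_bigr (fun p => b p.2 ^+ 2 * M2 p.1 p.2)) //.
  rewrite -(pair_bigA _ (fun i j => b j ^+ 2 * M2 i j)) /= exchange_big mulr_sumr.
  apply: ler_sum => i _; rewrite -mulr_sumr mulrA mulrC.
  by apply: ler_wpM2r; rewrite ?sqr_ge0.
rewrite pair_bigA /=.
have lePQ p : `|T p.1 p.2| <= Num.sqrt (P p) * Num.sqrt (Q p).
  rewrite -sqrtrM // -sqrtr_sqr; apply: ler_wsqrtr; exact: hT.
apply: (le_trans (ler_sum _ (fun p _ => lePQ p))).
apply: (le_trans (sum_cauchy_schwarz_sqrt _ _ _ _)).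
rewrite (eq_bigr P) => [|p _]; last by rewrite sqr_sqrtr.
rewrite [X in _ * Num.sqrt X](eq_bigr Q) => [|p _]; last by rewrite sqr_sqrtr.
have -> (u v : R) : C * (Num.sqrt u * Num.sqrt v) = Num.sqrt (C * u) * Num.sqrt (C * v).
  by rewrite !sqrtrM // mulrACA -expr2 sqr_sqrtr.
by apply: ler_pM; rewrite ?sqrtr_ge0 //; apply: ler_wsqrtr.
Qed.

End WeightedSums.

(** * Martingale differences on nested finite partitions *)

Section Averages.
Context {R : rcfType} {X : finType} {I : eqType} (w : X -> R) (c : nat -> X -> I).
Hypothesis w_gt0 : forall x, 0 < w x.
Hypothesis c_inj : forall x y, c 0 x = c 0 y -> x = y.
Hypothesis c_nested : forall k x y, c k x = c k y -> c k.+1 x = c k.+1 y.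
Implicit Types (f g u : X -> R) (k l n : nat).

Definition mass k x := \sum_(y | c k y == c k x) w y.
Definition avg k f x := (\sum_(y | c k y == c k x) w y * f y) / mass k x.
(** Levels grow with the size of the cubes, so this difference is constant on cubes of level [k] and
    has mean zero on cubes of level [k.+1]. *)
Definition diff k f x := avg k f x - avg k.+1 f x.
Definition ip f g := \sum_x w x * f x * g x.
Definition wnorm f := Num.sqrt (\sum_x w x * f x ^+ 2).
Definition level_inv k f := forall x y, c k x = c k y -> f x = f y.

Lemma mass_gt0 k x : 0 < mass k x.
Proof.
rewrite /mass (bigD1 x) //= ltr_pwDl //.
by apply: sumr_ge0 => y _; exact: ltW.
Qed.

Lemma mass_inv k : level_inv k (mass k).
Proof. by move=> x y e; rewrite /mass e. Qed.

Lemma avg_inv k f : level_inv k (avg k f).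
Proof. by move=> x y e; rewrite /avg (mass_inv e) e. Qed.

Lemma nested_le k l x y : (k <= l)%N -> c k x = c k y -> c l x = c l y.
Proof.
move=> /subnK <- e; elim: (l - k)%N => [//|i IH]; rewrite addSn.
exact: c_nested.
Qed.

Lemma level_inv_le k l f : (k <= l)%N -> level_inv l f -> level_inv k f.
Proof. by move=> kl fi x y /(nested_le kl) /fi. Qed.

Lemma eq_avg k f g : f =1 g -> avg k f =1 avg k g.
Proof. by move=> e x; rewrite /avg (eq_bigr (fun y => w y * g y)) // => y _; rewrite e. Qed.

Lemma avg_pull k u f x : level_inv k u -> avg k (fun y => u y * f y) x = u x * avg k f x.
Proof.
move=> ui; rewrite /avg mulrA mulr_sumr; congr (_ / _); apply: eq_bigr => y /eqP e.
by rewrite (ui _ _ e); ring.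
Qed.

Lemma avg_cst k a x : avg k (fun=> a) x = a.
Proof. by rewrite /avg -mulr_suml mulrAC divff ?mul1r // gt_eqF // mass_gt0. Qed.

Lemma avg_id k u x : level_inv k u -> avg k u x = u x.
Proof.
move=> ui; rewrite (@eq_avg _ _ (fun y => u y * 1)); last by move=> y; rewrite mulr1.
by rewrite avg_pull // avg_cst mulr1.
Qed.

Lemma avgD k f g x : avg k (fun y => f y + g y) x = avg k f x + avg k g x.
Proof.
by rewrite /avg -mulrDl -big_split; congr (_ / _); apply: eq_bigr => y _; rewrite mulrDr.
Qed.

Lemma avgZ k a f x : avg k (fun y => a * f y) x = a * avg k f x.
Proof. exact: (@avg_pull k (fun=> a)). Qed.

Lemma avgB k f g x : avg k (fun y => f y - g y) x = avg k f x - avg k g x.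
Proof.
rewrite (@eq_avg _ _ (fun y => f y + (-1) * g y)); last by move=> y; ring.
by rewrite avgD avgZ mulN1r.
Qed.

Lemma avg_sum k (J : Type) (r : seq J) (P : pred J) (F : J -> X -> R) x :
  avg k (fun y => \sum_(j <- r | P j) F j y) x = \sum_(j <- r | P j) avg k (F j) x.
Proof.
elim: r => [|j r IH].
  by rewrite big_nil (@eq_avg _ _ (fun=> 0)) ?avg_cst // => y; rewrite big_nil.
rewrite big_cons (@eq_avg _ _ (fun y => (if P j then F j y else 0) + \sum_(j <- r | P j) F j y)).
  by rewrite avgD IH; case: (P j) => //; rewrite avg_cst add0r.
by move=> y; rewrite big_cons; case: (P j) => //; rewrite add0r.
Qed.

Lemma ler_avg k f g x : (forall y, c k y = c k x -> f y <= g y) -> avg k f x <= avg k g x.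
Proof.
move=> fg; apply: ler_wpM2r; first by rewrite invr_ge0 ltW // mass_gt0.
by apply: ler_sum => y /eqP /fg; apply: ler_wpM2l; exact: ltW.
Qed.

Lemma ipC f g : ip f g = ip g f.
Proof. by apply: eq_bigr => x _; ring. Qed.

(** The kernel of the average is symmetric: it equals [1 / mass] on pairs of points in the same cube
    and vanishes elsewhere. *)
Lemma avg_adj k f g : ip (avg k f) g = ip f (avg k g).
Proof.
have H h h' : ip (avg k h) h' =
    \sum_x \sum_y (c k y == c k x)%:R * (w x * w y * h y * h' x / mass k x).
  apply: eq_bigr => x _; rewrite /avg big_mkcond /= !(mulr_suml, mulr_sumr).
  by apply: eq_bigr => y _; case: eqP => _; rewrite /= ?mul1r ?mul0r ?mulr0 //; ring.
rewrite H (ipC f) H exchange_big; apply: eq_bigr => x _; apply: eq_bigr => y _.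
rewrite (eq_sym (c k x)); case: eqP => [e|_]; rewrite ?mul0r // !mul1r.
by rewrite (mass_inv e); ring.
Qed.

Lemma eq_ip f f' g g' : f =1 f' -> g =1 g' -> ip f g = ip f' g'.
Proof. by move=> e e'; apply: eq_bigr => x _; rewrite e e'. Qed.

Lemma avg_avg_ge k l f x : (k <= l)%N -> avg l (avg k f) x = avg l f x.
Proof.
move=> kl; rewrite {1 3}/avg; congr (_ / _).
(* The sum over the larger cube is a pairing with its indicator, which is invariant at level [k];
   self-adjointness moves the inner average onto it, where it does nothing. *)
pose h y : R := (c l y == c l x)%:R.
have H g : \sum_(y | c l y == c l x) w y * g y = ip g h.
  rewrite big_mkcond; apply: eq_bigr => y _; rewrite /h.
  by case: eqP => _; rewrite ?mulr1 ?mulr0.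
rewrite !H avg_adj; apply: eq_ip => // y; apply: avg_id => y1 y2 e.
by rewrite /h (nested_le kl e).
Qed.

Lemma avg_avg_le k l f x : (k <= l)%N -> avg k (avg l f) x = avg l f x.
Proof. by move=> kl; apply: avg_id; apply: level_inv_le kl _; exact: avg_inv. Qed.

Lemma avg0 f x : avg 0 f x = f x.
Proof. by apply: avg_id => y z /c_inj ->. Qed.

Lemma diff_inv k f : level_inv k (diff k f).
Proof.
move=> x y e; rewrite /diff (avg_inv f e); congr (_ - _).
by apply: avg_inv; exact: c_nested.
Qed.

Lemma eq_diff k f g : f =1 g -> diff k f =1 diff k g.
Proof. by move=> e x; rewrite /diff !(eq_avg _ e). Qed.

Lemma diffD k f g x : diff k (fun y => f y + g y) x = diff k f x + diff k g x.
Proof. by rewrite /diff !avgD; ring. Qed.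

Lemma diff_pull k u f x : level_inv k.+1 u -> diff k (fun y => u y * f y) x = u x * diff k f x.
Proof.
by move=> ui; rewrite /diff !avg_pull ?mulrBr //; exact: level_inv_le ui.
Qed.

Lemma diff_sum k (J : Type) (r : seq J) (P : pred J) (F : J -> X -> R) x :
  diff k (fun y => \sum_(j <- r | P j) F j y) x = \sum_(j <- r | P j) diff k (F j) x.
Proof. by rewrite /diff !avg_sum sumrB. Qed.

Lemma diff_adj k f g : ip (diff k f) g = ip f (diff k g).
Proof.
have -> : ip (diff k f) g = ip (avg k f) g - ip (avg k.+1 f) g.
  by rewrite -sumrB; apply: eq_bigr => x _; rewrite /diff; ring.
by rewrite !avg_adj -sumrB; apply: eq_bigr => x _; rewrite /diff; ring.
Qed.

Lemma avg_diff_gt k l f x : (k < l)%N -> avg l (diff k f) x = 0.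
Proof. by move=> kl; rewrite /diff avgB !avg_avg_ge ?subrr // ltnW. Qed.

Lemma avg_diff_le k l f x : (l <= k)%N -> avg l (diff k f) x = diff k f x.
Proof. by move=> kl; rewrite /diff avgB !avg_avg_le // ltnW. Qed.

Lemma diff_diff k l f x : diff k (diff l f) x = if k == l then diff l f x else 0.
Proof.
rewrite {1}/diff; case: ltngtP => [kl|lk|->].
- by rewrite !avg_diff_le ?subrr // ltnW.
- by rewrite !avg_diff_gt ?subrr // ltnW.
- by rewrite avg_diff_le // avg_diff_gt // subr0.
Qed.

Lemma diff_avg_le k n f x : (n <= k)%N -> diff k (avg n f) x = diff k f x.
Proof. by move=> nk; rewrite /diff !avg_avg_ge //; exact: leqW. Qed.

Lemma diff_avg_gt k n f x : (k < n)%N -> diff k (avg n f) x = 0.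
Proof. by move=> nk; rewrite /diff !avg_avg_le ?subrr // ltnW. Qed.

Lemma sum_diff k n f x : (k <= n)%N ->
  \sum_(k <= l < n) diff l f x = avg k f x - avg n f x.
Proof.
move=> kn; rewrite -[RHS]opprB -(telescope_sumr (fun l => avg l f x) kn) -sumrN.
by apply: eq_bigr => l _; rewrite opprB.
Qed.

Lemma avg_decomp n f x : f x = avg n f x + \sum_(k < n) diff k f x.
Proof.
have := sum_diff f x (leq0n n); rewrite big_mkord avg0 => ->; ring.
Qed.

Lemma wnorm_ge0 f : 0 <= wnorm f. Proof. exact: sqrtr_ge0. Qed.

Lemma wnorm_sqr f : wnorm f ^+ 2 = ip f f.
Proof.
rewrite /wnorm sqr_sqrtr; first by apply: eq_bigr => x _; rewrite -mulrA -expr2.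
by apply: sumr_ge0 => x _; rewrite mulr_ge0 ?sqr_ge0 ?ltW.
Qed.

Lemma wnormE f : wnorm f ^+ 2 = \sum_x w x * f x ^+ 2.
Proof. by rewrite wnorm_sqr; apply: eq_bigr => x _; rewrite -mulrA -expr2. Qed.

Lemma eq_wnorm f g : f =1 g -> wnorm f = wnorm g.
Proof. by move=> e; congr Num.sqrt; apply: eq_bigr => x _; rewrite e. Qed.

Lemma ler_wnorm f g : (forall x, `|f x| <= `|g x|) -> wnorm f <= wnorm g.
Proof.
move=> fg; apply: ler_wsqrtr; apply: ler_sum => x _; apply: ler_wpM2l; first exact: ltW.
by rewrite -[leLHS]real_normK ?num_real // -[leRHS]real_normK ?num_real // lerXn2r ?nnegrE.
Qed.

Lemma ip_wnorm f g : `|ip f g| <= wnorm f * wnorm g.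
Proof.
have H h g0 : ip h g0 <= wnorm h * wnorm g0.
  have -> : ip h g0 = \sum_x (Num.sqrt (w x) * h x) * (Num.sqrt (w x) * g0 x).
    apply: eq_bigr => x _; rewrite mulrACA -expr2 sqr_sqrtr ?ltW //; ring.
  have E h1 : wnorm h1 = Num.sqrt (\sum_x (Num.sqrt (w x) * h1 x) ^+ 2).
    by congr Num.sqrt; apply: eq_bigr => x _; rewrite exprMn sqr_sqrtr // ltW.
  rewrite !E; exact: sum_cauchy_schwarz_sqrt.
rewrite ler_norml H andbT lerNl.
have -> : - ip f g = ip (fun x => - f x) g.
  by rewrite -sumrN; apply: eq_bigr => x _; ring.
have <- : wnorm (fun x => - f x) = wnorm f by congr Num.sqrt; apply: eq_bigr => x _; rewrite sqrrN.
exact: H.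
Qed.

Lemma wnorm_split k f : wnorm (avg k f) ^+ 2 =
  wnorm (avg k.+1 f) ^+ 2 + wnorm (diff k f) ^+ 2.
Proof.
have H : ip (avg k f) (avg k.+1 f) = ip (avg k.+1 f) (avg k.+1 f).
  rewrite !avg_adj; apply: eq_ip => // x.
  by rewrite avg_avg_le // avg_avg_le.
have -> : wnorm (diff k f) ^+ 2 =
    ip (avg k f) (avg k f) - 2 * ip (avg k f) (avg k.+1 f) + ip (avg k.+1 f) (avg k.+1 f).
  rewrite wnorm_sqr /ip mulr_sumr -sumrB -big_split; apply: eq_bigr => x _ /=.
  rewrite /diff; ring.
rewrite H !wnorm_sqr; ring.
Qed.

Lemma wnorm_decomp n f : wnorm f ^+ 2 =
  wnorm (avg n f) ^+ 2 + \sum_(k < n) wnorm (diff k f) ^+ 2.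
Proof.
elim: n => [|n IH].
  by rewrite big_ord0 addr0; congr (_ ^+ 2); apply: eq_wnorm => x; rewrite avg0.
by rewrite big_ord_recr /= [_ + wnorm (diff n f) ^+ 2]addrC addrA -wnorm_split.
Qed.

Lemma sum_wnorm_diff n f : \sum_(k < n) wnorm (diff k f) ^+ 2 <= wnorm f ^+ 2.
Proof. by rewrite (wnorm_decomp n) lerDr sqr_ge0. Qed.

Lemma wnorm_avg n f : wnorm (avg n f) <= wnorm f.
Proof.
rewrite -(ler_pXn2r (ltn0Sn 1)) ?nnegrE ?wnorm_ge0 // (wnorm_decomp n f) lerDl.
by apply: sumr_ge0 => k _; exact: sqr_ge0.
Qed.

Lemma ip_avg1 k f : \sum_x w x * avg k f x = \sum_x w x * f x.
Proof.
have H h : \sum_x w x * h x = ip h (fun=> 1) by apply: eq_bigr => x _; rewrite mulr1.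
rewrite !H avg_adj; apply: eq_ip => // x; exact: avg_cst.
Qed.

(** Jensen's inequality for the jointly convex function [f ^ 2 / g]. With [g = 1 + A] it is the
    concavity used in the Bellman induction. *)
Lemma avg_cauchy_schwarz k f g x : (forall y, 0 < g y) ->
  avg k f x ^+ 2 <= avg k (fun y => f y ^+ 2 / g y) x * avg k g x.
Proof.
move=> g0; have m0 := mass_gt0 k x.
have H h : avg k h x = (\sum_(y | c k y == c k x) w y * h y) / mass k x by [].
rewrite !H mulrACA -invfM -expr2 expr_div_n; apply: ler_wpM2r.
  by rewrite invr_ge0 exprn_ge0 // ltW.
pose F y := Num.sqrt (w y) * f y / Num.sqrt (g y).
pose G y := Num.sqrt (w y) * Num.sqrt (g y).
rewrite (eq_bigr (fun y => F y * G y)); last first.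
  move=> y _; rewrite /F /G -[w y in LHS]sqr_sqrtr ?ltW //.
  have : Num.sqrt (g y) != 0 by rewrite gt_eqF // sqrtr_gt0 g0.
  by move=> ?; field.
rewrite [X in _ <= X * _](eq_bigr (fun y => F y ^+ 2)); last first.
  by move=> y _; rewrite /F !exprMn exprVn !sqr_sqrtr ?ltW //; ring.
rewrite [X in _ <= _ * X](eq_bigr (fun y => G y ^+ 2)); last first.
  by move=> y _; rewrite /G !exprMn !sqr_sqrtr ?ltW.
exact: sum_cauchy_schwarz.
Qed.

(* Induction on scales with the Bellman function 4 (F - f^2 / (1 + A)). *)
Lemma carleson_avg n (a : nat -> X -> R) f :
  (forall k x, 0 <= a k x) ->
  (forall l x, (l <= n)%N -> avg l (fun y => \sum_(j < l.+1) a j y) x <= 1) ->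
  forall l x, (l <= n)%N ->
  avg l (fun y => \sum_(j < l.+1) a j y * avg j f y ^+ 2) x <=
  4 * (avg l (fun y => f y ^+ 2) x -
       avg l f x ^+ 2 / (1 + avg l (fun y => \sum_(j < l.+1) a j y) x)).
Proof.
move=> a0 a1; elim=> [|l IH] x ln.
  have := a1 0%N x ln; rewrite !avg0 !big_ord1 !avg0; have := a0 0%N x.
  move: (a 0%N x) (f x) => A F A0 A1.
  have A2 : 1 + A != 0 by lra.
  rewrite -subr_ge0.
  have -> : 4 * (F ^+ 2 - F ^+ 2 / (1 + A)) - A * F ^+ 2 = A * F ^+ 2 * (3 - A) / (1 + A) by field.
  by apply: divr_ge0; last lra; apply: mulr_ge0; [apply: mulr_ge0; rewrite ?sqr_ge0|lra].
have aS0 j y : 0 <= \sum_(i < j) a i y by apply: sumr_ge0.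
have avg_ge0 j h y : (forall z, 0 <= h z) -> 0 <= avg j h y.
  by move=> h0; rewrite -(avg_cst j 0 y); apply: ler_avg.
pose A y := avg l (fun z => \sum_(j < l.+1) a j z) y.
have A0 y : 0 <= A y by apply: avg_ge0.
set A' := avg l.+1 (fun z => \sum_(j < l.+1) a j z) x.
have A'0 : 0 <= A' by apply: avg_ge0.
set al := avg l.+1 (a l.+1) x.
have al0 : 0 <= al by apply: avg_ge0.
have splitA : avg l.+1 (fun y => \sum_(j < l.+2) a j y) x = A' + al.
  rewrite -avgD; apply: eq_avg => y; by rewrite big_ord_recr.
have -> : avg l.+1 (fun y => \sum_(j < l.+2) a j y * avg j f y ^+ 2) x =
  avg l.+1 (fun y => \sum_(j < l.+1) a j y * avg j f y ^+ 2) x + avg l.+1 f x ^+ 2 * al.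
  rewrite -(@avg_pull l.+1 (fun y => avg l.+1 f y ^+ 2)); last by move=> y z /(@avg_inv _ f) ->.
  by rewrite -avgD; apply: eq_avg => y; rewrite big_ord_recr /= [a l.+1 y * _]mulrC.
have IH' : avg l.+1 (fun y => \sum_(j < l.+1) a j y * avg j f y ^+ 2) x <=
  4 * (avg l.+1 (fun y => f y ^+ 2) x - avg l.+1 (fun y => avg l f y ^+ 2 / (1 + A y)) x).
  rewrite -(avg_avg_ge _ _ (leqnSn l)) -[avg l.+1 (fun y => f y ^+ 2) x](avg_avg_ge _ _ (leqnSn l)).
  rewrite -avgB -avgZ; apply: ler_avg => y _; apply: IH; exact: ltnW.
have CS := @avg_cauchy_schwarz l.+1 (avg l f) (fun y => 1 + A y) x.
rewrite avg_avg_ge // in CS.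
have EA : avg l.+1 (fun y => 1 + A y) x = 1 + A'.
  by rewrite avgD avg_cst /A avg_avg_ge.
rewrite EA in CS.
have {}CS : avg l.+1 f x ^+ 2 <= avg l.+1 (fun y => avg l f y ^+ 2 / (1 + A y)) x * (1 + A').
  by apply: CS => y; have := A0 y; lra.
have := a1 l.+1 x ln; rewrite splitA.
move: CS IH'; move: (avg l.+1 f x) (avg l.+1 (fun y => avg l f y ^+ 2 / (1 + A y)) x).
move: (avg l.+1 (fun y => f y ^+ 2) x) (avg _ _ x) => F L e T CS IH' A1.
have CS' : e ^+ 2 / (1 + A') <= T by rewrite ler_pdivrMr //; lra.
suff : e ^+ 2 * al <= 4 * (e ^+ 2 / (1 + A') - e ^+ 2 / (1 + (A' + al))) by lra.
have -> : 4 * (e ^+ 2 / (1 + A') - e ^+ 2 / (1 + (A' + al))) =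
  e ^+ 2 * al * (4 / ((1 + A') * (1 + (A' + al)))).
  by field; lra.
rewrite -[leLHS]mulr1; apply: ler_wpM2l; first by rewrite mulr_ge0 ?sqr_ge0.
by rewrite ler_pdivlMr; nra.
Qed.

Lemma carleson_embedding n (a : nat -> X -> R) f (K : R) : 0 <= K ->
  (forall k x, 0 <= a k x) ->
  (forall l x, (l <= n)%N -> avg l (fun y => \sum_(j < l.+1) a j y) x <= K) ->
  \sum_(j < n.+1) \sum_x w x * (a j x * avg j f x ^+ 2) <= 4 * K * wnorm f ^+ 2.
Proof.
move=> K0 a0 a1.
(* The case of packing constant 1 will be applied to [a / (K + e)]; the slack [e] is there because
   [K] may be 0. *)
suff H e : 0 < e -> \sum_(j < n.+1) \sum_x w x * (a j x * avg j f x ^+ 2) <=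
    4 * (K + e) * wnorm f ^+ 2.
  apply/ler_addgt0Pr => e e0.
  have := H (e / (4 * (1 + wnorm f ^+ 2))).
  have N0 : 0 <= wnorm f ^+ 2 by exact: sqr_ge0.
  have p0 : 0 < 4 * (1 + wnorm f ^+ 2) by lra.
  move=> /(_ (divr_gt0 e0 p0)) /le_trans; apply.
  rewrite mulrDr mulrDl lerD2l.
  have -> : 4 * (e / (4 * (1 + wnorm f ^+ 2))) * wnorm f ^+ 2 =
     e * (wnorm f ^+ 2 / (1 + wnorm f ^+ 2)) by field; lra.
  rewrite -[leRHS]mulr1; apply: ler_wpM2l; first exact: ltW.
  by rewrite ler_pdivrMr; lra.
move=> e0; have Ke : 0 < K + e by lra.
have H0 := @carleson_avg n (fun k x => a k x / (K + e)) f.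
have Z j y : a j y / (K + e) = (K + e)^-1 * a j y by rewrite mulrC.
have h1 k x : 0 <= a k x / (K + e) by rewrite divr_ge0 // ltW.
have h2 l x : (l <= n)%N -> avg l (fun y => \sum_(j < l.+1) a j y / (K + e)) x <= 1.
  move=> ln; rewrite (@eq_avg _ _ (fun y => (K + e)^-1 * \sum_(j < l.+1) a j y)).
    rewrite avgZ mulrC ler_pdivrMr // mul1r; apply: (le_trans (a1 _ _ ln)); lra.
  by move=> y; rewrite mulr_sumr; apply: eq_bigr => j _.
have H x := H0 h1 h2 n x (leqnn n).
have {}H x : w x * avg n (fun y => \sum_(j < n.+1) a j y * avg j f y ^+ 2) x <=
    4 * (K + e) * (w x * avg n (fun y => f y ^+ 2) x).
  have := H x.
  set b := avg n f x ^+ 2 / _ => Hx.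
  have b0 : 0 <= b.
    rewrite divr_ge0 ?sqr_ge0 // addr_ge0 // -[leLHS](avg_cst n 0 x); apply: ler_avg => y _.
    by apply: sumr_ge0 => j _; rewrite divr_ge0 // ltW.
  have : avg n (fun y => \sum_(j < n.+1) a j y * avg j f y ^+ 2) x / (K + e) <=
      4 * avg n (fun y => f y ^+ 2) x.
    apply: (@le_trans _ _ (4 * (avg n (fun y => f y ^+ 2) x - b))); last by lra.
    rewrite mulrC -(avgZ n (K + e)^-1).
    rewrite (@eq_avg _ _ (fun y => \sum_(j < n.+1) a j y / (K + e) * avg j f y ^+ 2)) // => y.
    by rewrite mulr_sumr; apply: eq_bigr => j _; rewrite mulrA Z.
  rewrite ler_pdivrMr // => {}Hx.
  have -> : 4 * (K + e) * (w x * avg n (fun y => f y ^+ 2) x) =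
    w x * (4 * avg n (fun y => f y ^+ 2) x * (K + e)) by ring.
  by rewrite ler_pM2l.
have := ler_sum (index_enum X) (fun x (_ : true) => H x).
rewrite ip_avg1 -mulr_sumr ip_avg1 -wnormE => H'.
apply: (le_trans _ H'); rewrite exchange_big; apply: ler_sum => x _.
by rewrite mulr_sumr.
Qed.

End Averages.

(** * Geometric sums and windows of levels *)

Section GeometricSums.
Context {R : rcfType}.
Implicit Types q : R.

Lemma sum_expr_le q n : 0 < q < 1 -> \sum_(i < n) q ^+ i <= (1 - q)^-1.
Proof.
move=> /andP[q0 q1]; have p1 : 0 < 1 - q by lra.
rewrite -[leRHS]mul1r ler_pdivlMr // mulrC -opprB mulNr -subrX1.
by have : 0 <= q ^+ n; [rewrite exprn_ge0 // ltW|lra].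
Qed.

(** Each exponent occurs at most twice. The halves come from the margin in the definition of
    goodness. *)
Lemma sum_expr_half_le q n : 0 < q < 1 -> \sum_(i < n) q ^+ i./2 <= 2 / (1 - q).
Proof.
move=> q01; have /andP[q0 q1] := q01.
have H m : \sum_(i < m.*2) q ^+ i./2 = 2 * \sum_(i < m) q ^+ i.
  elim: m => [|m IH]; first by rewrite !big_ord0 mulr0.
  rewrite doubleS !big_ord_recr /= IH /= uphalf_double doubleK; ring.
apply: (@le_trans _ _ (\sum_(i < n.*2) q ^+ i./2)).
  rewrite -addnn big_split_ord /= lerDl; apply: sumr_ge0 => i _.
  by rewrite exprn_ge0 // ltW.
by rewrite H; apply: ler_wpM2l => //; exact: sum_expr_le.
Qed.

Lemma sum_shift (g : nat -> R) s m :
  \sum_(j < m) (if (s <= j)%N then g (j - s)%N else 0) = \sum_(k < m - s) g k.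
Proof.
elim: m => [|m IH]; first by rewrite sub0n !big_ord0.
rewrite big_ord_recr /= IH; case: leqP => rm.
  by rewrite subSn // big_ord_recr.
by rewrite addr0; have -> : (m.+1 - s = m - s)%N by lia.
Qed.

Lemma sum_window (C : R) a b m : \sum_(l < m) (if (a <= l < b)%N then C else 0) =
  C *+ (minn m b - a).
Proof.
elim: m => [|m IH]; first by rewrite big_ord0 min0n sub0n.
rewrite big_ord_recr /= IH; case: ifP => h; last by rewrite addr0; congr (_ *+ _); lia.
by rewrite -mulrSr; congr (_ *+ _); lia.
Qed.

End GeometricSums.

(** * The form on good functions *)

Section OneSided.
Context {R : rcfType} {X : finType} {I : eqType} (w : X -> R) (c : nat -> X -> I).
Hypothesis w_gt0 : forall x, 0 < w x.
Hypothesis c_inj : forall x y, c 0 x = c 0 y -> x = y.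
Hypothesis c_nested : forall k x y, c k x = c k y -> c k.+1 x = c k.+1 y.
(* [B x y] stands for the pairing of the operator applied to the indicator of [y] with
   the indicator of [x]; [ker x0 y] is the kernel at the point [x0], integrated over [y]. *)
Variables (dist : X -> X -> nat) (th : X -> X -> R) (B ker : X -> X -> R).
Variables (n r a0 : nat) (q C0 C1 C2 : R) (G : nat -> X -> bool).
Hypothesis q01 : 0 < q < 1.
Hypothesis C0_ge0 : 0 <= C0.
Hypothesis C1_ge0 : 0 <= C1.
Hypothesis C2_ge0 : 0 <= C2.
Hypothesis distC : forall x y, dist x y = dist y x.
Hypothesis thC : forall x y, th x y = th y x.
Hypothesis th_ge0 : forall x y, 0 <= th x y.
Hypothesis diam : forall k x y, c k x = c k y -> (dist x y < 2 ^ k)%N.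
(** For [q = 2 ^ -eps], the factor [q ^- j] below stands for [|x - x0| ^ eps] and [th x y] for
    [|x - y| ^ -(m + eps)], whose integral beyond distance [2 ^ a] decays like [q ^ a]. *)
Hypothesis tail : forall x a,
  \sum_(y | (2 ^ a <= dist x y)%N) w y * th x y <= C1 * q ^+ a.
Hypothesis smoothB : forall j x x0 y, (dist x x0 < 2 ^ j)%N ->
  (2 ^ (j + a0) <= dist x y)%N ->
  `|B x y - w x * ker x0 y| <= w x * w y * (q ^- j * th x y).

Definition bil (g f : X -> R) := \sum_x \sum_y g x * f y * B x y.
Definition cind k z y : R := (c k y == c k z)%:R.

Hypothesis testing : forall k z h, (k <= n)%N ->
  `|bil h (cind k z)| <= C0 * Num.sqrt (mass w c k z) * wnorm w h.

(** Nearness is decided by the parents, at level [k.+1]: its indicator is then constant on the cubes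
    over which a difference of level [k] has mean zero, so cutting it out does not destroy
    cancellation. *)
Definition near k x y := [exists x', exists y',
  [&& c k.+1 x' == c k.+1 x, c k.+1 y' == c k.+1 y & (dist x' y' < 2 ^ (k.+1 + a0))%N]].

(** A whole cube contributes exactly 1 to such a sum, so this counts the cubes of level [k] whose
    parents are near. *)
Hypothesis near_count : forall k x, (k < n)%N ->
  \sum_(y | near k x y) w y / mass w c k y <= C2.
Hypothesis top_count : \sum_y w y / mass w c n y <= C2.
Hypothesis G_inv : forall k x y, c k.+1 x = c k.+1 y -> G k x = G k y.
Hypothesis G_good : forall k l x y, (k + r <= l)%N -> (l <= n)%N -> G k x ->
  c l x <> c l y -> (2 ^ (k.+1 + (l - k)./2) <= dist x y)%N.
Hypothesis r_gt0 : (0 < r)%N.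
Hypothesis r_a0 : (a0 <= r./2)%N.

Local Notation avg := (avg w c).
Local Notation diff := (diff w c).
Local Notation mass := (mass w c).
Local Notation ip := (ip w).
Local Notation wnorm := (wnorm w).

Let q0 : 0 < q. Proof. by case/andP: q01. Qed.
Let q1 : q < 1. Proof. by case/andP: q01. Qed.
Let mass0 k x : 0 < mass k x. Proof. exact: mass_gt0. Qed.
Let Cq_ge0 a : 0 <= C1 * q ^+ a.
Proof. by apply: mulr_ge0 => //; rewrite ?exprn_ge0 // ltW. Qed.

Definition farw a x y := if (2 ^ a <= dist x y)%N then w x * w y * th x y else 0.

Lemma farw_ge0 a x y : 0 <= farw a x y.
Proof. by rewrite /farw; case: ifP => // _; rewrite !mulr_ge0 // ltW. Qed.

Lemma farwC a x y : farw a x y = farw a y x.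
Proof. by rewrite /farw distC thC; case: ifP => // _; ring. Qed.

Lemma farw_sum a x : \sum_y farw a x y <= C1 * q ^+ a * w x.
Proof.
rewrite -big_mkcond /=; under eq_bigr do rewrite -mulrA.
by rewrite -mulr_sumr mulrC; apply: ler_wpM2r; [exact: ltW|exact: tail].
Qed.

Lemma far_schur a v u :
  \sum_x \sum_y `|v x * u y * farw a x y| <= C1 * q ^+ a * (wnorm v * wnorm u).
Proof.
apply: (sum_schur (M1 := farw a) (M2 := farw a)).
- exact: Cq_ge0.
- exact: farw_ge0.
- exact: farw_ge0.
- by move=> x y; rewrite le_eqVlt; apply/orP; left; apply/eqP; ring.
- exact: farw_sum.
- by move=> y; under eq_bigr do rewrite farwC; exact: farw_sum.
Qed.

(** Companion of [far_schur] with both functions at the same point; it is needed when [u y] is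
    compared with [u x]. *)
Lemma far_diag a v u :
  \sum_x \sum_y `|v x * u x * farw a x y| <= C1 * q ^+ a * (wnorm v * wnorm u).
Proof.
have Cq0 : 0 <= C1 * q ^+ a := Cq_ge0 a.
apply: (@le_trans _ _ (C1 * q ^+ a * ip (fun x => `|v x|) (fun x => `|u x|))).
  rewrite mulr_sumr; apply: ler_sum => x _.
  under eq_bigr do rewrite !normrM (ger0_norm (farw_ge0 _ _ _)).
  rewrite -mulr_sumr.
  have := ler_wpM2l (mulr_ge0 (normr_ge0 (v x)) (normr_ge0 (u x))) (farw_sum a x).
  by move=> /le_trans; apply; rewrite le_eqVlt; apply/orP; left; apply/eqP; ring.
apply: ler_wpM2l => //.
have <- : wnorm (fun x => `|v x|) = wnorm v by congr Num.sqrt; apply: eq_bigr => x _; rewrite real_normK ?num_real.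
have <- : wnorm (fun x => `|u x|) = wnorm u by congr Num.sqrt; apply: eq_bigr => x _; rewrite real_normK ?num_real.
by apply: le_trans (ler_norm _) _; exact: ip_wnorm.
Qed.

(* The mean-zero condition on v allows subtracting from B x y the value of the
   kernel at a fixed point of the cube containing x. *)
Lemma cancellation k a v (H : X -> X -> R) :
  (k.+1 + a0 <= a)%N -> (forall x, avg k.+1 v x = 0) ->
  (forall x x' y, c k.+1 x = c k.+1 x' -> H x y = H x' y) ->
  (forall x y, v x != 0 -> H x y != 0 -> (2 ^ a <= dist x y)%N) ->
  `|\sum_x \sum_y v x * H x y * B x y| <=
  q ^- k.+1 * \sum_x \sum_y `|v x * H x y * farw a x y|.
Proof.
move=> ka v0 Hi Hd.
pose rep x := odflt x [pick z | c k.+1 z == c k.+1 x].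
have repP x : c k.+1 (rep x) = c k.+1 x.
  by rewrite /rep; case: pickP => [z /eqP|].
have rep_inv x x' : c k.+1 x = c k.+1 x' -> rep x = rep x'.
  move=> e; rewrite /rep e; case: pickP => [//|/(_ x')]; by rewrite eqxx.
have z y : \sum_x v x * H x y * (w x * ker (rep x) y) = 0.
  pose u x := H x y * ker (rep x) y.
  have ui : level_inv c k.+1 u.
    by move=> x x' e; rewrite /u (rep_inv _ _ e) (Hi _ _ _ e).
  transitivity (ip v u); first by apply: eq_bigr => x _; rewrite /u; ring.
  have -> : ip v u = ip v (avg k.+1 u) by apply: eq_ip => // x; rewrite avg_id.
  by rewrite -avg_adj //; apply: big1 => x _; rewrite v0; ring.
have -> : \sum_x \sum_y v x * H x y * B x y =
    \sum_x \sum_y v x * H x y * (B x y - w x * ker (rep x) y).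
  have E : \sum_x \sum_y v x * H x y * (w x * ker (rep x) y) = 0.
    by rewrite exchange_big; apply: big1 => y _; exact: z.
  rewrite -[LHS]subr0 -[X in _ - X]E -sumrB; apply: eq_bigr => x _; rewrite -sumrB.
  by apply: eq_bigr => y _; ring.
apply: (le_trans (ler_norm_sum _ _ _)); rewrite mulr_sumr; apply: ler_sum => x _.
apply: (le_trans (ler_norm_sum _ _ _)); rewrite mulr_sumr; apply: ler_sum => y _.
have [->|vx] := eqVneq (v x) 0; first by rewrite !mul0r normr0 mulr0.
have [->|hx] := eqVneq (H x y) 0; first by rewrite !(mulr0, mul0r) normr0 mulr0.
have d := Hd _ _ vx hx.
rewrite !normrM mulrCA; apply: ler_wpM2l; first by rewrite mulr_ge0.
rewrite (ger0_norm (farw_ge0 _ _ _)) /farw d mulrCA.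
apply: smoothB; first by apply: diam; rewrite repP.
by apply: leq_trans d; rewrite leq_exp2l.
Qed.

Definition rowsum x := \sum_y B x y.

Lemma qVq k a : (k <= a)%N -> q ^- k * q ^+ a = q ^+ (a - k).
Proof. by move=> ka; rewrite -{1}(subnK ka) exprD mulrCA mulVf ?mulr1 // expf_neq0 // gt_eqF. Qed.

(** Replacing [u y] by [u x] produces the row sum, which is left to the paraproduct. The error
    [u y - u x] vanishes when both points share their cube of level [l]; otherwise goodness
    separates them and the mean zero of [v] brings in the smoothness of the kernel. *)
Lemma off_diagonal k l v u : (k + r <= l)%N -> (l <= n)%N ->
  (forall x, avg k.+1 v x = 0) -> (forall x, v x != 0 -> G k x) ->
  level_inv c l u ->
  `|bil v u - \sum_x v x * u x * rowsum x| <=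
     2 * C1 * q ^+ (l - k)./2 * (wnorm v * wnorm u).
Proof.
move=> kl ln v0 vG ui.
pose a := (k.+1 + (l - k)./2)%N.
pose H x y := u y - u x.
have Hz x y : c l x = c l y -> H x y = 0 by move=> e; rewrite /H (ui _ _ e) subrr.
have -> : bil v u - \sum_x v x * u x * rowsum x = \sum_x \sum_y v x * H x y * B x y.
  rewrite -sumrB; apply: eq_bigr => x _; rewrite mulr_sumr -sumrB.
  by apply: eq_bigr => y _; rewrite /H; ring.
(* Since [l - k >= r] and [a0 <= r./2], the margin of a good cube already exceeds the separation
   that the smoothness condition asks for. *)
have ka : (k.+1 + a0 <= a)%N.
  by rewrite leq_add2l (leq_trans r_a0) //; apply: half_leq; nat_lia.
apply: (le_trans (cancellation ka v0 _ _)).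
- move=> x x' y e; rewrite /H; congr (_ - _); apply: ui.
  by apply: nested_le e => //; nat_lia.
- move=> x y /vG Gx; case: (eqVneq (c l x) (c l y)) => [/Hz ->|/eqP ne _].
    by rewrite eqxx.
  exact: G_good Gx ne.
apply: (@le_trans _ _ (q ^- k.+1 * (2 * (C1 * q ^+ a * (wnorm v * wnorm u))))).
  apply: ler_wpM2l; first by rewrite invr_ge0 exprn_ge0 // ltW.
  rewrite mulr_natl mulr2n; apply: le_trans (lerD (far_schur a v u) (far_diag a v u)).
  rewrite -big_split; apply: ler_sum => x _; rewrite -big_split; apply: ler_sum => y _ /=.
  rewrite !normrM -!mulrDl -mulrDr -!mulrA; apply: ler_wpM2l => //; apply: ler_wpM2r => //.
  exact: ler_normB.
rewrite le_eqVlt; apply/orP; left; apply/eqP.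
have -> : q ^- k.+1 * (2 * (C1 * q ^+ a * (wnorm v * wnorm u))) =
  (q ^- k.+1 * q ^+ a) * (2 * C1 * (wnorm v * wnorm u)) by ring.
rewrite qVq; last by rewrite /a leq_addr.
by rewrite /a addKn; ring.
Qed.

Lemma sum_cind k z f : \sum_x cind k z x * f x = \sum_(x | c k x == c k z) f x.
Proof.
rewrite [RHS]big_mkcond; apply: eq_bigr => x _; rewrite /cind.
by case: eqP; rewrite ?mul1r ?mul0r.
Qed.

Lemma cind_inv k l z : (k <= l)%N -> level_inv c k (cind l z).
Proof. by move=> kl x y e; rewrite /cind (nested_le c_nested kl e). Qed.

Lemma wnorm_cind k z : wnorm (cind k z) = Num.sqrt (mass k z).
Proof.
congr Num.sqrt; transitivity (\sum_x cind k z x * w x); last exact: sum_cind.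
apply: eq_bigr => x _; rewrite /cind.
by case: eqP; rewrite ?(expr1n, expr0n) /= ?(mul1r, mulr1, mul0r, mulr0).
Qed.

(** Sums over cubes are written as sums over points with weight [w y / mass k y], of total 1 on each
    cube; this avoids a separate index set of cubes. *)
Lemma spread k phi psi : level_inv c k phi ->
  \sum_y phi y * (w y / mass k y) * (\sum_z cind k y z * psi z) = \sum_y phi y * psi y.
Proof.
move=> phii.
have -> : \sum_y phi y * (w y / mass k y) * (\sum_z cind k y z * psi z) =
  \sum_z \sum_y (phi z * psi z / mass k z) * (cind k z y * w y).
  rewrite exchange_big; apply: eq_bigr => y _; rewrite mulr_sumr; apply: eq_bigr => z _.
  rewrite /cind eq_sym; case: eqP => [e|]; last by rewrite !(mul0r, mulr0).
  by rewrite (phii _ _ e) (mass_inv w e); ring.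
apply: eq_bigr => z _; rewrite -mulr_sumr sum_cind -/(mass k z).
by rewrite mulfVK // gt_eqF.
Qed.

Lemma bil_cind_le k x y : (k <= n)%N ->
  `|bil (cind k x) (cind k y)| <= C0 * (Num.sqrt (mass k x) * Num.sqrt (mass k y)).
Proof.
move=> kn; apply: (le_trans (testing _ _ kn)); rewrite wnorm_cind.
by rewrite le_eqVlt; apply/orP; left; apply/eqP; ring.
Qed.

Lemma nearC k x y : near k x y = near k y x.
Proof.
by apply/existsP/existsP => -[x' /existsP[y' /and3P[e1 e2 d]]];
  exists y'; apply/existsP; exists x'; rewrite e1 e2 distC d.
Qed.

Lemma near_inv k x x' y : c k.+1 x = c k.+1 x' -> near k x y = near k x' y.
Proof. by move=> e; rewrite /near e. Qed.

(** Near pairs are expanded into indicators of cubes of level [k], tested pairwise and summed by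
    Schur's test over boundedly many neighbours. On the remaining pairs the mean zero of [v] gives
    decay. *)
Lemma near_diagonal k v u : (k < n)%N -> level_inv c k v -> level_inv c k u ->
  (forall x, avg k.+1 v x = 0) ->
  `|bil v u| <= (C0 * C2 + C1) * (wnorm v * wnorm u).
Proof.
move=> kn vi ui v0.
pose N x y : R := (near k x y)%:R.
have NC x y : N x y = N y x by rewrite /N nearC.
have Ni x x' y : c k x = c k x' -> N x y = N x' y.
  by move=> /c_nested e; rewrite /N (near_inv y e).
have -> : bil v u = \sum_x \sum_y v x * u y * N x y * B x y +
    \sum_x \sum_y v x * ((1 - N x y) * u y) * B x y.
  rewrite -big_split; apply: eq_bigr => x _; rewrite -big_split.
  by apply: eq_bigr => y _ /=; ring.
apply: (le_trans (ler_normD _ _)); rewrite mulrDl; apply: lerD; last first.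
  apply: (le_trans (cancellation (leqnn _) v0 _ _)).
  - by move=> x x' y e; rewrite /N (near_inv y e).
  - move=> x y _; rewrite /N; case: (boolP (near k x y)) => [_|nn _].
      by rewrite subrr mul0r eqxx.
    rewrite leqNgt; apply: contra nn => d; apply/existsP; exists x; apply/existsP; exists y.
    by rewrite !eqxx.
  apply: (@le_trans _ _ (q ^- k.+1 * (C1 * q ^+ (k.+1 + a0) * (wnorm v * wnorm u)))).
    apply: ler_wpM2l; first by rewrite invr_ge0 exprn_ge0 // ltW.
    apply: le_trans (far_schur (k.+1 + a0) v u).
    apply: ler_sum => x _; apply: ler_sum => y _; rewrite !normrM.
    apply: ler_wpM2r => //; apply: ler_wpM2l => //; apply: ler_piMl => //.
    by rewrite /N; case: (near k x y); rewrite ?subrr ?subr0 ?normr0 ?normr1.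
  have -> : q ^- k.+1 * (C1 * q ^+ (k.+1 + a0) * (wnorm v * wnorm u)) =
    (q ^- k.+1 * q ^+ (k.+1 + a0)) * (C1 * (wnorm v * wnorm u)) by ring.
  rewrite qVq ?leq_addr // addKn -[leRHS]mul1r; apply: ler_wpM2r.
    by rewrite !mulr_ge0 ?wnorm_ge0.
  by rewrite exprn_ile1 // ltW.
pose T x y := v x * u y * N x y * (w x / mass k x) * (w y / mass k y) * bil (cind k x) (cind k y).
have -> : \sum_x \sum_y v x * u y * N x y * B x y = \sum_x \sum_y T x y.
  transitivity (\sum_x \sum_y v x * u y * N x y * (w y / mass k y) * (\sum_z cind k y z * B x z)).
    apply: eq_bigr => x _.
    rewrite -(@spread k (fun y => v x * u y * N x y)) //.
    by move=> y y' e; rewrite (ui _ _ e) NC (Ni _ _ x e) NC.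
  rewrite exchange_big [RHS]exchange_big; apply: eq_bigr => y _ /=.
  pose psi x := \sum_z cind k y z * B x z.
  transitivity (\sum_x (v x * u y * N x y * (w y / mass k y)) * psi x) => //.
  rewrite -(@spread k (fun x => v x * u y * N x y * (w y / mass k y))); last first.
    by move=> x x' e; rewrite (vi _ _ e) (Ni _ _ y e).
  apply: eq_bigr => x _; rewrite /T.
  have -> : \sum_z cind k x z * psi z = bil (cind k x) (cind k y).
    apply: eq_bigr => z _; rewrite /psi mulr_sumr; apply: eq_bigr => z' _; ring.
  ring.
(* Being 0 or 1, [N] can be given to both majorants in Schur's test, so that the row and the column
   sums each run over neighbours only. *)
have N01 x y : N x y * N x y = N x y.
  by rewrite /N; case: near; rewrite ?mulr1 ?mulr0.
have N0 x y : 0 <= N x y by rewrite /N ler0n.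
apply: (@le_trans _ _ (\sum_x \sum_y `|T x y|)).
  apply: (le_trans (ler_norm_sum _ _ _)); apply: ler_sum => x _; exact: ler_norm_sum.
apply: (sum_schur (T := T) (M1 := fun x y => C0 * (N x y * w x * (w y / mass k y)))
  (M2 := fun x y => C0 * (N x y * w y * (w x / mass k x)))).
- by rewrite mulr_ge0.
- by move=> x y; rewrite !mulr_ge0 ?invr_ge0 // ltW.
- by move=> x y; rewrite !mulr_ge0 ?invr_ge0 // ltW.
- move=> x y.
  have b2 : bil (cind k x) (cind k y) ^+ 2 <= C0 ^+ 2 * (mass k x * mass k y).
    have := @bil_cind_le k x y (ltnW kn).
    rewrite -(ler_pXn2r (ltn0Sn 1)) ?nnegrE ?mulr_ge0 ?sqrtr_ge0 //.
    by rewrite real_normK ?num_real // !exprMn !sqr_sqrtr ?(ltW (mass0 _ _)).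
  have -> : T x y ^+ 2 =
     (v x ^+ 2 * u y ^+ 2 * N x y * (w x / mass k x) ^+ 2 * (w y / mass k y) ^+ 2) *
     bil (cind k x) (cind k y) ^+ 2.
    by rewrite /T -{2}N01; ring.
  apply: (@le_trans _ _ ((v x ^+ 2 * u y ^+ 2 * N x y * (w x / mass k x) ^+ 2 * (w y / mass k y) ^+ 2) *
     (C0 ^+ 2 * (mass k x * mass k y)))).
    by apply: ler_wpM2l b2; rewrite !(sqr_ge0, N0, mulr_ge0).
  rewrite le_eqVlt; apply/orP; left; apply/eqP.
  rewrite -{1}N01; field.
  by rewrite !gt_eqF.
- move=> x; rewrite -mulr_sumr -mulrA; apply: ler_wpM2l => //.
  rewrite (eq_bigr (fun y => w x * (N x y * (w y / mass k y)))); last by move=> y _; ring.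
  rewrite -mulr_sumr mulrC; apply: ler_wpM2r; first exact: ltW.
  apply: le_trans (near_count x kn); rewrite [leRHS]big_mkcond.
  by apply: ler_sum => y _; rewrite /N; case: near; rewrite ?mul1r ?mul0r.
- move=> y; rewrite -mulr_sumr -mulrA; apply: ler_wpM2l => //.
  rewrite (eq_bigr (fun x => w y * (N x y * (w x / mass k x)))); last by move=> x _; ring.
  rewrite -mulr_sumr mulrC; apply: ler_wpM2r; first exact: ltW.
  apply: le_trans (near_count y kn); rewrite [leRHS]big_mkcond.
  by apply: ler_sum => x _; rewrite NC /N; case: near; rewrite ?mul1r ?mul0r.
Qed.

(** The average at the top level is a combination of at most [C2] indicators, each of which can be
    tested; Cauchy-Schwarz over these cubes costs [sqrt C2]. *)
Lemma top_bound h f : `|bil h (avg n f)| <= C0 * Num.sqrt C2 * (wnorm h * wnorm f).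
Proof.
set u := avg n f; have ui : level_inv c n u by exact: avg_inv.
have -> : bil h u = \sum_y u y * (w y / mass n y) * bil h (cind n y).
  transitivity (\sum_y u y * (\sum_x h x * B x y)).
    rewrite /bil exchange_big; apply: eq_bigr => y _; rewrite mulr_sumr.
    by apply: eq_bigr => x _; ring.
  rewrite -(spread _ ui); apply: eq_bigr => y _; congr (_ * _).
  rewrite /bil exchange_big; apply: eq_bigr => z _; rewrite mulr_sumr.
  by apply: eq_bigr => x _; ring.
apply: (@le_trans _ _ (\sum_y C0 * wnorm h * ((Num.sqrt (w y) * `|u y|) * Num.sqrt (w y / mass n y)))).
  apply: (le_trans (ler_norm_sum _ _ _)); apply: ler_sum => y _; rewrite normrM.
  apply: (le_trans (ler_wpM2l (normr_ge0 _) (testing _ _ (leqnn n)))).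
  have wm0 : 0 <= w y / mass n y by rewrite divr_ge0 // ltW.
  rewrite normrM (ger0_norm wm0).
  rewrite le_eqVlt; apply/orP; left; apply/eqP.
  rewrite sqrtrM ?(ltW (w_gt0 _)) // sqrtrV ?(ltW (mass0 _ _)) //.
  have s0 : Num.sqrt (mass n y) != 0 by rewrite gt_eqF // sqrtr_gt0.
  have -> : mass n y = Num.sqrt (mass n y) ^+ 2 by rewrite sqr_sqrtr // ltW.
  have -> : w y = Num.sqrt (w y) ^+ 2 by rewrite sqr_sqrtr // ltW.
  rewrite !sqrtr_sqr !(ger0_norm (sqrtr_ge0 _)); by field.
rewrite -mulr_sumr -!mulrA; apply: ler_wpM2l => //.
rewrite [leRHS]mulrCA; apply: ler_wpM2l; first exact: wnorm_ge0.
apply: (le_trans (sum_cauchy_schwarz_sqrt _ _ _ _)); rewrite mulrC.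
apply: ler_pM; rewrite ?sqrtr_ge0 //.
  apply: ler_wsqrtr; apply: le_trans top_count; apply: ler_sum => y _.
  by rewrite sqr_sqrtr // divr_ge0 // ltW.
apply: le_trans (wnorm_avg w_gt0 c_inj c_nested n f); apply: ler_wsqrtr.
apply: ler_sum => y _; rewrite exprMn sqr_sqrtr ?(ltW (w_gt0 _)) //.
by rewrite real_normK ?num_real.
Qed.

Let Cq := 2 / (1 - q).

Lemma sum_half_rev l m : (m <= l.+1)%N -> \sum_(k < m) q ^+ (l - k)./2 <= Cq.
Proof.
move=> ml; apply: (@le_trans _ _ (\sum_(k < l.+1) q ^+ (l - k)./2)).
  rewrite -!(big_mkord xpredT (fun k => q ^+ (l - k)./2)) [leRHS](big_cat_nat (n := m)) //=.
  by rewrite lerDl; apply: sumr_ge0 => k _; rewrite exprn_ge0 // ltW.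
rewrite (reindex_inj rev_ord_inj) /=.
rewrite (eq_bigr (fun k : 'I_l.+1 => q ^+ (k : nat)./2)); first exact: sum_expr_half_le.
by move=> k _; rewrite subSS subKn // -ltnS.
Qed.

(** This is the density of [T 1], the symbol of the paraproduct. *)
Definition rowavg x := rowsum x / w x.
Definition Kcar := 2 * (C0 ^+ 2 + C1 ^+ 2 * Cq).

Lemma Cq_ge1 : 0 <= Cq.
Proof. by rewrite divr_ge0 // subr_ge0 ltW. Qed.

Lemma Kcar_ge0 : 0 <= Kcar.
Proof. by rewrite mulr_ge0 // addr_ge0 ?sqr_ge0 // mulr_ge0 ?sqr_ge0 // Cq_ge1. Qed.

Lemma diff_mul_ip k v h : level_inv c k.+1 v ->
  (forall x, v x = 0 \/ v x = 1) ->
  wnorm (fun x => v x * diff k h x) ^+ 2 = ip (fun x => v x * diff k h x) h.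
Proof.
move=> vi v01; rewrite wnorm_sqr //.
transitivity (ip (fun x => v x * diff k h x) (diff k h)).
  apply: eq_bigr => x _; rewrite -!mulrA; congr (_ * _); case: (v01 x) => ->; ring.
rewrite -diff_adj //; apply: eq_ip => // x; rewrite diff_pull // diff_diff //.
by rewrite eqxx.
Qed.

(** The density of [T 1_Q] is bounded by duality: testing on [Q] is applied with the density itself
    as the other argument, and one factor of its norm cancels. *)
Lemma local_rowavg l x : (l <= n)%N ->
  wnorm (fun y => (\sum_z cind l x z * B y z) / w y) <= C0 * Num.sqrt (mass l x).
Proof.
move=> ln; set bS := fun y => (\sum_z cind l x z * B y z) / w y.
have e : wnorm bS ^+ 2 = bil bS (cind l x).
  rewrite wnorm_sqr //; apply: eq_bigr => y _.
  rewrite [w y * _]mulrC -mulrA [w y * _]mulrC /bS mulfVK; last by rewrite gt_eqF.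
  by rewrite mulr_sumr; apply: eq_bigr => z _; rewrite mulrA.
have := testing x bS ln; rewrite -e => h.
have {}h := le_trans (ler_norm _) h.
have := wnorm_ge0 w bS; rewrite le_eqVlt => /orP[/eqP <-|p].
  by rewrite mulr_ge0 ?sqrtr_ge0.
by move: h; rewrite expr2 ler_pM2r.
Qed.

(** A good lower cube inside a cube [Q] of level [l] is far from the complement of [Q], so the
    differences of [T 1] restricted to that complement are small by smoothness. The norm is again
    found by pairing the function with itself. *)
Lemma far_rowavg k l x : (k + r <= l)%N -> (l <= n)%N ->
  wnorm (fun y => (cind l x y * (G k y)%:R) *
    diff k (fun y => (\sum_z (1 - cind l x z) * B y z) / w y) y)
  <= C1 * q ^+ (l - k)./2 * Num.sqrt (mass l x).
Proof.
move=> kl ln; set bS := fun y => (\sum_z (1 - cind l x z) * B y z) / w y.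
set v := fun y => cind l x y * (G k y)%:R * diff k bS y.
have kl1 : (k.+1 <= l)%N by nat_lia.
pose a := (k.+1 + (l - k)./2)%N.
have ka : (k.+1 + a0 <= a)%N.
  by rewrite leq_add2l (leq_trans r_a0) //; apply: half_leq; nat_lia.
have phi_inv : level_inv c k.+1 (fun y => cind l x y * (G k y)%:R : R).
  by move=> y z e; rewrite (cind_inv x kl1 e) (G_inv e).
have v0 y : avg k.+1 v y = 0.
  by rewrite avg_pull // avg_diff_gt // mulr0.
have e : wnorm v ^+ 2 = \sum_y \sum_z v y * (1 - cind l x z) * B y z.
  rewrite diff_mul_ip //; last first.
    by move=> y; rewrite /cind; case: eqP => _; case: (G k y); rewrite ?mulr1 ?mulr0; auto.
  apply: eq_bigr => y _; rewrite -/(v y) [w y * _]mulrC -mulrA [w y * _]mulrC /bS mulfVK.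
    by rewrite mulr_sumr; apply: eq_bigr => z _; rewrite mulrA.
  by rewrite gt_eqF.
have h : wnorm v ^+ 2 <= C1 * q ^+ (l - k)./2 * Num.sqrt (mass l x) * wnorm v.
  rewrite e; apply: (le_trans (ler_norm _)).
  apply: (le_trans (cancellation (H := fun y z => 1 - cind l x z) ka v0 _ _)) => //.
    move=> y z; rewrite /v /cind; case: (eqVneq (c l y) (c l x)) => [ey|_]; last by rewrite !mul0r eqxx.
    case: (boolP (G k y)) => [Gy _|]; last by rewrite mulr0 mul0r eqxx.
    case: (eqVneq (c l z) (c l x)) => [_|nz _]; first by rewrite subrr eqxx.
    by apply: G_good Gy _ => //; rewrite ey; apply/eqP; rewrite eq_sym.
  apply: (@le_trans _ _ (q ^- k.+1 * (C1 * q ^+ a * (Num.sqrt (mass l x) * wnorm v)))).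
    apply: ler_wpM2l; first by rewrite invr_ge0 exprn_ge0 // ltW.
    apply: (@le_trans _ _ (\sum_y \sum_z `|cind l x y * v y * farw a y z|)); last first.
      by rewrite -wnorm_cind; exact: far_diag.
    apply: ler_sum => y _; apply: ler_sum => z _; rewrite !normrM.
    apply: ler_wpM2r => //.
    have -> : `|cind l x y| * (`|cind l x y| * `|(G k y)%:R| * `|diff k bS y|) =
      `|cind l x y| * `|(G k y)%:R| * `|diff k bS y|.
      by rewrite /cind; case: eqP => _; rewrite ?normr1 ?normr0 ?mul0r ?mul1r.
    apply: ler_piMr; first by rewrite !mulr_ge0.
    by rewrite /cind; case: eqP => _; rewrite ?subrr ?subr0 ?normr0 ?normr1.
  rewrite le_eqVlt; apply/orP; left; apply/eqP.
  have -> : q ^- k.+1 * (C1 * q ^+ a * (Num.sqrt (mass l x) * wnorm v)) =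
    (q ^- k.+1 * q ^+ a) * (C1 * Num.sqrt (mass l x) * wnorm v) by ring.
  rewrite qVq; last by rewrite /a leq_addr.
  by rewrite /a addKn; ring.
have := wnorm_ge0 w v; rewrite le_eqVlt => /orP[/eqP <-|p].
  by rewrite mulr_ge0 ?sqrtr_ge0.
by move: h; rewrite expr2 ler_pM2r.
Qed.

(** The square of the difference at level [j - r] is charged to level [j], because the paraproduct
    pairs it with the average of the other function at that level. *)
Definition para j y :=
  if (r <= j)%N then (G (j - r)%N y)%:R * diff (j - r) rowavg y ^+ 2 else 0.

Lemma para_ge0 j y : 0 <= para j y.
Proof. by rewrite /para; case: ifP => // _; rewrite mulr_ge0 ?sqr_ge0. Qed.

(** [T 1] is split into [T 1_Q] and the contribution of the complement of [Q]. The first is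
    controlled by testing and orthogonality of differences, the second by [far_rowavg] and a
    geometric sum; the factor 2 in [Kcar] comes from squaring the sum. *)
Lemma packing l x : (l <= n)%N -> avg l (fun y => \sum_(j < l.+1) para j y) x <= Kcar.
Proof.
move=> ln; rewrite avg_sum //.
pose bS y := (\sum_z cind l x z * B y z) / w y.
pose bS' y := (\sum_z (1 - cind l x z) * B y z) / w y.
have bE y : rowavg y = bS y + bS' y.
  rewrite /rowavg /bS /bS' -mulrDl -big_split; congr (_ / _).
  by apply: eq_bigr => z _ /=; ring.
have -> : \sum_(j < l.+1) avg l (para j) x =
    (\sum_(j < l.+1) \sum_y w y * (cind l x y * para j y)) / mass l x.
  rewrite mulr_suml; apply: eq_bigr => j _; congr (_ / _).
  rewrite -sum_cind; apply: eq_bigr => y _; ring.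
rewrite ler_pdivrMr //.
pose v k y := (cind l x y * (G k y)%:R) * diff k bS' y.
have step (j : 'I_l.+1) : \sum_y w y * (cind l x y * para j y) <=
    (if (r <= j)%N then 2 * wnorm (diff (j - r) bS) ^+ 2 else 0) +
    (if (r <= j)%N then 2 * (C1 ^+ 2 * mass l x) * q ^+ (l - (j - r))./2 else 0).
  rewrite /para; case: ifP => rj; last by rewrite addr0 big1 // => y _; rewrite !mulr0.
  apply: (@le_trans _ _ (2 * wnorm (diff (j - r) bS) ^+ 2 + 2 * wnorm (v (j - r)%N) ^+ 2)).
    rewrite !wnormE // !mulr_sumr -big_split; apply: ler_sum => y _ /=.
    rewrite (eq_diff w c (j - r) bE) diffD //.
    have -> (s t : R) : 2 * (w y * s) + 2 * (w y * t) = w y * (2 * s + 2 * t) by ring.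
    apply: ler_wpM2l; first exact: ltW.
    rewrite /v; move: (diff _ bS y) (diff _ bS' y) => s t.
    have := sqr_ge0 (s - t); have := sqr_ge0 s; have := sqr_ge0 t.
    by rewrite /cind; case: eqP => _; case: (G _ y) => /=; nra.
  rewrite lerD2l -mulrA; apply: ler_wpM2l => //.
  have h : wnorm (v (j - r)%N) <= _ := @far_rowavg (j - r) l x _ ln.
  have {}h := h (_ : _).
  have : (j - r + r <= l)%N by rewrite subnK // -ltnS.
  move=> /h {}h.
  apply: (@le_trans _ _ ((C1 * q ^+ (l - (j - r))./2 * Num.sqrt (mass l x)) ^+ 2)).
    by rewrite lerXn2r // nnegrE ?wnorm_ge0 // mulr_ge0 ?sqrtr_ge0.
  rewrite !exprMn sqr_sqrtr ?(ltW (mass0 _ _)) // [leRHS]mulrAC.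
  apply: ler_wpM2r; first exact: ltW.
  apply: ler_wpM2l; first exact: sqr_ge0.
  (* One of the two decaying factors is dropped, so that the sum over levels is the one already
     bounded by [Cq]. *)
  by rewrite expr2; apply: ler_piMl; rewrite ?exprn_ge0 ?exprn_ile1 // ltW.
apply: (le_trans (ler_sum _ (fun j _ => step j))).
rewrite big_split /= (sum_shift (fun k => 2 * wnorm (diff k bS) ^+ 2)).
rewrite (sum_shift (fun k => 2 * (C1 ^+ 2 * mass l x) * q ^+ (l - k)./2)) -!mulr_sumr.
have -> : Kcar * mass l x = 2 * (C0 ^+ 2 * mass l x) + 2 * (C1 ^+ 2 * mass l x) * Cq.
  by rewrite /Kcar; ring.
apply: lerD.
  apply: ler_wpM2l => //; apply: le_trans (sum_wnorm_diff w_gt0 c_inj c_nested _ _) _.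
  have := @local_rowavg l x ln; rewrite -/bS => h.
  apply: (@le_trans _ _ ((C0 * Num.sqrt (mass l x)) ^+ 2)).
    by rewrite lerXn2r // nnegrE ?wnorm_ge0 // mulr_ge0 ?sqrtr_ge0.
  by rewrite exprMn sqr_sqrtr // ltW.
apply: ler_wpM2l; last by apply: sum_half_rev; nat_lia.
by rewrite !mulr_ge0 ?sqr_ge0 // ltW.
Qed.

(** Cauchy-Schwarz against the differences of [g] leaves squares of averages of [f] weighted by
    [para], which is the Carleson embedding; its constant [4 * Kcar] becomes [2 * sqrt Kcar]. *)
Lemma paraproduct f g : (forall k x, diff k g x != 0 -> G k x) ->
  `|\sum_(k < n | (k + r <= n)%N) \sum_x diff k g x * avg (k + r) f x * rowsum x|
   <= 2 * Num.sqrt Kcar * (wnorm g * wnorm f).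
Proof.
move=> gG.
pose h k x := (G k x)%:R * avg (k + r) f x * diff k rowavg x.
have hE k : \sum_x diff k g x * avg (k + r) f x * rowsum x = ip (diff k g) (h k).
  transitivity (ip (diff k g) (fun x => (G k x)%:R * avg (k + r) f x * rowavg x)).
    apply: eq_bigr => x _; rewrite /rowavg.
    have [->|/gG ->] := eqVneq (diff k g x) 0; first by rewrite !(mul0r, mulr0).
    by rewrite mul1r; field; rewrite gt_eqF.
  (* A second copy of the projection [diff k] is inserted and moved to the other side, where it hits
     only [rowavg]: the remaining factors are invariant at level [k.+1], as [r > 0]. *)
  transitivity (ip (diff k (diff k g)) (fun x => (G k x)%:R * avg (k + r) f x * rowavg x)).
    by apply: eq_ip => // x; rewrite diff_diff // eqxx.
  rewrite diff_adj //; apply: eq_ip => // x; rewrite diff_pull // => y z e.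
  rewrite (G_inv e); congr (_ * _); apply: avg_inv.
  by apply: nested_le e => //; rewrite -addn1 leq_add2l.
apply: (le_trans (ler_norm_sum _ _ _)).
apply: (@le_trans _ _ (\sum_(k < n | (k + r <= n)%N) wnorm (diff k g) * wnorm (h k))).
  by apply: ler_sum => k _; rewrite hE; exact: ip_wnorm.
apply: (le_trans (sum_cauchy_schwarz_sqrt _ _ _ _)).
rewrite mulrCA; apply: ler_pM; rewrite ?sqrtr_ge0 //.
  rewrite -[leRHS]ger0_norm ?wnorm_ge0 // -sqrtr_sqr; apply: ler_wsqrtr.
  apply: le_trans (sum_wnorm_diff w_gt0 c_inj c_nested n g); rewrite big_mkcond.
  by apply: ler_sum => k _; case: ifP => // _; rewrite sqr_ge0.
have -> : 2 * Num.sqrt Kcar * wnorm f = Num.sqrt (4 * Kcar * wnorm f ^+ 2).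
  have -> : 4 * Kcar * wnorm f ^+ 2 = (2 * Num.sqrt Kcar * wnorm f) ^+ 2.
    by rewrite !exprMn (sqr_sqrtr Kcar_ge0); ring.
  by rewrite sqrtr_sqr ger0_norm // !mulr_ge0 ?sqrtr_ge0 ?wnorm_ge0.
apply: ler_wsqrtr; apply: le_trans (carleson_embedding w_gt0 c_inj c_nested f Kcar_ge0 para_ge0 packing).
rewrite (eq_bigr (fun j : 'I_n.+1 => if (r <= j)%N then wnorm (h (j - r)%N) ^+ 2 else 0)).
  rewrite (sum_shift (fun k => wnorm (h k) ^+ 2)).
  rewrite -(big_mkord (fun k => (k + r <= n)%N) (fun k => wnorm (h k) ^+ 2)).
  rewrite -(big_mkord xpredT (fun k => wnorm (h k) ^+ 2)).
  rewrite (big_cat_nat (n := (n.+1 - r)%N)) /=; [|nat_lia|nat_lia].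
  rewrite [X in _ + X]big_nat_cond [X in _ + X]big1 ?addr0; last by move=> k; nat_lia.
  rewrite [leLHS]big_mkcond /=; apply: ler_sum => k _.
  by case: ifP => // _; rewrite sqr_ge0.
move=> j _; rewrite /para; case: ifP => rj; last by apply: big1 => x _; rewrite mul0r mulr0.
rewrite wnormE //; apply: eq_bigr => x _; rewrite /h subnK //; congr (_ * _).
by rewrite !exprMn; case: (G _ x); rewrite ?expr0n ?expr1n ?mul0r ?mul1r // mulrC.
Qed.

(** The three terms account for at most [r] comparable levels on either side, for the errors at
    distant levels, and for the paraproduct. *)
Definition Cside := (C0 * C2 + C1) * r%:R + 2 * C1 * Cq + 2 * Num.sqrt Kcar.

(** Schur's test in the level indices, followed by orthogonality of the differences. *)
Lemma sum_levels (M : nat -> nat -> R) C f g : 0 <= C -> (forall k l, 0 <= M k l) ->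
  (forall k, (k < n)%N -> \sum_(l < n) M k l <= C) ->
  (forall l, (l < n)%N -> \sum_(k < n) M k l <= C) ->
  \sum_(k < n) \sum_(l < n) M k l * (wnorm (diff k g) * wnorm (diff l f)) <=
  C * (wnorm g * wnorm f).
Proof.
move=> Cge0 M0 h1 h2.
have := @sum_schur R 'I_n 'I_n (fun k l => M k l * (wnorm (diff k g) * wnorm (diff l f)))
  (fun k l => M k l) (fun k l => M k l) (fun k => wnorm (diff k g)) (fun=> 1)
  (fun k => wnorm (diff k f)) (fun=> 1) C Cge0.
move=> /(_ (fun k l => M0 k l) (fun k l => M0 k l)) H.
apply: le_trans (_ : _ <= \sum_(k < n) \sum_(l < n) `|M k l * (wnorm (diff k g) * wnorm (diff l f))|) _.
  by apply: ler_sum => k _; apply: ler_sum => l _; exact: ler_norm.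
apply: (le_trans (H _ _ _)).
- by move=> k l; rewrite le_eqVlt; apply/orP; left; apply/eqP; ring.
- by move=> k; rewrite mulr1; exact: h1.
- by move=> k; rewrite mulr1; exact: h2.
apply: ler_wpM2l => //.
have E h : Num.sqrt (\sum_(k < n) 1 * wnorm (diff k h) ^+ 2) <= wnorm h.
  rewrite -[leRHS]ger0_norm ?wnorm_ge0 // -sqrtr_sqr; apply: ler_wsqrtr.
  under eq_bigr do rewrite mul1r.
  exact: sum_wnorm_diff.
by apply: ler_pM; rewrite ?sqrtr_ge0.
Qed.

(** The offset [e] is 0 for the form and 1 for its transpose, so that equal levels are counted
    exactly once when the two halves are added. *)
Lemma one_sided e f g : (e <= r)%N -> (forall k x, diff k g x != 0 -> G k x) ->
  (forall x, avg n f x = 0) ->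
  `|\sum_(k < n) \sum_(l < n | (k + e <= l)%N) bil (diff k g) (diff l f)| <=
  Cside * (wnorm g * wnorm f).
Proof.
move=> er gG f0.
have avgf0 k x : avg k.+1 (diff k g) x = 0 by rewrite avg_diff_gt.
pose main k l := \sum_x diff k g x * diff l f x * rowsum x.
pose Mn k l : R := if ((k + e <= l) && (l < k + r))%N then C0 * C2 + C1 else 0.
pose Mo k l : R := if (k + r <= l)%N then 2 * C1 * q ^+ (l - k)./2 else 0.
pose N k l := wnorm (diff k g) * wnorm (diff l f).
have N0 k l : 0 <= N k l by rewrite mulr_ge0 ?wnorm_ge0.
have CC0 : 0 <= C0 * C2 + C1 by rewrite addr_ge0 ?mulr_ge0.
pose P := \sum_(k < n) \sum_(l < n | (k + r <= l)%N) main k l.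
(* The differences of [f] from level [k + r] upwards telescope to [avg (k + r) f], because the
   average at level [n] vanishes. *)
have PE : P = \sum_(k < n | (k + r <= n)%N) \sum_x diff k g x * avg (k + r) f x * rowsum x.
  rewrite /P [RHS]big_mkcond; apply: eq_bigr => k _; case: ifP => krn; last first.
    by rewrite big_pred0 // => l; have := ltn_ord l; nat_lia.
  rewrite /main exchange_big; apply: eq_bigr => x _ /=.
  rewrite -mulr_suml -mulr_sumr; congr (_ * _ * _).
  rewrite -[RHS]subr0 -[X in _ = _ - X](f0 x) -(sum_diff w c f x krn).
  rewrite -(big_mkord (fun l => (k + r <= l)%N) (fun l => diff l f x)).
  rewrite (big_cat_nat (n := (k + r)%N)) //= [X in X + _]big_nat_cond [X in X + _]big1 ?add0r.
    by rewrite big_nat_cond [RHS]big_nat_cond; apply: eq_bigl => l; nat_lia.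
  by move=> l; nat_lia.
have key k l : (k < n)%N -> (l < n)%N -> (k + e <= l)%N ->
    `|bil (diff k g) (diff l f) - (if (k + r <= l)%N then main k l else 0)| <=
    (Mn k l + Mo k l) * N k l.
  move=> kn ln kel; rewrite /Mn /Mo kel /=; case: leqP => krl.
    rewrite add0r; apply: (off_diagonal krl (ltnW ln) (avgf0 k) (gG k)).
    exact: diff_inv.
  rewrite addr0 subr0; apply: (@near_diagonal k) => //; first by apply: diff_inv.
  by move=> x y xy; apply: diff_inv => //; apply: nested_le xy => //; nat_lia.
have SM : \sum_(k < n) \sum_(l < n) (Mn k l + Mo k l) * N k l <=
    ((C0 * C2 + C1) * r%:R + 2 * C1 * Cq) * (wnorm g * wnorm f).
  have -> : \sum_(k < n) \sum_(l < n) (Mn k l + Mo k l) * N k l =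
     \sum_(k < n) \sum_(l < n) Mn k l * N k l + \sum_(k < n) \sum_(l < n) Mo k l * N k l.
    by rewrite -big_split; apply: eq_bigr => k _; rewrite -big_split; apply: eq_bigr => l _ /=; rewrite mulrDl.
  rewrite mulrDl; apply: lerD; [apply: (@sum_levels Mn)|apply: (@sum_levels Mo)].
  - by rewrite mulr_ge0.
  - by move=> k l; rewrite /Mn; case: ifP.
  - move=> k kn; rewrite (sum_window (C0 * C2 + C1)) mulr_natr; apply: ler_wpMn2l => //; nat_lia.
  - move=> l ln.
    rewrite (eq_bigr (fun k : 'I_n => if (l.+1 - r <= k < l.+1 - e)%N then C0 * C2 + C1 else 0)).
      by rewrite (sum_window (C0 * C2 + C1)) mulr_natr; apply: ler_wpMn2l => //; nat_lia.
    by move=> k _; rewrite /Mn; congr (if _ then _ else _); nat_lia.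
  - by apply: mulr_ge0; [rewrite mulr_ge0|exact: Cq_ge1].
  - by move=> k l; rewrite /Mo; case: ifP => // _; rewrite !mulr_ge0 ?exprn_ge0 // ltW.
  - move=> k kn; apply: (@le_trans _ _ (\sum_(l < n) 2 * C1 * (if (k <= l)%N then q ^+ (l - k)./2 else 0))).
      apply: ler_sum => l _; rewrite /Mo; case: (leqP (k + r) l) => krl.
        by have -> : (k <= l)%N by nat_lia.
      by rewrite !mulr_ge0 //; case: ifP => // _; rewrite exprn_ge0 // ltW.
    rewrite -mulr_sumr (sum_shift (fun i => q ^+ i./2)); apply: ler_wpM2l.
      by rewrite mulr_ge0.
    exact: sum_expr_half_le.
  - move=> l ln; apply: (@le_trans _ _ (\sum_(k < n | (k < l.+1)%N) 2 * C1 * q ^+ (l - k)./2)).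
      rewrite [leRHS]big_mkcond; apply: ler_sum => k _; rewrite /Mo; case: (leqP (k + r) l) => krl.
        by have -> : (k < l.+1)%N by nat_lia.
      by case: ifP => // _; rewrite !mulr_ge0 ?exprn_ge0 // ltW.
    rewrite -(big_ord_widen n (fun k => 2 * C1 * q ^+ (l - k)./2) ln) -mulr_sumr.
    by apply: ler_wpM2l; rewrite ?mulr_ge0 // sum_half_rev.
have -> : \sum_(k < n) \sum_(l < n | (k + e <= l)%N) bil (diff k g) (diff l f) =
  P + \sum_(k < n) \sum_(l < n | (k + e <= l)%N)
    (bil (diff k g) (diff l f) - (if (k + r <= l)%N then main k l else 0)).
  rewrite /P -big_split; apply: eq_bigr => k _; rewrite /= sumrB.
  rewrite [X in _ = _ + (_ - X)]big_mkcond [X in _ = X + _]big_mkcond /=.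
  suff -> : \sum_(l < n) (if (k + r <= l)%N then main k l else 0) =
     \sum_(l < n) (if (k + e <= l)%N then if (k + r <= l)%N then main k l else 0 else 0) by ring.
  by apply: eq_bigr => l _; case: ifP => // krl; case: ifP => //; nat_lia.
apply: (le_trans (ler_normD _ _)); rewrite /Cside mulrDl addrC; apply: lerD; last first.
  by rewrite PE; exact: paraproduct.
apply: le_trans SM; apply: (le_trans (ler_norm_sum _ _ _)); apply: ler_sum => k _.
apply: (le_trans (ler_norm_sum _ _ _)); rewrite big_mkcond; apply: ler_sum => l _.
case: ifP => kel; first exact: key.
rewrite mulr_ge0 // addr_ge0 // /Mn /Mo; case: ifP => // _.
by rewrite !mulr_ge0 ?exprn_ge0 // ltW.
Qed.

End OneSided.

(** * Algebra of bilinear forms *)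

Section BilinearForms.
Context {R : rcfType} {X : finType}.
Implicit Types (B : X -> X -> R) (f g : X -> R).

Lemma bil_flip B g f : bil (fun x y => B y x) g f = bil B f g.
Proof.
rewrite /bil exchange_big; apply: eq_bigr => x _; apply: eq_bigr => y _; ring.
Qed.

Lemma eq_bil B g g' f f' : g =1 g' -> f =1 f' -> bil B g f = bil B g' f'.
Proof. by move=> e e'; apply: eq_bigr => x _; apply: eq_bigr => y _; rewrite e e'. Qed.

Lemma bilDr B g f f' : bil B g (fun x => f x + f' x) = bil B g f + bil B g f'.
Proof.
rewrite /bil -big_split; apply: eq_bigr => x _; rewrite -big_split.
by apply: eq_bigr => y _ /=; ring.
Qed.

Lemma bilDl B g g' f : bil B (fun x => g x + g' x) f = bil B g f + bil B g' f.
Proof. by rewrite -[LHS](bil_flip B) bilDr (bil_flip B f g) (bil_flip B f g'). Qed.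

Lemma bil_sumr B g (J : Type) (r : seq J) (P : pred J) (F : J -> X -> R) :
  bil B g (fun x => \sum_(j <- r | P j) F j x) = \sum_(j <- r | P j) bil B g (F j).
Proof.
rewrite /bil [RHS]exchange_big; apply: eq_bigr => x _; rewrite [RHS]exchange_big.
by apply: eq_bigr => y _; rewrite mulr_sumr mulr_suml.
Qed.

Lemma bil_suml B f (J : Type) (r : seq J) (P : pred J) (F : J -> X -> R) :
  bil B (fun x => \sum_(j <- r | P j) F j x) f = \sum_(j <- r | P j) bil B (F j) f.
Proof.
by rewrite -[LHS](bil_flip B) bil_sumr; apply: eq_bigr => j _; exact: (bil_flip B).
Qed.

End BilinearForms.

(** * Averaging over lattices *)

Section RandomLevels.
Context {R : rcfType} {X S : finType} {I : eqType} (w : X -> R) (c : S -> nat -> X -> I).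
Hypothesis w_gt0 : forall x, 0 < w x.
Hypothesis c_inj : forall s x y, c s 0 x = c s 0 y -> x = y.
Hypothesis c_nested : forall s k x y, c s k x = c s k y -> c s k.+1 x = c s k.+1 y.
Variables (dist : X -> X -> nat) (th : X -> X -> R) (B ker ker' : X -> X -> R).
Variables (n r a0 : nat) (q C0 C1 C2 : R) (G : S -> nat -> X -> bool).
Hypothesis q01 : 0 < q < 1.
Hypothesis C0_ge0 : 0 <= C0.
Hypothesis C1_ge0 : 0 <= C1.
Hypothesis C2_ge0 : 0 <= C2.
Hypothesis distC : forall x y, dist x y = dist y x.
Hypothesis thC : forall x y, th x y = th y x.
Hypothesis th_ge0 : forall x y, 0 <= th x y.
Hypothesis diam : forall s k x y, c s k x = c s k y -> (dist x y < 2 ^ k)%N.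
Hypothesis tail : forall x a,
  \sum_(y | (2 ^ a <= dist x y)%N) w y * th x y <= C1 * q ^+ a.
Hypothesis smooth_l : forall j x x0 y, (dist x x0 < 2 ^ j)%N ->
  (2 ^ (j + a0) <= dist x y)%N ->
  `|B x y - w x * ker x0 y| <= w x * w y * (q ^- j * th x y).
Hypothesis smooth_r : forall j x x0 y, (dist x x0 < 2 ^ j)%N ->
  (2 ^ (j + a0) <= dist x y)%N ->
  `|B y x - w x * ker' x0 y| <= w x * w y * (q ^- j * th x y).
Hypothesis testing_l : forall s k z h, (k <= n)%N ->
  `|bil B h (cind (c s) k z)| <= C0 * Num.sqrt (mass w (c s) k z) * wnorm w h.
Hypothesis testing_r : forall s k z h, (k <= n)%N ->
  `|bil B (cind (c s) k z) h| <= C0 * Num.sqrt (mass w (c s) k z) * wnorm w h.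
Hypothesis near_count : forall s k x, (k < n)%N ->
  \sum_(y | near (c s) dist a0 k x y) w y / mass w (c s) k y <= C2.
Hypothesis top_count : forall s, \sum_y w y / mass w (c s) n y <= C2.
Hypothesis G_inv : forall s k x y, c s k.+1 x = c s k.+1 y -> G s k x = G s k y.
Hypothesis G_good : forall s k l x y, (k + r <= l)%N -> (l <= n)%N -> G s k x ->
  c s l x <> c s l y -> (2 ^ (k.+1 + (l - k)./2) <= dist x y)%N.
Hypothesis S_gt0 : (0 < #|S|)%N.
Hypothesis r_gt0 : (0 < r)%N.
Hypothesis r_a0 : (a0 <= r./2)%N.
(** The constant 32 is chosen so that the relative squared bad parts of two functions add up to at
    most 1/16 on average; some lattice then keeps both bad parts below a quarter of the norms. *)
Hypothesis G_rarely_fails : forall k x f, (k < n)%N ->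
  32 * \sum_s (if G s k x then 0 else diff w (c s) k f x ^+ 2) <=
  \sum_s diff w (c s) k f x ^+ 2.

Definition Cgood := 2 * (C0 * Num.sqrt C2) + 2 * Cside r q C0 C1 C2.

Lemma Cgood_ge0 : 0 <= Cgood.
Proof.
have /andP[q0 q1] := q01; have p : 0 < 1 - q by lra.
rewrite /Cgood /Cside !(addr_ge0, mulr_ge0) ?sqrtr_ge0 ?invr_ge0 ?ler0n //.
exact: ltW.
Qed.

(** Top averages are split off and bounded by [top_bound]. The double sum over the levels of the
    rest is cut along the diagonal, and the half with the larger cubes on the side of [g] is a
    one-sided sum for the transpose. *)
Lemma good_bound s f g :
  (forall k x, (k < n)%N -> diff w (c s) k f x != 0 -> G s k x) ->
  (forall k x, (k < n)%N -> diff w (c s) k g x != 0 -> G s k x) ->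
  `|bil B g f| <= Cgood * (wnorm w g * wnorm w f).
Proof.
move=> fG gG.
have ci := @c_inj s; have cn := @c_nested s.
pose m (h : X -> R) x := h x - avg w (c s) n h x.
have mE h x : m h x = \sum_(k < n) diff w (c s) k h x.
  by rewrite /m {1}(avg_decomp w_gt0 ci n h x); ring.
have hE h : h =1 (fun x => avg w (c s) n h x + m h x) by move=> x; rewrite /m; ring.
have m_avg h x : avg w (c s) n (m h) x = 0 by rewrite avgB // avg_avg_le // subrr.
have m_diff h k x : diff w (c s) k (m h) x = if (k < n)%N then diff w (c s) k h x else 0.
  have -> : diff w (c s) k (m h) x = diff w (c s) k h x - diff w (c s) k (avg w (c s) n h) x.
    by rewrite /diff !avgB //; ring.
  by case: ltnP => kn; [rewrite diff_avg_gt // subr0|rewrite diff_avg_le // subrr].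
have m_norm h : wnorm w (m h) <= wnorm w h.
  rewrite -(ler_pXn2r (ltn0Sn 1)) ?nnegrE ?wnorm_ge0 //.
  rewrite (wnorm_decomp w_gt0 ci cn n h) (wnorm_decomp w_gt0 ci cn n (m h)).
  have -> : wnorm w (avg w (c s) n (m h)) = 0.
    rewrite (eq_wnorm w (m_avg h)) /wnorm big1 ?sqrtr0 // => x _.
    by rewrite expr0n mulr0.
  rewrite expr0n add0r -[leLHS]add0r; apply: lerD; first exact: sqr_ge0.
  rewrite le_eqVlt; apply/orP; left; apply/eqP; apply: eq_bigr => k _.
  by congr (_ ^+ 2); apply: eq_wnorm => x; rewrite m_diff ltn_ord.
have m_good h k x : (forall k x, (k < n)%N -> diff w (c s) k h x != 0 -> G s k x) ->
    diff w (c s) k (m h) x != 0 -> G s k x.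
  move=> hG; rewrite m_diff; case: ifP => kn; last by rewrite eqxx.
  exact: hG.
have nn h := wnorm_ge0 w h.
pose Ct := C0 * Num.sqrt C2.
have Ct0 : 0 <= Ct by rewrite mulr_ge0 ?sqrtr_ge0.
rewrite (eq_bil B (fun=> erefl) (hE f)) bilDr.
apply: (le_trans (ler_normD _ _)).
have t1 : `|bil B g (avg w (c s) n f)| <= Ct * (wnorm w g * wnorm w f).
  exact: (top_bound w_gt0 ci cn C0_ge0 (@testing_l s) (@top_count s)).
have t2 : `|bil B (avg w (c s) n g) (m f)| <= Ct * (wnorm w g * wnorm w f).
  rewrite -(bil_flip B).
  have H := @top_bound R X I w (c s) w_gt0 ci cn (fun x y => B y x) n C0 C2 C0_ge0.
  apply: (le_trans (H _ (@top_count s) (m f) g)).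
    by move=> k z h kn; rewrite (bil_flip B); exact: testing_r.
  by apply: ler_wpM2l => //; rewrite mulrC; apply: ler_wpM2l.
suff t3 : `|bil B (m g) (m f)| <= 2 * Cside r q C0 C1 C2 * (wnorm w g * wnorm w f).
  rewrite [bil B g (m f)](eq_bil B (hE g) (fun=> erefl)) bilDl.
  apply: (le_trans (lerD t1 (ler_normD _ _))); rewrite /Cgood -/Ct.
  by move: (bil B (avg _ _ _ g) _) (bil B (m g) _) t2 t3 => u v; lra.
have d1 : `|\sum_(k < n) \sum_(l < n | (k + 0 <= l)%N)
    bil B (diff w (c s) k (m g)) (diff w (c s) l (m f))| <=
    Cside r q C0 C1 C2 * (wnorm w (m g) * wnorm w (m f)).
  apply: (one_sided w_gt0 ci cn q01 C0_ge0 C1_ge0 C2_ge0 distC thC th_ge0 (@diam s)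
    tail smooth_l (@testing_l s) (@near_count s) (@G_inv s)
    (@G_good s) r_gt0 r_a0) => //.
  by move=> k x; apply: m_good.
have d2 : `|\sum_(k < n) \sum_(l < n | (k + 1 <= l)%N)
    bil (fun x y => B y x) (diff w (c s) k (m f)) (diff w (c s) l (m g))| <=
    Cside r q C0 C1 C2 * (wnorm w (m f) * wnorm w (m g)).
  have tt k z h : (k <= n)%N -> `|bil (fun x y => B y x) h (cind (c s) k z)| <=
      C0 * Num.sqrt (mass w (c s) k z) * wnorm w h.
    by move=> kn; rewrite (bil_flip B); exact: testing_r.
  apply: (one_sided w_gt0 ci cn q01 C0_ge0 C1_ge0 C2_ge0 distC thC th_ge0 (@diam s)
    tail smooth_r tt (@near_count s) (@G_inv s)
    (@G_good s) r_gt0 r_a0) => //.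
  by move=> k x; apply: m_good.
have -> : bil B (m g) (m f) =
  \sum_(k < n) \sum_(l < n | (k + 0 <= l)%N)
    bil B (diff w (c s) k (m g)) (diff w (c s) l (m f)) +
  \sum_(k < n) \sum_(l < n | (k + 1 <= l)%N)
    bil (fun x y => B y x) (diff w (c s) k (m f)) (diff w (c s) l (m g)).
  have mE' h : m h =1 (fun x => \sum_(k < n) diff w (c s) k (m h) x).
    by move=> x; rewrite mE; apply: eq_bigr => k _; rewrite m_diff ltn_ord.
  rewrite (eq_bil B (mE' g) (mE' f)) bil_suml.
  transitivity (\sum_(k < n) \sum_(l < n) bil B (diff w (c s) k (m g)) (diff w (c s) l (m f))).
    by apply: eq_bigr => k _; rewrite bil_sumr.
  pose F k l := bil B (diff w (c s) k (m g)) (diff w (c s) l (m f)).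
  transitivity (\sum_(k < n) (\sum_(l < n | (k + 0 <= l)%N) F k l + \sum_(l < n | (l + 1 <= k)%N) F k l)).
    apply: eq_bigr => k _; rewrite (bigID (fun l : 'I_n => (k + 0 <= l)%N)) /=; congr (_ + _).
    by apply: eq_bigl => l; rewrite addn0 addn1 -ltnNge.
  rewrite big_split; congr (_ + _) => /=; rewrite (exchange_big_dep xpredT) //=.
  by apply: eq_bigr => k _; apply: eq_bigr => l _; rewrite (bil_flip B).
apply: (le_trans (ler_normD _ _)); apply: (le_trans (lerD d1 d2)).
have Cs0 : 0 <= Cside r q C0 C1 C2.
  have /andP[q0 q1] := q01; have p : 0 < 1 - q by lra.
  rewrite /Cside !(addr_ge0, mulr_ge0) ?sqrtr_ge0 ?invr_ge0 ?ler0n //; exact: ltW.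
have := ler_wpM2l Cs0 (ler_pM (nn _) (nn _) (m_norm g) (m_norm f)); lra.
Qed.

Definition badpart s f x :=
  \sum_(k < n) (if G s k x then 0 else diff w (c s) k f x).

(** Goodness at level [k] is constant on cubes of level [k.+1], so discarding good cubes keeps the
    mean zero of each difference and the orthogonality between levels. *)
Lemma diff_badpart s k f x : diff w (c s) k (badpart s f) x =
  if (k < n)%N then (if G s k x then 0 else diff w (c s) k f x) else 0.
Proof.
have ci := @c_inj s; have cn := @c_nested s.
rewrite /badpart diff_sum //.
pose b j y : R := if G s j y then 0 else 1.
have bi j : level_inv (c s) j.+1 (b j) by move=> y z e; rewrite /b (G_inv e).
have E j y : diff w (c s) k (fun z => if G s j z then 0 else diff w (c s) j f z) y =
    if j == k then (if G s k y then 0 else diff w (c s) k f y) else 0.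
  have e z : (if G s j z then 0 else diff w (c s) j f z) = b j z * diff w (c s) j f z.
    by rewrite /b; case: ifP; rewrite ?mul0r ?mul1r.
  rewrite (eq_diff w (c s) k e); case: ltngtP => jk.
  - rewrite {1}/diff; have H i : (j < i)%N -> avg w (c s) i (fun z => b j z * diff w (c s) j f z) y = 0.
      move=> ji; rewrite -(avg_avg_ge w_gt0 cn _ _ ji).
      rewrite (@eq_avg _ _ _ w (c s) i _ (fun=> 0)) ?avg_cst // => z.
      by rewrite avg_pull // avg_diff_gt // mulr0.
    by rewrite !H ?subrr // ltnW.
  - have inv i : (i <= j)%N -> level_inv (c s) i (fun z => b j z * diff w (c s) j f z).
      move=> ij z z' ez; rewrite (bi j z z'); last by apply: nested_le ez => //; exact: leqW.
      by congr (_ * _); apply: diff_inv => //; apply: nested_le ez.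
    by rewrite {1}/diff (avg_id w_gt0 _ (inv _ (ltnW jk))) (avg_id w_gt0 _ (inv _ jk)) subrr.
  - by rewrite -jk diff_pull // diff_diff // eqxx /b; case: ifP; rewrite ?mul0r ?mul1r.
rewrite (eq_bigr (fun j : 'I_n => if (j : nat) == k then (if G s k x then 0 else diff w (c s) k f x) else 0)) //.
rewrite -big_mkcond; case: (ltnP k n) => kn.
  by rewrite (big_pred1 (Ordinal kn)) // => j; rewrite -val_eqE.
by rewrite big_pred0 // => j; apply/eqP => jk; move: (ltn_ord j); rewrite jk ltnNge kn.
Qed.

Lemma avg_badpart s f x : avg w (c s) n (badpart s f) x = 0.
Proof.
have cn := @c_nested s.
rewrite /badpart avg_sum //; apply: big1 => k _.
pose b y : R := if G s k y then 0 else 1.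
have bi : level_inv (c s) k.+1 b by move=> y z e; rewrite /b (G_inv e).
rewrite -(avg_avg_ge w_gt0 cn _ _ (ltn_ord k)).
rewrite (@eq_avg _ _ _ w (c s) n _ (fun=> 0)) ?avg_cst // => z.
rewrite (@eq_avg _ _ _ w (c s) k.+1 _ (fun z => b z * diff w (c s) k f z)).
  by rewrite avg_pull // avg_diff_gt // mulr0.
by move=> y; rewrite /b; case: ifP; rewrite ?mul0r ?mul1r.
Qed.

Lemma wnorm_badpart s f : wnorm w (badpart s f) ^+ 2 =
  \sum_(k < n) \sum_x w x * (if G s k x then 0 else diff w (c s) k f x ^+ 2).
Proof.
have ci := @c_inj s; have cn := @c_nested s.
rewrite (wnorm_decomp w_gt0 ci cn n).
have -> : wnorm w (avg w (c s) n (badpart s f)) = 0.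
  rewrite (eq_wnorm w (avg_badpart s f)) /wnorm big1 ?sqrtr0 // => x _.
  by rewrite expr0n mulr0.
rewrite expr0n add0r; apply: eq_bigr => k _; rewrite wnormE //; apply: eq_bigr => x _.
by rewrite diff_badpart ltn_ord; case: ifP; rewrite ?expr0n.
Qed.

Lemma sum_wnorm_badpart f :
  32 * \sum_s wnorm w (badpart s f) ^+ 2 <= #|S|%:R * wnorm w f ^+ 2.
Proof.
have -> : #|S|%:R * wnorm w f ^+ 2 = \sum_(s : S) wnorm w f ^+ 2.
  by rewrite sumr_const mulr_natl.
apply: (@le_trans _ _ (\sum_s \sum_(k < n) wnorm w (diff w (c s) k f) ^+ 2)); last first.
  by apply: ler_sum => s _; apply: sum_wnorm_diff => //; [exact: c_inj|exact: c_nested].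
under eq_bigr do rewrite wnorm_badpart.
under [leRHS]eq_bigr => s _ do under eq_bigr do rewrite wnormE //.
rewrite exchange_big [leRHS]exchange_big mulr_sumr /=; apply: ler_sum => k _.
rewrite exchange_big [leRHS]exchange_big mulr_sumr /=; apply: ler_sum => x _.
rewrite -!mulr_sumr mulrCA; apply: ler_wpM2l; first exact: ltW.
exact: G_rarely_fails.
Qed.

(** The form splits into bad against everything, good against bad, and good against good. The first
    two cost [N / 4] each, the last is [good_bound]. *)
Lemma absorption N : 0 <= N ->
  (forall f g, `|bil B g f| <= N * (wnorm w g * wnorm w f)) ->
  forall f g, 2 * `|bil B g f| <= (2 * Cgood + N) * (wnorm w g * wnorm w f).
Proof.
move=> N0 HN f g.
have nn h := wnorm_ge0 w h.
have [f0|fn0] := eqVneq (wnorm w f) 0.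
  by have := HN f g; rewrite f0 !mulr0; lra.
have [g0|gn0] := eqVneq (wnorm w g) 0.
  by have := HN f g; rewrite g0 !mul0r !mulr0; lra.
have fp : 0 < wnorm w f by rewrite lt_def fn0 nn.
have gp : 0 < wnorm w g by rewrite lt_def gn0 nn.
have [s [hf hg]] : exists s, 4 * wnorm w (badpart s f) <= wnorm w f /\
    4 * wnorm w (badpart s g) <= wnorm w g.
  pose F s := wnorm w (badpart s f) ^+ 2 / wnorm w f ^+ 2 +
    wnorm w (badpart s g) ^+ 2 / wnorm w g ^+ 2.
  have F0 : 16 * \sum_s F s <= #|S|%:R.
    have H h : 0 < wnorm w h -> 32 * \sum_s wnorm w (badpart s h) ^+ 2 / wnorm w h ^+ 2 <= #|S|%:R.
      move=> hp; rewrite -mulr_suml mulrA ler_pdivrMr ?exprn_gt0 //.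
      exact: sum_wnorm_badpart.
    have := H f fp; have := H g gp; rewrite /F big_split /=; lra.
  case: (pickP (fun s => 16 * F s <= 1)) => [s Fs|no].
    exists s; have {}Fs : F s <= 16^-1 by lra.
    have H h : 0 < wnorm w h -> wnorm w (badpart s h) ^+ 2 / wnorm w h ^+ 2 <= 16^-1 ->
        4 * wnorm w (badpart s h) <= wnorm w h.
      move=> hp; rewrite ler_pdivrMr ?exprn_gt0 // => h2.
      rewrite -(ler_pXn2r (ltn0Sn 1)) ?nnegrE ?mulr_ge0 // exprMn; lra.
    have p h : 0 <= wnorm w (badpart s h) ^+ 2 / wnorm w h ^+ 2 by rewrite divr_ge0 ?sqr_ge0.
    by split; apply: H => //; have := p f; have := p g; rewrite /F in Fs; lra.
  have /card_gt0P[s0 _] : (0 < #|S|)%N := S_gt0.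
  suff : #|S|%:R < 16 * \sum_s F s by lra.
  rewrite mulr_sumr -sum1_card natr_sum; apply: ltr_sum => [|s _]; last by rewrite ltNge no.
  by apply/hasP; exists s0; rewrite ?mem_index_enum.
have split h : h =1 (fun x => badpart s h x + (h x - badpart s h x)) by move=> x; ring.
pose gd h x := h x - badpart s h x.
have gdG h k x : (k < n)%N -> diff w (c s) k (gd h) x != 0 -> G s k x.
  move=> kn; have -> : diff w (c s) k (gd h) x = diff w (c s) k h x - diff w (c s) k (badpart s h) x.
    by rewrite /diff !avgB //; ring.
  by rewrite diff_badpart kn; case: ifP => // _; rewrite subrr eqxx.
have gd_norm h : wnorm w (gd h) <= wnorm w h.
  have ci := @c_inj s; have cn := @c_nested s.
  rewrite -(ler_pXn2r (ltn0Sn 1)) ?nnegrE //.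
  rewrite (wnorm_decomp w_gt0 ci cn n h) (wnorm_decomp w_gt0 ci cn n (gd h)).
  apply: lerD.
    rewrite le_eqVlt; apply/orP; left; apply/eqP; congr (_ ^+ 2); apply: eq_wnorm => x.
    by rewrite avgB // avg_badpart subr0.
  apply: ler_sum => k _; rewrite lerXn2r ?nnegrE //; apply: ler_wnorm => // x.
  have -> : diff w (c s) k (gd h) x = diff w (c s) k h x - diff w (c s) k (badpart s h) x.
    by rewrite /diff !avgB //; ring.
  by rewrite diff_badpart ltn_ord; case: ifP; rewrite ?subr0 ?subrr ?normr0.
have b1 : `|bil B (gd g) (gd f)| <= Cgood * (wnorm w g * wnorm w f).
  apply: (le_trans (good_bound (gdG f) (gdG g))).
  by apply: ler_wpM2l; [exact: Cgood_ge0|apply: ler_pM].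
have b2 : 4 * `|bil B (badpart s g) f| <= N * (wnorm w g * wnorm w f).
  have := HN f (badpart s g); move: (`|bil B (badpart s g) f|) => t ht.
  have : N * (4 * wnorm w (badpart s g) * wnorm w f) <= N * (wnorm w g * wnorm w f).
    by apply: ler_wpM2l => //; apply: ler_wpM2r.
  lra.
have b3 : 4 * `|bil B (gd g) (badpart s f)| <= N * (wnorm w g * wnorm w f).
  have := HN (badpart s f) (gd g); move: (`|bil B (gd g) (badpart s f)|) => t ht.
  have : N * (wnorm w (gd g) * (4 * wnorm w (badpart s f))) <= N * (wnorm w g * wnorm w f).
    by apply: ler_wpM2l => //; apply: ler_pM => //; rewrite mulr_ge0.
  lra.
rewrite (eq_bil B (split g) (fun=> erefl)) bilDl.
have -> : bil B (fun x => g x - badpart s g x) f = bil B (gd g) (badpart s f) + bil B (gd g) (gd f).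
  by rewrite -bilDr; apply: eq_bil => // x; rewrite /gd; ring.
have := ler_normD (bil B (badpart s g) f) (bil B (gd g) (badpart s f) + bil B (gd g) (gd f)).
have := ler_normD (bil B (gd g) (badpart s f)) (bil B (gd g) (gd f)).
lra.
Qed.

(** The fixed point of the improvement from [N] to [Cgood + N / 2] is [2 * Cgood], and the distance
    to it halves at each round. *)
Lemma iterated_absorption N : 0 <= N ->
  (forall f g, `|bil B g f| <= N * (wnorm w g * wnorm w f)) ->
  forall i f g, `|bil B g f| <= (2 * Cgood + N / 2 ^+ i) * (wnorm w g * wnorm w f).
Proof.
move=> N0 HN; elim=> [|i IH] f g.
  rewrite expr0 divr1; apply: (le_trans (HN f g)); apply: ler_wpM2r.
    by rewrite mulr_ge0 ?wnorm_ge0.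
  by rewrite lerDr mulr_ge0 // Cgood_ge0.
have p : 0 <= 2 * Cgood + N / 2 ^+ i.
  by rewrite addr_ge0 ?mulr_ge0 ?Cgood_ge0 ?invr_ge0 ?exprn_ge0.
have := absorption p IH f g; rewrite exprS invfM; lra.
Qed.

End RandomLevels.

(** * Translated dyadic lattices of a finite grid *)

Section Grid.
Context {d n : nat}.
Implicit Types (x y : {ffun 'I_d -> 'I_(2 ^ n)}) (s k l : nat).
Local Open Scope nat_scope.

Definition gcube s k x : {ffun 'I_d -> nat} := [ffun i => (x i + s) %/ 2 ^ k].

(** Subtraction is truncated and one of the two terms vanishes, so this is the sup distance counted
    in meshes. *)
Definition gdist x y := \max_(i < d) ((x i - y i) + (y i - x i)).

Lemma gdistC x y : gdist x y = gdist y x.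
Proof. by apply: eq_bigr => i _; rewrite addnC. Qed.

Lemma leq_gdist x y i : (x i - y i) + (y i - x i) <= gdist x y.
Proof. exact: (leq_bigmax (F := fun i => (x i - y i) + (y i - x i))). Qed.

Lemma gdist_ltP x y m : 0 < m ->
  reflect (forall i, (x i - y i) + (y i - x i) < m) (gdist x y < m).
Proof.
case: m => // m _; rewrite /gdist ltnS; apply: (iffP (bigmax_leqP _ _ _)) => H i; first by rewrite ltnS H.
by move=> _; rewrite -ltnS H.
Qed.

Lemma gdist_max x y : gdist x y < 2 ^ n.
Proof.
apply/gdist_ltP => [|i]; first by rewrite expn_gt0.
by have := ltn_ord (x i); have := ltn_ord (y i); lia.
Qed.

Lemma eq_gcube s k x y i : gcube s k x = gcube s k y ->
  (x i + s) %/ 2 ^ k = (y i + s) %/ 2 ^ k.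
Proof. by move=> /(congr1 (fun h : {ffun 'I_d -> nat} => h i)); rewrite !ffunE. Qed.

Lemma gcube_inj s x y : gcube s 0 x = gcube s 0 y -> x = y.
Proof.
move=> e; apply/ffunP => i; apply: val_inj => /=.
by have := eq_gcube i e; rewrite expn0 !divn1 => /addIn.
Qed.

Lemma gcube_nested s k x y : gcube s k x = gcube s k y -> gcube s k.+1 x = gcube s k.+1 y.
Proof.
move=> e; apply/ffunP => i; by rewrite !ffunE expnSr !divnMA (eq_gcube i e).
Qed.

Lemma eq_divn_dist P a b : 0 < P -> a %/ P = b %/ P -> a < b + P.
Proof.
move=> P0 e; rewrite {1}(divn_eq a P) e; have := divn_eq b P; have := ltn_pmod a P0; lia.
Qed.

Lemma gcube_diam s k x y : gcube s k x = gcube s k y -> gdist x y < 2 ^ k.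
Proof.
have P0 : 0 < 2 ^ k by rewrite expn_gt0.
move=> e; apply/gdist_ltP => // i; have ei := eq_gcube i e.
have := eq_divn_dist P0 ei; have := eq_divn_dist P0 (esym ei); lia.
Qed.

(** Two parent sides and the distance of the parents add up to at most
    [2 * 2 ^ k.+1 + 2 ^ (k.+1 + a0)], which is below [8 * 2 ^ a0] sides of level [k]. *)
Lemma gcube_near s k a0 x x' y y' i :
  gcube s k.+1 x' = gcube s k.+1 x -> gcube s k.+1 y' = gcube s k.+1 y ->
  gdist x' y' < 2 ^ (k.+1 + a0) ->
  gcube s k y i <= gcube s k x i + 2 ^ a0.+3.
Proof.
have P0 : 0 < 2 ^ k by rewrite expn_gt0.
have P1 : 0 < 2 ^ k.+1 by rewrite expn_gt0.
move=> /(eq_gcube i) ex /(eq_gcube i) ey; rewrite !ffunE.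
move=> /(leq_ltn_trans (leq_gdist x' y' i)).
rewrite expnD => h.
have := eq_divn_dist P1 ex; have := eq_divn_dist P1 (esym ey) => h1 h2.
have A0 : 0 < 2 ^ a0 by rewrite expn_gt0.
have hy : y i + s <= 2 ^ a0.+3 * 2 ^ k + (x i + s).
  have e1 : 2 ^ k.+1 * 2 ^ a0 = 2 * (2 ^ a0 * 2 ^ k) by rewrite expnS -mulnA [2 ^ k * _]mulnC.
  have e2 : 2 ^ a0.+3 * 2 ^ k = 8 * (2 ^ a0 * 2 ^ k) by rewrite !expnS !mulnA.
  have : 2 ^ k <= 2 ^ a0 * 2 ^ k by rewrite leq_pmull.
  by move: h h1 h2; rewrite e1 e2 expnS; lia.
by rewrite [leqRHS]addnC; have := leq_div2r (2 ^ k) hy; rewrite divnMDl.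
Qed.

(* In every coordinate, the cube of level [k.+1] containing [x] is at least
   [2 ^ (l - k)./2] of its own sides away from the boundary of its ancestor of each
   level [l >= k + r]. *)
Definition ggood r s k x : bool :=
  [forall i : 'I_d, forall l : 'I_n.+1, (k + r <= l) ==>
    (2 ^ (l - k)./2 <= gcube s k.+1 x i %% 2 ^ (l - k.+1)) &&
    (gcube s k.+1 x i %% 2 ^ (l - k.+1) + 2 ^ (l - k)./2 < 2 ^ (l - k.+1))].

Lemma ggood_inv r s k x y : gcube s k.+1 x = gcube s k.+1 y -> ggood r s k x = ggood r s k y.
Proof. by move=> e; rewrite /ggood e. Qed.

(** [P] is the side of the lower cube and [Q] the number of such cubes in one row of the ancestor.
    With [T] of them on either side of [X], leaving the ancestor takes at least [T] lower sides. *)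
Lemma far_from_boundary P Q T X Y : 0 < P -> 0 < Q ->
  T <= (X %/ P) %% Q -> (X %/ P) %% Q + T < Q -> X %/ (P * Q) <> Y %/ (P * Q) ->
  P * T <= (X - Y) + (Y - X).
Proof.
move=> P0 Q0; rewrite (divnMA X) => h1 h2.
have := divn_eq X P; have := ltn_pmod X P0.
have := divn_eq (X %/ P) Q.
have PQ0 : 0 < P * Q by rewrite muln_gt0 P0.
have := divn_eq Y (P * Q); have := ltn_pmod Y PQ0.
move: h1 h2; move: (Y %/ (P * Q)) (Y %% (P * Q)) => b sg.
move: ((X %/ P) %/ Q) ((X %/ P) %% Q) => a m; move: (X %/ P) (X %% P) => U rho.
move=> h1 h2 sgl -> -> rhol -> /eqP; rewrite neq_ltn.
have -> : (a * Q + m) * P = a * (P * Q) + P * m by rewrite mulnDl -mulnA [Q * P]mulnC [m * P]mulnC.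
case/orP => ab.
- have : P * (m + T).+1 <= P * Q by rewrite leq_mul2l h2 orbT.
  have : a.+1 * (P * Q) <= b * (P * Q) by rewrite leq_mul2r ab orbT.
  by rewrite mulSn mulnS mulnDr; lia.
- have : b.+1 * (P * Q) <= a * (P * Q) by rewrite leq_mul2r ab orbT.
  have : P * T <= P * m by rewrite leq_mul2l h1 orbT.
  by rewrite mulSn; lia.
Qed.

Lemma ggood_dist r s k l x y : 0 < r -> k + r <= l -> l <= n -> ggood r s k x ->
  gcube s l x <> gcube s l y -> 2 ^ (k.+1 + (l - k)./2) <= gdist x y.
Proof.
move=> r0 kl ln gx ne.
have [i ni] : exists i, gcube s l x i != gcube s l y i.
  apply/existsP; apply: contra_notT ne => /existsPn h; apply/ffunP => i.
  by apply/eqP; rewrite -[_ == _]negbK h.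
have lS : l < n.+1 by [].
have := forallP (forallP gx i) (Ordinal lS); rewrite kl /= => /andP[].
rewrite ffunE => h1 h2.
apply: leq_trans (leq_gdist x y i); move: ni; rewrite !ffunE.
have -> : x i - y i + (y i - x i) = (x i + s - (y i + s)) + (y i + s - (x i + s)) by lia.
have -> : 2 ^ l = 2 ^ k.+1 * 2 ^ (l - k.+1) by rewrite -expnD subnKC //; lia.
by move=> /eqP; rewrite expnD; apply: far_from_boundary; rewrite ?expn_gt0.
Qed.

Lemma shift_subproof s k u : (s + 2 ^ k.+1 * u) %% 2 ^ n < 2 ^ n.
Proof. by rewrite ltn_pmod // expn_gt0. Qed.

(* Moving the lattice by multiples of [2 ^ k.+1] keeps the cubes of levels up to
   [k.+1] but randomizes their position in the larger ones. *)
Definition gshift k u (s : 'I_(2 ^ n)) : 'I_(2 ^ n) := Ordinal (shift_subproof s k u).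

Lemma gshift_inj k u : injective (gshift k u).
Proof.
move=> s s' /(congr1 val) /= /eqP; rewrite eqn_modDr !modn_small //.
by move=> /eqP e; apply: val_inj.
Qed.

(** The shift is reduced modulo [2 ^ n]; each wrap moves all labels of level [j] by the same
    [2 ^ (n - j)]. Hence the partition at level [j] is unchanged, and labels of level [k.+1] modulo
    a divisor of [2 ^ (n - k.+1)] simply advance by [u]. *)
Lemma gcube_shift k u (s : 'I_(2 ^ n)) j x i : j <= k.+1 -> k < n ->
  gcube (gshift k u s) j x i + 2 ^ (n - j) * ((s + 2 ^ k.+1 * u) %/ 2 ^ n) =
  gcube s j x i + 2 ^ (k.+1 - j) * u.
Proof.
move=> jk kn; rewrite !ffunE /=.
have P0 : 0 < 2 ^ j by rewrite expn_gt0.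
have e m t v z : m <= t -> v %/ 2 ^ m + 2 ^ (t - m) * z = (v + 2 ^ t * z) %/ 2 ^ m.
  move=> mt; have -> : v + 2 ^ t * z = (2 ^ (t - m) * z) * 2 ^ m + v.
    by rewrite -{1}(subnK mt) expnD mulnAC addnC.
  by rewrite divnMDl ?expn_gt0 // addnC.
rewrite !e //; last exact: leq_trans jk _.
congr (_ %/ _); rewrite -addnA [in LHS]mulnC -[X in _ + X]addnC addnAC.
by rewrite -!addnA; congr (_ + _); have := divn_eq (s + 2 ^ k.+1 * u) (2 ^ n); lia.
Qed.

Lemma eq_gcube_shift k u (s : 'I_(2 ^ n)) j x y : j <= k.+1 -> k < n ->
  (gcube (gshift k u s) j x == gcube (gshift k u s) j y) = (gcube s j x == gcube s j y).
Proof.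
move=> jk kn; apply/eqP/eqP => /ffunP e; apply/ffunP => i; have := e i.
  have := gcube_shift u s x i jk kn; have := gcube_shift u s y i jk kn.
  by move=> h1 h2 h3; move: h1; rewrite -h3 h2 => /addIn.
have := gcube_shift u s x i jk kn; have := gcube_shift u s y i jk kn.
by move=> h1 h2 h3; move: h1; rewrite -h3 -h2 => /addIn.
Qed.

Lemma gcube_shift_mod k u (s : 'I_(2 ^ n)) x i p : k < n -> p <= n - k.+1 ->
  gcube (gshift k u s) k.+1 x i = gcube s k.+1 x i + u %[mod 2 ^ p].
Proof.
move=> kn pn; have := gcube_shift u s x i (leqnn k.+1) kn.
rewrite subnn mul1n => <-.
set v := _ %/ 2 ^ n; have -> : 2 ^ (n - k.+1) * v = (2 ^ (n - k.+1 - p) * v) * 2 ^ p.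
  by rewrite mulnAC -expnD subnK.
by rewrite addnC modnMDl.
Qed.

Lemma sum_rotate P (F : nat -> nat) c m : 0 < P ->
  \sum_(u < m * P) F ((c + u) %% P) = m * \sum_(v < P) F v.
Proof.
move=> P0.
have per b : \sum_(u < P) F ((b + u) %% P) = \sum_(v < P) F v.
  elim: b => [|b IH]; first by apply: eq_bigr => u _; rewrite add0n modn_small.
  rewrite -IH; case: P P0 {IH} => // P _.
  rewrite big_ord_recr big_ord_recl /= [LHS]addnC; congr (_ + _).
    by rewrite addn0 -[in RHS]modnDr addnS.
  by apply: eq_bigr => u _; rewrite addSnnS.
elim: m => [|m IH]; first by rewrite !mul0n big_ord0.
rewrite mulSnr big_split_ord /= IH mulSnr; congr (_ + _).
by rewrite -(per (c + m * P)); apply: eq_bigr => u _; rewrite addnA.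
Qed.

Definition gbad T P v : nat := if (T <= v) && (v + T < P) then 0 else 1.

Lemma sum_gbad T P : \sum_(v < P) gbad T P v <= 2 * T.
Proof.
have W a b m : \sum_(l < m) (if a <= l < b then 1 else 0) = minn m b - a.
  elim: m => [|m IH]; first by rewrite big_ord0 min0n.
  by rewrite big_ord_recr /= IH; case: ifP; lia.
apply: (@leq_trans (\sum_(v < P) ((if 0 <= v < T then 1 else 0) + (if P - T <= v < P then 1 else 0)))).
  apply: leq_sum => v _; rewrite /gbad; have := ltn_ord v; do 3 (case: ifP); lia.
rewrite big_split (W 0 T P) (W (P - T) P P) /=; lia.
Qed.

(** As [u] varies, the position of the cube inside its ancestor runs through all [2 ^ (l - k.+1)]
    residues equally often, and at most [2 * 2 ^ (l - k)./2] of these lie too close to an end. *)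
Lemma card_gbad k l i r x (s : 'I_(2 ^ n)) : 0 < r -> k < n -> k + r <= l -> l <= n ->
  \sum_(u < 2 ^ n) gbad (2 ^ (l - k)./2) (2 ^ (l - k.+1))
    (gcube (gshift k u s) k.+1 x i %% 2 ^ (l - k.+1)) <=
  2 ^ (n - (l - k.+1)) * (2 * 2 ^ (l - k)./2).
Proof.
move=> r0 kn kl ln; set p := l - k.+1.
have pn : p <= n - k.+1 by rewrite /p; lia.
rewrite (eq_bigr (fun u : 'I_(2 ^ n) =>
    gbad (2 ^ (l - k)./2) (2 ^ p) ((gcube s k.+1 x i + u) %% 2 ^ p))); last first.
  by move=> u _; rewrite gcube_shift_mod.
have e : 2 ^ n = 2 ^ (n - p) * 2 ^ p by rewrite -expnD subnK //; lia.
have P0 : 0 < 2 ^ p by rewrite expn_gt0.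
have := sum_rotate (gbad (2 ^ (l - k)./2) (2 ^ p)) (gcube s k.+1 x i) (2 ^ (n - p)) P0.
by rewrite -e => ->; rewrite leq_mul2l sum_gbad orbT.
Qed.

Lemma ggood_gbad r s k x : (if ggood r s k x then 0 else 1) <=
  \sum_(i < d) \sum_(l < n.+1) (if k + r <= l then
    gbad (2 ^ (l - k)./2) (2 ^ (l - k.+1)) (gcube s k.+1 x i %% 2 ^ (l - k.+1)) else 0).
Proof.
case: ifP => // /negbT /forallPn[i /forallPn[l]]; rewrite negb_imply => /andP[kl b].
by rewrite (bigD1 i) //= (bigD1 l) //= kl /gbad (negbTE b).
Qed.

End Grid.

Section RandomShift.
Context {R : rcfType} {d n a0 : nat}.
Local Notation cell := {ffun 'I_d -> 'I_(2 ^ n)}.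
(** Summing the failures over coordinates and levels gives a proportion of at most
    [16 * d * 2 ^ -(r./2)]. Since [32 * 16 = 2 ^ 9] and [d < 2 ^ d], this choice brings it below
    1/32, and it also secures [a0 <= r./2]. *)
Let r := (d + 9 + a0).*2.

Lemma sum_bad_shifts k (x : cell) (s : 'I_(2 ^ n)) : (k < n)%N ->
  32 * \sum_(u < 2 ^ n) (if ggood r (gshift k u s) k x then 0 else 1) <= (2 ^ n)%:R :> R.
Proof.
move=> kn; pose h : R := 2^-1.
have h01 : 0 < h < 1 by rewrite /h; lra.
have /andP[h0 h1] := h01.
have r0 : (0 < r)%N by rewrite /r; lia.
pose T i l u := (if (k + r <= l)%N then gbad (2 ^ (l - k)./2) (2 ^ (l - k.+1))
  (gcube (gshift k u s) k.+1 x i %% 2 ^ (l - k.+1)) else 0)%N.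
have le1 : \sum_(u < 2 ^ n) (if ggood r (gshift k u s) k x then 0 else 1) <=
    (\sum_(i < d) \sum_(l < n.+1) \sum_(u < 2 ^ n) T i l u)%:R :> R.
  under [X in _ <= X%:R]eq_bigr do rewrite exchange_big /=.
  rewrite exchange_big /= natr_sum; apply: ler_sum => u _.
  have := ggood_gbad r (gshift k u s) k x; rewrite -(ler_nat R); apply: le_trans.
  by case: ifP.
have le2 (i : 'I_d) (l : 'I_n.+1) : (\sum_(u < 2 ^ n) T i l u)%:R <=
    (if (k + r <= l)%N then 4 * h ^+ ((l - (k + r) + r)./2) * (2 ^ n)%:R else 0) :> R.
  rewrite /T; case: ifP => kl; last by rewrite big1.
  have ln : (l <= n)%N by rewrite -ltnS.
  have := card_gbad i x s r0 kn kl ln; rewrite -(ler_nat R) => /le_trans; apply.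
  have -> : (l - (k + r) + r = l - k)%N by lia.
  have -> : (n - (l - k.+1) = (n - (l - k)).+1)%N by lia.
  set j := (l - k)%N; have jn : (j <= n)%N by rewrite /j; lia.
  have e : (2 ^ n)%:R = (2 ^ (n - j))%:R * (2 ^ j)%:R :> R by rewrite -natrM -expnD subnK.
  rewrite e expnS !natrM.
  have -> : 2 * (2 ^ (n - j))%:R * (2 * (2 ^ j./2)%:R) = (2 ^ (n - j))%:R * (4 * (2 ^ j./2)%:R) :> R by ring.
  have -> : 4 * h ^+ j./2 * ((2 ^ (n - j))%:R * (2 ^ j)%:R) =
     (2 ^ (n - j))%:R * (4 * (h ^+ j./2 * (2 ^ j)%:R)) by ring.
  rewrite ler_pM2l ?ltr0n ?expn_gt0 // ler_pM2l ?ltr0n // !natrX /h exprVn.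
  rewrite mulrC ler_pdivlMr ?exprn_gt0 // -exprD ler_eXn2l ?ltr1n //.
  by have := odd_double_half j; lia.
have le3 (i : 'I_d) : \sum_(l < n.+1) (\sum_(u < 2 ^ n) T i l u)%:R <= 16 * h ^+ r./2 * (2 ^ n)%:R :> R.
  apply: (le_trans (ler_sum _ (fun l _ => le2 i l))).
  rewrite (sum_shift (fun j => 4 * h ^+ ((j + r)./2) * (2 ^ n)%:R)) -mulr_suml.
  apply: ler_wpM2r; rewrite ?ler0n //.
  (* As [r] is even, [(j + r)./2] splits exactly into [j./2 + r./2]. *)
  have -> : \sum_(j < n.+1 - (k + r)) 4 * h ^+ (j + r)./2 =
     4 * h ^+ r./2 * \sum_(j < n.+1 - (k + r)) h ^+ j./2.
    rewrite mulr_sumr; apply: eq_bigr => j _; rewrite -mulrA -exprD; congr (_ * _ ^+ _).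
    by rewrite halfD {2}/r odd_double andbF add0n addnC.
  have -> : 16 * h ^+ r./2 = 4 * h ^+ r./2 * 4 by ring.
  apply: ler_wpM2l; first by rewrite mulr_ge0 ?exprn_ge0 // ltW.
  apply: (le_trans (sum_expr_half_le _ h01)).
  have -> : 1 - h = 2^-1 by rewrite /h; lra.
  by rewrite invrK; lra.
apply: (@le_trans _ _ (32 * (\sum_(i < d) 16 * h ^+ r./2 * (2 ^ n)%:R))).
  apply: ler_wpM2l => //; apply: (le_trans le1); rewrite natr_sum.
  by apply: ler_sum => i _; rewrite natr_sum; exact: le3.
rewrite sumr_const card_ord -[X in 32 * X]mulr_natl.
have -> : 32 * (d%:R * (16 * h ^+ r./2 * (2 ^ n)%:R)) = (512 * d%:R * h ^+ r./2) * (2 ^ n)%:R by ring.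
rewrite -[leRHS]mul1r; apply: ler_wpM2r; first by rewrite ler0n.
rewrite /h exprVn ler_pdivrMr ?exprn_gt0 // mul1r /r doubleK -natrX -natrM ler_nat.
rewrite expnD [(2 ^ (d + 9))%N]expnD.
have := ltn_expl d (isT : (1 < 2)%N); have : (0 < 2 ^ a0)%N by rewrite expn_gt0.
have -> : (2 ^ 9 = 512)%N by [].
by move: (2 ^ d)%N (2 ^ a0)%N => D A; nia.
Qed.

End RandomShift.

Lemma inord_window (m q a b : nat) :
  (q <= a + m)%N && (a <= q + m)%N -> (q <= b + m)%N && (b <= q + m)%N ->
  inord (a + m - q) = inord (b + m - q) :> 'I_(m.*2.+1) -> a = b.
Proof.
move=> /andP[h1 h2] /andP[h3 h4] /(congr1 val) /=.
rewrite !inordK; lia.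
Qed.

(** * The theorem for weighted finite grids *)

Section FiniteT1.
Context {R : rcfType} {d : nat}.
Variables (q M C0 C1 C3 : R) (a0 : nat).
Hypotheses (q01 : 0 < q < 1) (M0 : 0 < M) (C0_ge0 : 0 <= C0) (C1_ge0 : 0 <= C1) (C3_ge0 : 0 <= C3).

(* Discrete form of [|x - y| ^ -(m + eps)], for [M = 2 ^ m] and [q = 2 ^ -eps]. *)
Definition gth n (x y : {ffun 'I_d -> 'I_(2 ^ n)}) : R :=
  C3 * (q / M) ^+ trunc_log 2 (gdist x y).

(** The dyadic shell at distance [2 ^ b] has mass at most [C1 * M ^ b] and carries the value
    [C3 * (q / M) ^ b], so it contributes [C1 * C3 * q ^ b]. *)
Lemma tail_growth n (w : {ffun 'I_d -> 'I_(2 ^ n)} -> R) x a :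
  (forall y, 0 <= w y) ->
  (forall b, \sum_(y | (gdist x y < 2 ^ b.+1)%N) w y <= C1 * M ^+ b) ->
  \sum_(y | (2 ^ a <= gdist x y)%N) w y * gth x y <= C1 * C3 / (1 - q) * q ^+ a.
Proof.
move=> w0 growth; have /andP[q0 q1] := q01.
pose tl y : 'I_n.+1 := inord (trunc_log 2 (gdist x y)).
have tlE y : tl y = trunc_log 2 (gdist x y) :> nat.
  rewrite inordK // ltnS.
  have [->|p] := posnP (gdist x y); first by rewrite trunc_log0.
  have := trunc_logP (isT : (1 < 2)%N) p; move/leq_ltn_trans/(_ (gdist_max x y)).
  by rewrite ltn_exp2l // => /ltnW.
have qM0 : 0 <= q / M by rewrite divr_ge0 // ltW.
rewrite (partition_big tl (fun b : 'I_n.+1 => (a <= b)%N)) /=; last first.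
  by move=> y ay; rewrite tlE; apply: trunc_log_max.
apply: (@le_trans _ _ (\sum_(b < n.+1 | (a <= b)%N) C1 * C3 * q ^+ b)).
  apply: ler_sum => b ab.
  apply: (@le_trans _ _ (\sum_(y | (gdist x y < 2 ^ b.+1)%N) w y * (C3 * (q / M) ^+ b))).
    rewrite big_mkcond [leRHS]big_mkcond /=; apply: ler_sum => y _.
    case: ifP => [/andP[h1 /eqP h2]|_].
      rewrite /gth -tlE h2; have -> // : (gdist x y < 2 ^ b.+1)%N.
      by rewrite -h2 tlE; exact: trunc_log_ltn.
    by case: ifP => // _; rewrite !mulr_ge0 ?exprn_ge0.
  rewrite -mulr_suml.
  apply: (@le_trans _ _ (C1 * M ^+ b * (C3 * (q / M) ^+ b))).
    by apply: ler_wpM2r; rewrite ?mulr_ge0 ?exprn_ge0.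
  rewrite expr_div_n le_eqVlt; apply/orP; left; apply/eqP; field.
  by rewrite expf_neq0 // gt_eqF.
rewrite big_mkcond /=.
rewrite (eq_bigr (fun b : 'I_n.+1 => if (a <= b)%N then C1 * C3 * q ^+ (b - a + a) else 0)); last first.
  by move=> b _; case: ifP => // ab; rewrite subnK.
rewrite (sum_shift (fun j => C1 * C3 * q ^+ (j + a))).
have -> : \sum_(j < n.+1 - a) C1 * C3 * q ^+ (j + a) = C1 * C3 * q ^+ a * \sum_(j < n.+1 - a) q ^+ j.
  by rewrite mulr_sumr; apply: eq_bigr => j _; rewrite exprD; ring.
rewrite [leRHS]mulrAC; apply: ler_wpM2l; last exact: sum_expr_le.
by rewrite !mulr_ge0 ?exprn_ge0 // ltW.
Qed.

(** Points are grouped by the position of their label in a window of [2 m + 1] values per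
    coordinate; each group lies in a single cube and contributes at most 1. *)
Lemma count_cubes n (X : finType) (v : X -> {ffun 'I_d -> 'I_(2 ^ n)}) (w : X -> R)
    s k (P : pred X) (Q : 'I_d -> nat) (m : nat) : (forall x, 0 < w x) ->
  (forall y i, P y -> (Q i <= gcube s k (v y) i + m)%N && (gcube s k (v y) i <= Q i + m)%N) ->
  \sum_(y | P y) w y / mass w (fun k x => gcube s k (v x)) k y <= ((m.*2.+1) ^ d)%:R.
Proof.
move=> w0 H; set ms := mass _ _.
have ms0 y : 0 < ms k y by exact: mass_gt0.
pose p y : {ffun 'I_d -> 'I_(m.*2.+1)} := [ffun i => inord (gcube s k (v y) i + m - Q i)].
rewrite (partition_big p xpredT) //=.
have -> : ((m.*2.+1) ^ d)%:R = \sum_(j : {ffun 'I_d -> 'I_(m.*2.+1)}) 1 :> R.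
  by rewrite sumr_const card_ffun !card_ord.
apply: ler_sum => j _.
case: (pickP (fun y => P y && (p y == j))) => [y0 /andP[Py0 /eqP py0]|no]; last first.
  by rewrite big_pred0.
have same y : P y -> p y = j -> gcube s k (v y) = gcube s k (v y0).
  move=> Py py; apply/ffunP => i.
  have := congr1 (fun h : {ffun 'I_d -> 'I_(m.*2.+1)} => h i) (etrans py (esym py0)).
  rewrite [p y i]ffunE [p y0 i]ffunE; apply: inord_window; exact: H.
apply: (@le_trans _ _ (\sum_(y | gcube s k (v y) == gcube s k (v y0)) w y / ms k y0)).
  rewrite big_mkcond [leRHS]big_mkcond; apply: ler_sum => y _.
  case: ifP => [/andP[Py /eqP py]|_].
    rewrite (same y Py py) eqxx.
    by have -> : ms k y = ms k y0 by apply: mass_inv; exact: same.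
  by case: ifP => // _; rewrite divr_ge0 // ltW.
rewrite -mulr_suml; have -> : \sum_(y | gcube s k (v y) == gcube s k (v y0)) w y = ms k y0 by [].
by rewrite divff // gt_eqF.
Qed.

Definition Cfin := 2 * Cgood (d + 9 + a0).*2 q C0 (C1 * C3 / (1 - q)) (((2 ^ a0.+3).*2.+1) ^ d)%:R.

Lemma finite_T1 n (w : {ffun 'I_d -> 'I_(2 ^ n)} -> R) B ker ker' N :
  (forall x, 0 <= w x) ->
  (forall x b, 0 < w x -> \sum_(y | (gdist x y < 2 ^ b.+1)%N) w y <= C1 * M ^+ b) ->
  (forall j x x0 y, (gdist x x0 < 2 ^ j)%N -> (2 ^ (j + a0) <= gdist x y)%N ->
    `|B x y - w x * ker x0 y| <= w x * w y * (q ^- j * gth x y)) ->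
  (forall j x x0 y, (gdist x x0 < 2 ^ j)%N -> (2 ^ (j + a0) <= gdist x y)%N ->
    `|B y x - w x * ker' x0 y| <= w x * w y * (q ^- j * gth x y)) ->
  (forall s k J h, (k <= n)%N ->
    `|bil B h (fun y => (gcube s k y == J)%:R)| <=
      C0 * Num.sqrt (\sum_(y | gcube s k y == J) w y) * wnorm w h) ->
  (forall s k J h, (k <= n)%N ->
    `|bil B (fun y => (gcube s k y == J)%:R) h| <=
      C0 * Num.sqrt (\sum_(y | gcube s k y == J) w y) * wnorm w h) ->
  0 <= N -> (forall f g, `|bil B g f| <= N * (wnorm w g * wnorm w f)) ->
  forall i f g, `|bil B g f| <= (Cfin + N / 2 ^+ i) * (wnorm w g * wnorm w f).
Proof.
move=> w_ge0 growth sml smr tl tr N0 apriori i f g.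
have /andP[q0 q1] := q01; have p1 : 0 < 1 - q by lra.
(* Averages divide by masses, so cells of weight zero are removed. The a priori bound on point
   masses shows that [B] vanishes on their rows and columns, and nothing is lost. *)
pose A : {pred {ffun 'I_d -> 'I_(2 ^ n)}} := [pred x | 0 < w x].
pose X := {x in A}.
pose wX (x : X) := w (val x).
have wX0 x : 0 < wX x by exact: (valP x).
have w_out x : x \notin A -> w x = 0.
  by rewrite inE -leNgt => wx; apply/le_anti; rewrite wx w_ge0.
have wnorm_delta x : w x = 0 -> wnorm w (fun y => (y == x)%:R) = 0.
  move=> wx; rewrite /wnorm big1 ?sqrtr0 // => y _.
  by case: eqP => [->|_]; rewrite ?wx ?mul0r ?expr0n ?mulr0.
have bil_delta x y : bil B (fun z => (z == x)%:R) (fun z => (z == y)%:R) = B x y.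
  rewrite /bil (bigD1 x) //= (bigD1 y) //= !eqxx !mul1r big1 ?addr0; last first.
    by move=> z /negbTE ->; rewrite mulr0 mul0r.
  by rewrite big1 ?addr0 // => z /negbTE ->; apply: big1 => t _; rewrite !mul0r.
have B0l x y : w x = 0 -> B x y = 0.
  move=> /wnorm_delta wx; have := apriori (fun z => (z == y)%:R) (fun z => (z == x)%:R).
  by rewrite wx mul0r mulr0 bil_delta normr_le0 => /eqP.
have B0r x y : w y = 0 -> B x y = 0.
  move=> /wnorm_delta wx; have := apriori (fun z => (z == y)%:R) (fun z => (z == x)%:R).
  by rewrite wx !mulr0 bil_delta normr_le0 => /eqP.
have sumX (F : {ffun 'I_d -> 'I_(2 ^ n)} -> R) : (forall x, w x = 0 -> F x = 0) ->
    \sum_x F x = \sum_(x : X) F (val x).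
  move=> F0; rewrite -(big_sub A) (bigID (mem A)) /= [X in _ + X]big1 ?addr0 // => x /w_out.
  exact: F0.
have sumXc (P : pred {ffun 'I_d -> 'I_(2 ^ n)}) (F : {ffun 'I_d -> 'I_(2 ^ n)} -> R) :
    (forall x, w x = 0 -> F x = 0) -> \sum_(x | P x) F x = \sum_(x : X | P (val x)) F (val x).
  move=> F0; rewrite big_mkcond [RHS]big_mkcond.
  by apply: (sumX (fun x => if P x then F x else 0)) => x wx; rewrite F0 // if_same.
pose BX (x y : X) := B (val x) (val y).
have bilX h1 h2 : bil B h1 h2 = bil BX (fun x => h1 (val x)) (fun x => h2 (val x)).
  rewrite /bil (sumX (fun x => \sum_y h1 x * h2 y * B x y)); last first.
    by move=> x wx; apply: big1 => y _; rewrite B0l ?mulr0.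
  apply: eq_bigr => x _; apply: (sumX (fun y => h1 (val x) * h2 y * B (val x) y)).
  by move=> y wy; rewrite B0r ?mulr0.
have wnX h : wnorm w h = wnorm wX (fun x => h (val x)).
  rewrite /wnorm; congr Num.sqrt; apply: (sumX (fun x => w x * h x ^+ 2)) => x wx.
  by rewrite wx mul0r.
pose ext (h : X -> R) x := if insub x is Some z then h z else 0.
have extE h z : ext h (val z) = h z by rewrite /ext valK.
pose c (s : 'I_(2 ^ n)) k (x : X) := gcube s k (val x).
pose kerX (x y : X) := ker (val x) (val y).
pose kerX' (x y : X) := ker' (val x) (val y).
pose rr := (d + 9 + a0).*2.
pose GX (s : 'I_(2 ^ n)) k (x : X) := ggood rr s k (val x).
have rr0 : (0 < rr)%N by rewrite /rr; nat_lia.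
have rra : (a0 <= rr./2)%N by rewrite /rr doubleK leq_addl.
have apX f1 g1 : `|bil BX g1 f1| <= N * (wnorm wX g1 * wnorm wX f1).
  have := apriori (ext f1) (ext g1); rewrite bilX !wnX.
  rewrite (eq_bil BX (extE g1) (extE f1)).
  by rewrite (eq_wnorm wX (extE g1)) (eq_wnorm wX (extE f1)).
rewrite bilX !wnX /Cfin.
apply: (@iterated_absorption R X 'I_(2 ^ n) {ffun 'I_d -> nat} wX c wX0 _ _
  (fun x y => gdist (val x) (val y)) (fun x y => gth (val x) (val y)) BX kerX kerX'
  n rr a0 q C0 (C1 * C3 / (1 - q)) (((2 ^ a0.+3).*2.+1) ^ d)%:R GX q01 C0_ge0) => //.
- by move=> s x y /gcube_inj/val_inj.
- by move=> s k x y; exact: gcube_nested.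
- by rewrite divr_ge0 ?mulr_ge0 // ltW.
- by move=> x y; exact: gdistC.
- by move=> x y; rewrite /gth gdistC.
- by move=> x y; rewrite mulr_ge0 ?exprn_ge0 ?divr_ge0 // ltW.
- by move=> s k x y; exact: gcube_diam.
- move=> x a; have := @tail_growth n w (val x) a w_ge0 (fun b => growth _ _ (valP x)).
  rewrite (sumXc _ (fun y => w y * gth (val x) y)) // => y wy; by rewrite wy mul0r.
- by move=> j x x0 y; exact: sml.
- by move=> j x x0 y; exact: smr.
- move=> s k z h kn; have := tl s k (gcube s k (val z)) (ext h) kn.
  rewrite bilX wnX (eq_wnorm wX (extE h)) (sumXc _ w) //.
  by rewrite (eq_bil BX (extE h) (fun=> erefl)).
- move=> s k z h kn; have := tr s k (gcube s k (val z)) (ext h) kn.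
  rewrite bilX wnX (eq_wnorm wX (extE h)) (sumXc _ w) //.
  by rewrite (eq_bil BX (fun=> erefl) (extE h)).
- move=> s k x kn; apply: (@count_cubes n X val wX s k _ (gcube s k (val x))) => // y j.
  move=> /existsP[x' /existsP[y' /and3P[/eqP e1 /eqP e2 dd]]].
  rewrite (gcube_near j e1 e2 dd).
  by rewrite gdistC in dd; rewrite (gcube_near j e2 e1 dd).
(* Coordinates and shift are both below [2 ^ n], so labels at the top level are 0 or 1 and fit into
   the same window as neighbours do. *)
- move=> s; apply: (@count_cubes n X val wX s n _ (fun=> 0%N)) => // y j _ /=.
  rewrite ffunE add0n; apply: (@leq_trans 1); last by rewrite expn_gt0.
  rewrite -ltnS ltn_divLR ?expn_gt0 // mul2n -addnn.
  by rewrite -addSn leq_add // ltnW.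
- by move=> s k x y; exact: ggood_inv.
- move=> s k l x y kl ln; exact: ggood_dist.
- by rewrite card_ord expn_gt0.
move=> k x h kn.
pose phi s := diff wX (c s) k h x ^+ 2.
have phi0 s : 0 <= phi s by exact: sqr_ge0.
(* This is the independence: the difference does not notice a shift by a multiple of [2 ^ k.+1]. A
   redundant average over [u] can be inserted and, for fixed [s], it falls on goodness alone. *)
have phi_shift u s : phi (gshift k u s) = phi s.
  rewrite /phi; congr (_ ^+ 2); rewrite /diff /avg /mass /c.
  by congr (_ / _ - _ / _); apply: eq_bigl => y; rewrite eq_gcube_shift.
have D0 : 0 < (2 ^ n)%:R :> R by rewrite ltr0n expn_gt0.
rewrite -(ler_pM2l D0).
have -> : (2 ^ n)%:R * (32 * \sum_(s < 2 ^ n) (if GX s k x then 0 else phi s)) =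
  \sum_(s < 2 ^ n) phi s * (32 * \sum_(u < 2 ^ n) (if ggood rr (gshift k u s) k (val x) then 0 else 1)).
  transitivity (32 * \sum_(u < 2 ^ n) \sum_(s < 2 ^ n) (if GX s k x then 0 else phi s)).
    by rewrite mulrCA; congr (_ * _); rewrite sumr_const card_ord mulr_natl.
  under eq_bigr => u _ do rewrite (reindex_inj (@gshift_inj n k u)) /=.
  rewrite exchange_big mulr_sumr; apply: eq_bigr => s _ /=.
  rewrite mulrCA; congr (_ * _); rewrite mulr_sumr; apply: eq_bigr => u _.
  by rewrite phi_shift /GX; case: ifP; rewrite ?mulr0 ?mulr1.
rewrite mulr_sumr; apply: ler_sum => s _; rewrite [leRHS]mulrC; apply: ler_wpM2l => //.
exact: sum_bad_shifts.
Qed.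

End FiniteT1.

Local Open Scope classical_set_scope.
Local Open Scope ring_scope.

(** * Real square-integrable functions and smooth cut-offs *)

Section RealL2.
Context {d0 : measure_display} {T : measurableType d0} {R : realType}.
Variable mu : {finite_measure set T -> \bar R}.
Implicit Types (u v : T -> R).

Definition rL2 u := measurable_fun [set: T] u /\
  mu.-integrable [set: T] (EFin \o (fun x => u x ^+ 2)).
Definition dotr u v : R := \int[mu]_x (u x * v x).
Definition nrmr u : R := Num.sqrt (dotr u u).

Lemma rL2_mul u v : rL2 u -> rL2 v -> mu.-integrable [set: T] (EFin \o (fun x => u x * v x)).
Proof.
move=> [mu1 iu] [mv iv].
apply: (@le_integrable _ _ _ _ _ _ _ (EFin \o (fun x => u x ^+ 2 + v x ^+ 2))) => //.
- by apply/measurable_EFinP; exact: measurable_funM.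
- move=> x _; rewrite /= lee_fin [leRHS]ger0_norm ?addr_ge0 ?sqr_ge0 //.
  rewrite ler_norml; apply/andP; split.
  + by have := sqr_ge0 (u x + v x); have := sqr_ge0 (u x); have := sqr_ge0 (v x); rewrite sqrrD; lra.
  + by have := sqr_ge0 (u x - v x); have := sqr_ge0 (u x); have := sqr_ge0 (v x); rewrite sqrrB; lra.
- have -> : EFin \o (fun x => u x ^+ 2 + v x ^+ 2) =
    (EFin \o (fun x => u x ^+ 2)) \+ (EFin \o (fun x => v x ^+ 2)) by [].
  exact: integrableD.
Qed.

Lemma rL2_lin a u v : rL2 u -> rL2 v -> rL2 (fun x => a * u x + v x).
Proof.
move=> lu lv; have iuv := rL2_mul lu lv; have [mu1 iu] := lu; have [mv iv] := lv; split.
  by apply: measurable_funD => //; exact: measurable_funM.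
pose U2 : T -> \bar R := EFin \o (fun x => u x ^+ 2).
pose UV : T -> \bar R := EFin \o (fun x => u x * v x).
have -> : EFin \o (fun x => (a * u x + v x) ^+ 2) =
  (fun x => (a ^+ 2)%:E * U2 x)%E \+
  ((fun x => (2 * a)%:E * UV x)%E \+ (EFin \o (fun x => v x ^+ 2))).
  by apply/funext => x /=; rewrite -!EFinM -!EFinD; congr EFin; ring.
by apply: integrableD => //; [exact: integrableZl|apply: integrableD => //; exact: integrableZl].
Qed.

Lemma rL2_bounded u M : measurable_fun [set: T] u -> (forall x, `|u x| <= M) -> rL2 u.
Proof.
move=> mu1 uM; split => //.
apply: (@le_integrable _ _ _ _ _ _ _ (EFin \o cst (M ^+ 2))) => //.
- by apply/measurable_EFinP; exact: measurable_funX.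
- move=> x _ /=; rewrite lee_fin !ger0_norm ?sqr_ge0 //.
  rewrite -[leLHS]real_normK ?num_real // lerXn2r // nnegrE //.
  exact: le_trans (normr_ge0 _) (uM x).
- exact: finite_measure_integrable_cst.
Qed.

Lemma rL2_cst a : rL2 (fun=> a).
Proof. by apply: (@rL2_bounded _ `|a|). Qed.

Lemma rL2_indic (A : set T) : measurable A -> rL2 (\1_A).
Proof.
move=> mA; apply: (@rL2_bounded _ 1); first exact: measurable_indic.
by move=> x; rewrite indicE; case: (x \in A); rewrite ?normr1 ?normr0.
Qed.

Lemma rL2_scale a u : rL2 u -> rL2 (fun x => a * u x).
Proof.
move=> lu; have := rL2_lin a lu (rL2_cst 0).
by congr rL2; apply/funext => x; rewrite addr0.
Qed.

Lemma rL2_add u v : rL2 u -> rL2 v -> rL2 (fun x => u x + v x).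
Proof.
move=> lu lv; have := rL2_lin 1 lu lv.
by congr rL2; apply/funext => x; rewrite mul1r.
Qed.

Lemma rL2_sub u v : rL2 u -> rL2 v -> rL2 (fun x => u x - v x).
Proof.
move=> lu lv; have := rL2_lin (-1) lv lu.
by congr rL2; apply/funext => x; rewrite mulN1r addrC.
Qed.

Lemma rL2_sum (J : Type) (s : seq J) (P : pred J) (F : J -> T -> R) :
  (forall j, rL2 (F j)) -> rL2 (fun x => \sum_(j <- s | P j) F j x).
Proof.
move=> lF; elim: s => [|j s IH].
  by have := rL2_cst 0; congr rL2; apply/funext => x; rewrite big_nil.
case Pj: (P j).
  have := rL2_add (lF j) IH; congr rL2; apply/funext => x; by rewrite big_cons Pj.
by move: IH; congr rL2; apply/funext => x; rewrite big_cons Pj.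
Qed.

Lemma dotrC u v : dotr u v = dotr v u.
Proof. by apply: eq_Rintegral => x _; rewrite mulrC. Qed.

Lemma dotr_linl a u v z : rL2 u -> rL2 v -> rL2 z ->
  dotr (fun x => a * u x + v x) z = a * dotr u z + dotr v z.
Proof.
move=> lu lv lz; have iuz := rL2_mul lu lz; have ivz := rL2_mul lv lz.
rewrite -RintegralZl // -RintegralD //; last exact: (integrableZl measurableT a iuz).
by apply: eq_Rintegral => x _; ring.
Qed.

Lemma dotr_scalel a u z : rL2 u -> rL2 z -> dotr (fun x => a * u x) z = a * dotr u z.
Proof.
move=> lu lz; rewrite -RintegralZl //; last exact: rL2_mul.
by apply: eq_Rintegral => x _; ring.
Qed.

Lemma dotr_addl u v z : rL2 u -> rL2 v -> rL2 z ->
  dotr (fun x => u x + v x) z = dotr u z + dotr v z.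
Proof.
move=> lu lv lz; rewrite -[dotr u z]mul1r -dotr_linl //.
by apply: eq_Rintegral => x _; rewrite mul1r.
Qed.

Lemma dotr_subl u v z : rL2 u -> rL2 v -> rL2 z ->
  dotr (fun x => u x - v x) z = dotr u z - dotr v z.
Proof.
move=> lu lv lz; rewrite [RHS]addrC -mulN1r -dotr_linl //.
by apply: eq_Rintegral => x _; ring.
Qed.

Lemma dotr_suml (J : Type) (s : seq J) (P : pred J) (F : J -> T -> R) z :
  (forall j, rL2 (F j)) -> rL2 z ->
  dotr (fun x => \sum_(j <- s | P j) F j x) z = \sum_(j <- s | P j) dotr (F j) z.
Proof.
move=> lF lz; elim: s => [|j s IH].
  transitivity (dotr (fun x => 0 * z x) z); last by rewrite dotr_scalel // mul0r big_nil.
  by apply: eq_Rintegral => x _; rewrite big_nil !mul0r.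
rewrite big_cons -IH; case Pj: (P j); last first.
  by apply: eq_Rintegral => x _; rewrite big_cons Pj.
rewrite -dotr_addl //; last exact: rL2_sum.
by apply: eq_Rintegral => x _; rewrite big_cons Pj.
Qed.

Lemma dotr_ge0 u : 0 <= dotr u u.
Proof. by apply: Rintegral_ge0 => x _; rewrite -expr2 sqr_ge0. Qed.

Lemma nrmr_ge0 u : 0 <= nrmr u. Proof. exact: sqrtr_ge0. Qed.

Lemma nrmr_sqr u : nrmr u ^+ 2 = dotr u u.
Proof. by rewrite sqr_sqrtr // dotr_ge0. Qed.

Lemma dotr_cs u v : rL2 u -> rL2 v -> `|dotr u v| <= nrmr u * nrmr v.
Proof.
move=> lu lv.
have key a b : 0 <= a ^+ 2 * dotr u u + 2 * a * b * dotr u v + b ^+ 2 * dotr v v.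
  have l1 := rL2_scale b lv.
  have l2 := rL2_lin a lu l1.
  have := dotr_ge0 (fun x => a * u x + b * v x).
  rewrite dotr_linl // dotr_scalel // ![dotr _ (fun x => a * u x + _)]dotrC.
  rewrite !dotr_linl // !dotr_scalel // [dotr v u]dotrC; lra.
rewrite -(ler_pXn2r (ltn0Sn 1)) ?nnegrE ?mulr_ge0 ?nrmr_ge0 //.
rewrite exprMn !nrmr_sqr real_normK ?num_real //.
move: (dotr_ge0 u) (dotr_ge0 v) key.
move: (dotr u u) (dotr u v) (dotr v v) => A B C A0 C0 key.
have [C1|] := ltP 0 C.
  have := key C (- B); nra.
move=> C1; have {C1} C00 : C = 0 by lra.
have := key B (- (1 + A)); have := key 1 (- B); rewrite C00; nra.
Qed.

Lemma nrmr_tri u v : rL2 u -> rL2 v -> nrmr (fun x => u x + v x) <= nrmr u + nrmr v.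
Proof.
move=> lu lv; rewrite -(ler_pXn2r (ltn0Sn 1)) ?nnegrE ?addr_ge0 ?nrmr_ge0 //.
have luv := rL2_add lu lv.
rewrite nrmr_sqr dotr_addl // ![dotr _ (fun x => u x + v x)]dotrC !dotr_addl //.
rewrite [dotr v u]dotrC sqrrD -!nrmr_sqr; have := dotr_cs lu lv.
have := ler_norm (dotr u v); lra.
Qed.

Lemma nrmr_scale a u : rL2 u -> nrmr (fun x => a * u x) = `|a| * nrmr u.
Proof.
move=> lu; apply: (pexpIrn (n := 2)); rewrite ?nnegrE ?mulr_ge0 ?nrmr_ge0 //.
have l := rL2_scale a lu.
rewrite exprMn !nrmr_sqr dotr_scalel // dotrC dotr_scalel //.
by rewrite real_normK ?num_real // mulrA.
Qed.

Lemma nrmr_sub u v : rL2 u -> rL2 v -> nrmr (fun x => u x - v x) <= nrmr u + nrmr v.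
Proof.
move=> lu lv; have := nrmr_tri lu (rL2_scale (-1) lv).
rewrite nrmr_scale // normrN1 mul1r => h; apply: le_trans h.
by rewrite le_eqVlt; apply/orP; left; apply/eqP; congr nrmr; apply/funext => x; rewrite mulN1r.
Qed.

Lemma ae_dotr u u' v : measurable_fun [set: T] u -> measurable_fun [set: T] u' ->
  measurable_fun [set: T] v ->
  {ae mu, forall x, u x = u' x} -> dotr u v = dotr u' v.
Proof.
move=> m1 m2 m3 ae; rewrite /dotr /Rintegral; congr fine.
apply: ae_eq_integral => //.
- by apply/measurable_EFinP; exact: measurable_funM.
- by apply/measurable_EFinP; exact: measurable_funM.
- by apply: filterS ae => x e _; rewrite e.
Qed.

Lemma ae_nrmr u u' : measurable_fun [set: T] u -> measurable_fun [set: T] u' ->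
  {ae mu, forall x, u x = u' x} -> nrmr u = nrmr u'.
Proof.
move=> m1 m2 ae; congr Num.sqrt; rewrite (ae_dotr m1 m2 m1 ae) dotrC.
exact: ae_dotr.
Qed.

Lemma dotr_indic (A : set T) : measurable A -> dotr (\1_A) (\1_A) = fine (mu A).
Proof.
move=> mA; rewrite /dotr /Rintegral; congr fine; rewrite -(setIT A) -integral_indic // setIT.
by apply: eq_integral => x _; rewrite indicE; case: (x \in A); rewrite ?mulr1 ?mulr0.
Qed.

Lemma nrmr_indic (A : set T) : measurable A -> nrmr (\1_A) = Num.sqrt (fine (mu A)).
Proof. by move=> mA; rewrite /nrmr dotr_indic. Qed.

Lemma ler_nrmr u v : rL2 u -> rL2 v -> (forall x, `|u x| <= `|v x|) -> nrmr u <= nrmr v.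
Proof.
move=> lu lv uv; apply: ler_wsqrtr; apply: le_Rintegral => //; [exact: rL2_mul|exact: rL2_mul|].
move=> x _; rewrite -!expr2 -[leLHS]real_normK ?num_real // -[leRHS]real_normK ?num_real //.
by rewrite lerXn2r ?nnegrE.
Qed.

End RealL2.

(** * The flat function [exp (- 1 / t)] and its derivatives *)

Section FlatFunction.
Context {R : realType}.
Implicit Types (p : {poly R}) (s t : R).

Lemma poly_expR_bounded p k : exists C, forall s, 0 < s ->
  `|p.[s] * s ^+ k| * expR (- s) <= C.
Proof.
have base j s : 0 < s -> s ^+ j * expR (- s) <= j`!%:R.
  move=> s0; rewrite expRN ler_pdivrMr ?expR_gt0 //.
  case: j => [|j].
    by rewrite expr0 fact0 mul1r; have := expR_ge1Dx s; lra.
  rewrite mulrC -ler_pdivrMr ?ltr0n ?fact_gt0 //.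
  by apply: le_trans (expR_ge1Dxn j (ltW s0)); rewrite lerDr.
elim/poly_ind: p k => [|p a IH] k.
  by exists 0 => s _; rewrite horner0 mul0r normr0 mul0r.
have [C HC] := IH k.+1; exists (C + `|a| * k`!%:R) => s s0.
rewrite hornerMXaddC mulrDl; have := HC s s0; rewrite exprS mulrA => h.
apply: (le_trans (ler_wpM2r (expR_ge0 _) (ler_normD _ _))); rewrite mulrDl.
apply: lerD => //; rewrite normrM -mulrA; apply: ler_wpM2l => //.
by rewrite ger0_norm; [exact: base|rewrite exprn_ge0 // ltW].
Qed.

(** The polynomial factor in [1 / t] makes the family closed under differentiation, so smoothness
    becomes an induction over [p]. *)
Definition flat p t : R := if 0 < t then p.[t^-1] * expR (- t^-1) else 0.

(** With [s = 1 / t], the derivative of [p(s) exp (- s)] in [t] is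
    [s ^ 2 (p(s) - p'(s)) exp (- s)]. *)
Definition flat_next p : {poly R} := 'X^2 * (p - p^`()).

(** A quadratic bound is what makes the difference quotient at 0 tend to 0. *)
Lemma flat_quadratic p : exists C, forall t, `|flat p t| <= C * t ^+ 2.
Proof.
have [C HC] := poly_expR_bounded p 2; exists `|C| => t; rewrite /flat.
case: ifPn => [t0|_]; last by rewrite normr0 mulr_ge0 ?sqr_ge0.
have ti : 0 < t^-1 by rewrite invr_gt0.
have := HC _ ti; rewrite !normrM (ger0_norm (expR_ge0 _)) => h.
rewrite -ler_pdivrMr ?exprn_gt0 //; apply: le_trans (ler_norm C); apply: le_trans h.
by rewrite !(ger0_norm (ltW ti)) -invfM -expr2 mulrAC.
Qed.

Lemma is_derive_flat p t : is_derive t 1 (flat p) (flat (flat_next p) t).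
Proof.
have [t0|t0|<-] := ltgtP 0 t.
- apply: (@near_eq_is_derive _ _ _ (fun x : R => p.[x^-1] * expR (- x^-1) : R)).
  + near=> x; rewrite /flat; have -> // : 0 < x by near: x; exact: lt_nbhsr.
  have dV : is_derive t 1 (fun x : R => x^-1) (- t ^- 2).
    apply: DeriveDef; first by apply: derivableV; rewrite ?gt_eqF.
    by rewrite deriveV ?gt_eqF // derive_id scaler1.
  have d1 : is_derive t 1 (horner p \o (fun x : R => x^-1)) (p^`().[t^-1] * (- t ^- 2)).
    exact: is_derive1_comp.
  have d2 : is_derive t 1 (expR \o (fun x : R => - x^-1)) (expR (- t^-1) * t ^- 2).
    have d3 : is_derive t 1 (fun x : R => - x^-1) (t ^- 2).
      by apply: is_derive_eq (is_deriveN dV) _; rewrite opprK.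
    exact: is_derive1_comp.
  apply: is_derive_eq (is_deriveM d1 d2) _.
  rewrite /flat t0 /flat_next /= !hornerE /GRing.scale /= exprVn; ring.
- apply: (@near_eq_is_derive _ _ _ (fun x : R => 0 : R)).
  + near=> x; rewrite /flat; have x0 : x < 0 by near: x; exact: lt_nbhsl.
    by rewrite ltNge (ltW x0).
  rewrite /flat ltNge (ltW t0) /=; exact: is_derive_cst.
have [C HC] := flat_quadratic p.
have f0 q : flat q 0 = 0 by rewrite /flat ltxx.
have cv : (fun h : R => h^-1 *: ((flat p \o shift 0) (h *: 1) - flat p 0)) @ 0^' --> (0 : R).
  apply/cvgrPdist_le => e e0; near=> h.
  rewrite f0 subr0 sub0r normrN /= addr0 /GRing.scale /= mulr1 normrM normfV.
  have hn0 : h != 0 by near: h; exact: nbhs_dnbhs_neq.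
  have hp : 0 < `|h| by rewrite normr_gt0.
  rewrite mulrC ler_pdivrMr //; apply: (le_trans (HC h)).
  rewrite -[h ^+ 2]real_normK ?num_real // expr2 mulrA; apply: ler_wpM2r => //.
  apply: (@le_trans _ _ ((1 + `|C|) * `|h|)).
    by apply: ler_wpM2r => //; have := ler_norm C; lra.
  rewrite mulrC -ler_pdivlMr; last by have := normr_ge0 C; lra.
  near: h; apply: dnbhs0_le; rewrite divr_gt0 //; have := normr_ge0 C; lra.
rewrite f0; apply: DeriveDef; first by apply/cvg_ex; exists 0.
exact: cvg_lim cv.
Unshelve. all: by end_near. Qed.

Lemma differentiable_flat p t : differentiable (flat p) t.
Proof. by apply/derivable1_diffP; have [] := is_derive_flat p t. Qed.

Lemma flat1_ge0 t : 0 <= flat 1 t.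
Proof. by rewrite /flat; case: ifP => // _; rewrite hornerC mul1r expR_ge0. Qed.

Lemma flat1_le1 t : flat 1 t <= 1.
Proof.
rewrite /flat; case: ifP => // t0; rewrite hornerC mul1r -expR0 ler_expR oppr_le0.
by rewrite invr_ge0 ltW.
Qed.

Lemma flat1_ge s t : 0 < s -> s <= t -> 1 - s^-1 <= flat 1 t.
Proof.
move=> s0 st; have t0 : 0 < t by exact: lt_le_trans st.
rewrite /flat t0 hornerC mul1r; apply: le_trans (expR_ge1Dx _).
by rewrite lerD2l lerN2 lef_pV2.
Qed.

Lemma flat_eq0 p t : t <= 0 -> flat p t = 0.
Proof. by move=> t0; rewrite /flat ltNge t0. Qed.

End FlatFunction.

Section SmoothFunctions.
Context {R : realType} {d : nat}.
Implicit Types (f g : 'rV[R]_d -> R).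

Lemma cd_pred n f : continuously_differentiable n.+1 f -> continuously_differentiable n f.
Proof.
elim: n f => [|n IH] f [cf df] //.
by split=> // i; have [? ?] := df i; split=> //; exact: IH.
Qed.

Lemma cd_cst n a : continuously_differentiable n (fun _ : 'rV[R]_d => a).
Proof.
elim: n a => [|n IH] a /=; first exact: cst_continuous.
split; first exact: cst_continuous.
move=> i; split=> [x|]; first exact: derivable_cst.
have -> : (fun x : 'rV[R]_d => 'D_(delta_mx ord0 i) (fun=> a) x) = (fun=> 0).
  by apply/funext => x; exact: derive_cst.
exact: IH.
Qed.

Lemma cd_add n f g : continuously_differentiable n f -> continuously_differentiable n g ->
  continuously_differentiable n (fun x => f x + g x).
Proof.
elim: n f g => [|n IH] f g /=.
  by move=> cf cg x; apply: continuousD; [exact: cf|exact: cg].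
move=> [cf df] [cg dg]; split; first by move=> x; apply: continuousD; [exact: cf|exact: cg].
move=> i; have [df1 df2] := df i; have [dg1 dg2] := dg i; split.
  by move=> x; apply: derivableD.
have -> : (fun x => 'D_(delta_mx ord0 i) (fun x => f x + g x) x) =
   (fun x => 'D_(delta_mx ord0 i) f x + 'D_(delta_mx ord0 i) g x).
  by apply/funext => x; exact: deriveD.
exact: IH.
Qed.

Lemma cd_mul n f g : continuously_differentiable n f -> continuously_differentiable n g ->
  continuously_differentiable n (fun x => f x * g x).
Proof.
elim: n f g => [|n IH] f g.
  by move=> cf cg x; apply: continuousM; [exact: cf|exact: cg].
move=> cdf cdg; have cdf' := cd_pred cdf; have cdg' := cd_pred cdg.
have [cf df] := cdf; have [cg dg] := cdg; split.
  by move=> x; apply: continuousM; [exact: cf|exact: cg].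
move=> i; have [df1 df2] := df i; have [dg1 dg2] := dg i; split.
  by move=> x; apply: derivableM.
have -> : (fun x => 'D_(delta_mx ord0 i) (fun x => f x * g x) x) =
   (fun x => f x * 'D_(delta_mx ord0 i) g x + g x * 'D_(delta_mx ord0 i) f x).
  by apply/funext => x; exact: deriveM.
by apply: cd_add; apply: IH.
Qed.

Lemma cd_prod n (J : Type) (s : seq J) (F : J -> 'rV[R]_d -> R) :
  (forall j, continuously_differentiable n (F j)) ->
  continuously_differentiable n (fun x => \prod_(j <- s) F j x).
Proof.
move=> cF; elim: s => [|j s IH].
  have -> : (fun x => \prod_(j <- [::]) F j x) = (fun=> 1) by apply/funext => x; rewrite big_nil.
  exact: cd_cst.
have -> : (fun x => \prod_(j <- j :: s) F j x) = (fun x => F j x * \prod_(j <- s) F j x).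
  by apply/funext => x; rewrite big_cons.
exact: cd_mul.
Qed.

Lemma cd_flat n p (a b : R) (i : 'I_d) :
  continuously_differentiable n (fun x => flat p (a * x ord0 i + b)).
Proof.
have cont q : continuous (fun x : 'rV[R]_d => flat q (a * x ord0 i + b)).
  move=> x; apply: (@continuous_comp _ _ _ (fun x : 'rV[R]_d => a * x ord0 i + b) (flat q)).
    apply: continuousD; last exact: cst_continuous.
    by apply: continuousM; [exact: cst_continuous|exact: coord_continuous].
  by apply: differentiable_continuous; exact: differentiable_flat.
elim: n p => [|n IH] p; first exact: cont.
split; first exact: cont.
move=> j; set v := delta_mx ord0 j.
(* Along the coordinate vector [v] the argument moves with slope [c], which is [a] or 0, so the
   difference quotient is one of [flat p] in one variable. *)
pose c := a * v ord0 i.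
have quot x : (fun h : R => h^-1 *: (((fun x : 'rV[R]_d => flat p (a * x ord0 i + b)) \o shift x) (h *: v) -
     flat p (a * x ord0 i + b))) =
  (fun h : R => h^-1 *: ((flat p \o shift (a * x ord0 i + b)) (h *: c) - flat p (a * x ord0 i + b))).
  apply/funext => h; congr (_ *: (flat p _ - _)); rewrite /c !mxE /= /GRing.scale /=; ring.
have dflat y : derivable (flat p) y c /\ 'D_c (flat p) y = c * flat (flat_next p) y.
  have df := differentiable_flat p y; split; first exact: diff_derivable.
  have [_ e] := is_derive_flat p y.
  rewrite deriveE // -e deriveE //.
  have -> : c = c *: (1 : R) by rewrite /GRing.scale /= mulr1.
  by rewrite linearZ /= /GRing.scale /= mulr1.
split=> [x|].
  by rewrite /derivable quot; have [] := dflat (a * x ord0 i + b).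
have -> : (fun x => 'D_v (fun x : 'rV[R]_d => flat p (a * x ord0 i + b)) x) =
   (fun x => c * flat (flat_next p) (a * x ord0 i + b)).
  apply/funext => x; rewrite /derive quot; have [_ <-] := dflat (a * x ord0 i + b).
  by [].
by apply: cd_mul; [exact: cd_cst|exact: IH].
Qed.

End SmoothFunctions.

(** * Borel sets, half-open boxes and smooth bumps *)

Section Borel.
Context {R : realType} {d : nat}.
Local Notation E := (borelRd R d).

Lemma open_measurableRd (U : set 'rV[R]_d) : open U -> measurable (U : set E).
Proof. by move=> oU; apply: sub_sigma_algebra. Qed.

Lemma closed_measurableRd (U : set 'rV[R]_d) : closed U -> measurable (U : set E).
Proof.
by move=> cU; rewrite -[U]setCK; apply: measurableC; apply: open_measurableRd; exact: closed_openC.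
Qed.

Lemma continuous_at_measurable (U : set 'rV[R]_d) (f : 'rV[R]_d -> R) : open U ->
  (forall x, U x -> {for x, continuous f}) -> measurable_fun (U : set E) (f : E -> R).
Proof.
move=> oU cf; apply: (measurability _ (RGenOInfty.measurableE R)) => //.
move=> _ [_ [a ->] <-]; apply: open_measurableRd.
rewrite openE => x [Ux]; rewrite /= in_itv /= andbT => fx.
have := cf x Ux => /(_ [set z | a < z]) /= H.
rewrite /interior; near=> y; split; first by near: y; exact: open_nbhs_nbhs.
rewrite /= in_itv /= andbT; near: y; apply: H.
by apply: open_nbhs_nbhs; split => //; exact: open_gt.
Unshelve. all: by end_near. Qed.

Lemma continuous_measurableRd (f : 'rV[R]_d -> R) : continuous f ->
  measurable_fun setT (f : E -> R).
Proof. by move=> cf; apply: continuous_at_measurable => [|x _]; [exact: openT|exact: cf]. Qed.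

Lemma coord_measurable (i : 'I_d) : measurable_fun setT (fun x : E => (x : 'rV[R]_d) ord0 i).
Proof. by apply: continuous_measurableRd; exact: coord_continuous. Qed.

Definition hbox (a : 'rV[R]_d) (l : R) : set 'rV[R]_d :=
  [set y | forall i, a ord0 i <= y ord0 i < a ord0 i + l].

Lemma measurable_coord_sets (P : 'I_d -> set R) : (forall i, measurable (P i)) ->
  measurable ([set y : 'rV[R]_d | forall i, P i (y ord0 i)] : set E).
Proof.
move=> mP.
have -> : [set y : 'rV[R]_d | forall i, P i (y ord0 i)] =
    \bigcap_(i in [set: 'I_d]) [set y : 'rV[R]_d | P i (y ord0 i)].
  by apply/seteqP; split=> y /= h i; [move=> _; exact: h|exact: h].
apply: fin_bigcap_measurable => // i _.
by have := coord_measurable i measurableT (mP i); rewrite setTI.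
Qed.

Lemma measurable_hbox a l : measurable (hbox a l : set E).
Proof.
apply: (measurable_coord_sets (P := fun i => [set t | a ord0 i <= t < a ord0 i + l])) => i.
exact: (measurable_itv `[a ord0 i, (a ord0 i + l)[).
Qed.

Lemma measurable_cube c l : measurable (cube c l : set E).
Proof.
have -> : cube c l = [set y : 'rV[R]_d | forall i, [set t | c ord0 i - l / 2 <= t <= c ord0 i + l / 2] (y ord0 i)].
  by apply/seteqP; split=> y /= h i; have := h i; rewrite ler_distl.
apply: (measurable_coord_sets (P := fun i => [set t | c ord0 i - l / 2 <= t <= c ord0 i + l / 2])) => i.
exact: (measurable_itv `[(c ord0 i - l / 2), (c ord0 i + l / 2)]).
Qed.

(** The first factor has argument [K ^ 2 (y - a) + K]: it vanishes up to [a - 1 / K] and is nearly 1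
    from [a] on. The second has argument [K ^ 2 (a + l - y)] and vanishes from [a + l] on. The
    asymmetry makes the limit include the left face and exclude the right one, as in [hbox]. *)
Definition bump (K : R) (a : 'rV[R]_d) (l : R) (y : 'rV[R]_d) : R :=
  \prod_(i < d) (flat 1 (K ^+ 2 * y ord0 i + (K - K ^+ 2 * a ord0 i)) *
                 flat 1 ((- K ^+ 2) * y ord0 i + K ^+ 2 * (a ord0 i + l))).

Lemma bump_ge0 K a l y : 0 <= bump K a l y.
Proof. by apply: prodr_ge0 => i _; rewrite mulr_ge0 ?flat1_ge0. Qed.

Lemma bump_le1 K a l y : bump K a l y <= 1.
Proof.
apply: prodr_ile1 => i _; rewrite mulr_ge0 ?flat1_ge0 //=.
by rewrite -[leRHS]mulr1; apply: ler_pM; rewrite ?flat1_ge0 ?flat1_le1.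
Qed.

Lemma bump_smooth K a l : smooth (bump K a l).
Proof. by move=> n; apply: cd_prod => i; apply: cd_mul; exact: cd_flat. Qed.

Lemma bump_continuous K a l : continuous (bump K a l).
Proof. exact: (bump_smooth K a l 0). Qed.

Lemma bump_support K a l y : 0 < K -> bump K a l y != 0 ->
  forall i, a ord0 i - K^-1 < y ord0 i < a ord0 i + l.
Proof.
move=> K0 /prodf_neq0 h i; have {h} := h i isT; rewrite mulf_eq0 negb_or => /andP[h1 h2].
have K20 : 0 < K ^+ 2 by rewrite exprn_gt0.
apply/andP; split.
  rewrite ltNge; apply: contra h1 => h; apply/eqP/flat_eq0.
  have : K ^+ 2 * y ord0 i <= K ^+ 2 * (a ord0 i - K^-1) by rewrite ler_pM2l.
  have -> : K ^+ 2 * (a ord0 i - K^-1) = K ^+ 2 * a ord0 i - K by field; rewrite gt_eqF.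
  lra.
rewrite ltNge; apply: contra h2 => h; apply/eqP/flat_eq0.
have : K ^+ 2 * (a ord0 i + l) <= K ^+ 2 * y ord0 i by rewrite ler_pM2l.
lra.
Qed.

Lemma cvg_prod1 (s : seq 'I_d) (u : 'I_d -> nat -> R) :
  (forall i, u i n @[n --> \oo] --> (1 : R)) ->
  (\prod_(i <- s) u i n) @[n --> \oo] --> (1 : R).
Proof.
move=> cu; elim: s => [|i s IH].
  by under eq_cvg do rewrite big_nil; exact: cvg_cst.
under eq_cvg do rewrite big_cons.
have := cvgM (cu i) IH; rewrite mulr1; exact.
Qed.

Lemma bump_cvg a l y : bump n.+1%:R a l y @[n --> \oo] --> (\1_(hbox a l) y : R).
Proof.
rewrite indicE; case: (boolP (y \in hbox a l)) => [/[!inE] yb|]; last first.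
  rewrite notin_setE => /existsNP[i /negP]; rewrite negb_and => h.
  case/orP: h => h; last first.
    apply: cvg_near_cst; apply: nearW => n; apply/eqP; apply: contraT => nz.
    have n0 : 0 < n.+1%:R :> R by rewrite ltr0n.
    by have /andP[_ b2] := bump_support n0 nz i; rewrite b2 in h.
  rewrite -ltNge in h; have p : 0 < a ord0 i - y ord0 i by rewrite subr_gt0.
  apply: cvg_near_cst; near=> n; apply/eqP; apply: contraT => nz.
  have n0 : 0 < n.+1%:R :> R by rewrite ltr0n.
  have /andP[b1 _] := bump_support n0 nz i.
  have : n.+1%:R^-1 < a ord0 i - y ord0 i.
    by near: n; exact: (near_infty_natSinv_lt (PosNum p)).
  by rewrite ltrBrDl -ltrBrDr => /lt_trans /(_ b1); rewrite ltxx.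
apply: cvg_prod1 => i; have /andP[y1 y2] := yb i.
set t := y ord0 i in y1 y2 *; set b := a ord0 i in y1 y2 *.
have sq (f : nat -> R) (e : R) : 0 < e -> (forall n, e * n.+1%:R <= f n) ->
    flat 1 (f n) @[n --> \oo] --> (1 : R).
  move=> e0 hf; apply: (@squeeze_cvgr _ _ _ _ (fun n => 1 - e^-1 * n.+1%:R^-1) (fun=> 1)).
  - near=> n; rewrite flat1_le1 andbT -invfM; apply: flat1_ge (hf n).
    by rewrite mulr_gt0 // ltr0n.
  - have := cvgB (cvg_cst (1 : R)) (cvgM (cvg_cst e^-1) (@cvg_harmonic R)).
    by rewrite mulr0 subr0; exact.
  - exact: cvg_cst.
have c1 : flat 1 (n.+1%:R ^+ 2 * t + (n.+1%:R - n.+1%:R ^+ 2 * b)) @[n --> \oo] --> (1 : R).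
  apply: (sq _ 1) => // n; rewrite mul1r.
  have -> : n.+1%:R ^+ 2 * t + (n.+1%:R - n.+1%:R ^+ 2 * b) = n.+1%:R + n.+1%:R ^+ 2 * (t - b) :> R by ring.
  by rewrite lerDl mulr_ge0 ?sqr_ge0 // subr_ge0.
have c2 : flat 1 (- n.+1%:R ^+ 2 * t + n.+1%:R ^+ 2 * (b + l)) @[n --> \oo] --> (1 : R).
  apply: (sq _ (b + l - t)) => [|n]; first by rewrite subr_gt0.
  have -> : - n.+1%:R ^+ 2 * t + n.+1%:R ^+ 2 * (b + l) = (b + l - t) * n.+1%:R ^+ 2 :> R by ring.
  apply: ler_wpM2l; first by rewrite subr_ge0 ltW.
  by rewrite expr2 ler_peMr ?ler0n // ler1n.
have := cvgM c1 c2; rewrite mulr1; exact.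
Unshelve. all: by end_near. Qed.

Lemma compact_box (a b : 'rV[R]_d) :
  compact [set y : 'rV[R]_d | forall i, a ord0 i <= y ord0 i <= b ord0 i].
Proof.
have := @rV_compact _ _ (fun i => `[a ord0 i, b ord0 i]%classic)
  (fun i => @segment_compact _ (a ord0 i) (b ord0 i)).
congr compact; apply/seteqP; split=> y /= h i; have := h i; by rewrite in_itv.
Qed.

Lemma bump_supp K a l : 0 < K -> supp (fun x => (bump K a l x)%:C%C : R[i]) `<=`
  [set y | forall i, a ord0 i - K^-1 <= y ord0 i <= a ord0 i + l].
Proof.
move=> K0.
suff H : supp (fun x => (bump K a l x)%:C%C : R[i]) `<=`
   [set y | forall i, (a - const_mx K^-1) ord0 i <= y ord0 i <= (a + const_mx l) ord0 i].
  by move=> y /H /= h i; have := h i; rewrite !mxE.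
have cl := compact_closed (@norm_hausdorff _ _) (@compact_box (a - const_mx K^-1) (a + const_mx l)).
rewrite [X in _ `<=` X](closure_id _).1 //; apply: closureS => y /= h i.
have nz : bump K a l y != 0 by apply: contra h => /eqP ->.
by have /andP[/ltW h1 /ltW h2] := bump_support K0 nz i; rewrite !mxE h1.
Qed.

Lemma bump_compact K a l : 0 < K -> compact (supp (fun x => (bump K a l x)%:C%C : R[i])).
Proof.
move=> K0; have co := @compact_box (a - const_mx K^-1) (a + const_mx l).
apply: (subclosed_compact _ co); first exact: closed_closure.
by move=> y /(bump_supp K0) /= h i; have := h i; rewrite !mxE.
Qed.

End Borel.

(** * Dominated limits in the quadratic norm *)

Section Limits.
Context {d0 : measure_display} {T : measurableType d0} {R : realType}.
Variable mu : {finite_measure set T -> \bar R}.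

Lemma nrmr_cvg0_dominated (u_ : nat -> T -> R) (u g : T -> R) :
  (forall n, measurable_fun [set: T] (u_ n)) -> measurable_fun [set: T] u -> rL2 mu g ->
  (forall n x, `|u_ n x - u x| <= g x) ->
  (forall x, u_ n x @[n --> \oo] --> u x) ->
  nrmr mu (fun x => u_ n x - u x) @[n --> \oo] --> (0 : R).
Proof.
move=> mu_ mu1 [_ ig] b cv.
pose f_ n x : \bar R := ((u_ n x - u x) ^+ 2)%:E.
have mf n : measurable_fun [set: T] (f_ n).
  by apply/measurable_EFinP; apply: measurable_funX; exact: measurable_funB.
have key : (\int[mu]_x (f_ n x))%E @[n --> \oo] --> (\int[mu]_x (cst 0%E x))%E.
  have [] // := @dominated_convergence _ T R mu setT measurableT f_ (cst 0%E) (EFin \o (fun x => g x ^+ 2)) mf.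
  - apply: aeW => x _; rewrite /f_.
    have c1 : u_ n x - u x @[n --> \oo] --> (0 : R).
      by have := cvgB (cv x) (cvg_cst (u x)); rewrite subrr; exact.
    have := cvgM c1 c1; rewrite mulr0 => c2.
    by apply/cvg_EFin; [exact: nearW|exact: c2].
  - apply: aeW => x n _; rewrite /f_ /= lee_fin ger0_norm ?sqr_ge0 //.
    rewrite -[leLHS]real_normK ?num_real // lerXn2r ?nnegrE //.
    exact: le_trans (b n x).
have -> : (fun n => nrmr mu (fun x => u_ n x - u x)) = (fun n => Num.sqrt (fine (\int[mu]_x (f_ n x))%E)).
  apply/funext => n; congr (Num.sqrt (fine _)); exact: eq_integral.
rewrite integral0 in key.
suff : Num.sqrt (fine (\int[mu]_x (f_ n x))%E) @[n --> \oo] --> Num.sqrt (0 : R) by rewrite sqrtr0.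
exact: (cvg_comp _ _ (fine_cvg key) (@sqrt_continuous R 0)).
Qed.

Lemma nrmr_cvg0 (u_ : nat -> T -> R) (u : T -> R) :
  (forall n, measurable_fun [set: T] (u_ n)) -> measurable_fun [set: T] u ->
  (forall n x, `|u_ n x| <= 1) -> (forall x, `|u x| <= 1) ->
  (forall x, u_ n x @[n --> \oo] --> u x) ->
  nrmr mu (fun x => u_ n x - u x) @[n --> \oo] --> (0 : R).
Proof.
move=> mu_ mu1 b_ b; apply: (nrmr_cvg0_dominated mu_ mu1 (rL2_cst mu 2)) => n x.
by apply: le_trans (ler_normB _ _) _; have := b_ n x; have := b x; lra.
Qed.

Lemma measurable_if_in (D : set T) (f : T -> R) : measurable D -> measurable_fun D f ->
  measurable_fun [set: T] (fun x => if x \in D then f x else 0).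
Proof. by move=> mD /(measurable_restrictT _ mD). Qed.

Lemma cvg_le_cst (u_ : nat -> R) (l b : R) :
  u_ n @[n --> \oo] --> l -> (\forall n \near \oo, u_ n <= b) -> l <= b.
Proof.
move=> cv ub; rewrite -(cvg_lim _ cv) //; apply: limr_le ub.
by apply/cvg_ex; exists l.
Qed.

Lemma indic_le1 (S : set T) x : `|\1_S x : R| <= 1.
Proof. by rewrite indicE; case: (x \in S); rewrite ?normr1 ?normr0. Qed.

End Limits.

(** * Euclidean norm and coordinates *)

Section EuclideanNorm.
Context {R : realType} {d : nat}.
Implicit Types x y : 'rV[R]_d.

Lemma enorm_ge0 x : 0 <= enorm x. Proof. exact: sqrtr_ge0. Qed.

Lemma enorm0 : enorm (0 : 'rV[R]_d) = 0.
Proof. by rewrite /enorm big1 ?sqrtr0 // => i _; rewrite mxE expr0n. Qed.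

Lemma enormB x y : enorm (x - y) = enorm (y - x).
Proof. by congr Num.sqrt; apply: eq_bigr => i _; rewrite -opprB mxE sqrrN. Qed.

Lemma coord_le_enorm x i : `|x ord0 i| <= enorm x.
Proof.
rewrite -sqrtr_sqr; apply: ler_wsqrtr; rewrite (bigD1 i) //= lerDl.
by apply: sumr_ge0 => j _; exact: sqr_ge0.
Qed.

Lemma enorm_le x r : (forall i, `|x ord0 i| <= r) -> enorm x <= Num.sqrt d%:R * r.
Proof.
(* A negative [r] is possible only in dimension 0, where both sides vanish. *)
move=> h; have [r0|r0] := leP 0 r; last first.
  have d0 (i : 'I_d) : False by have := le_lt_trans (h i) r0; rewrite normr_lt0.
  rewrite /enorm big1 ?sqrtr0 => [|i]; last by case: (d0 i).
  suff -> : (d%:R : R) = 0 by rewrite sqrtr0 mul0r.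
  by case: (d) d0 => // n d0; case: (d0 ord0).
rewrite -[X in _ * X](ger0_norm r0) -sqrtr_sqr -sqrtrM ?ler0n //; apply: ler_wsqrtr.
have -> : d%:R * r ^+ 2 = \sum_(i < d) r ^+ 2 by rewrite sumr_const card_ord mulr_natl.
apply: ler_sum => i _.
by rewrite -[leLHS]real_normK ?num_real // lerXn2r ?nnegrE.
Qed.

Lemma enorm_gt0 x y : x != y -> 0 < enorm (x - y).
Proof.
move=> xy; rewrite lt_def enorm_ge0 andbT; apply: contra xy => /eqP e.
rewrite -subr_eq0; apply/eqP/rowP => i; rewrite [RHS]mxE.
by apply/eqP; rewrite -normr_le0 -e; exact: coord_le_enorm.
Qed.

Lemma open_eball x r : open (eball x r).
Proof.
have -> : eball x r = (fun y : 'rV[R]_d => enorm (y - x)) @^-1` [set t | t < r] by [].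
apply: open_comp; last exact: open_lt.
move=> y _; apply: (@continuous_comp _ _ _ (fun y : 'rV[R]_d => \sum_(i < d) (y - x) ord0 i ^+ 2) Num.sqrt); last exact: sqrt_continuous.
elim: (index_enum _) => [|i s IH].
  have -> : (fun y : 'rV[R]_d => \sum_(i <- [::]) (y - x) ord0 i ^+ 2) = (fun=> 0).
    by apply/funext => z; rewrite big_nil.
  exact: cst_continuous.
have -> : (fun y : 'rV[R]_d => \sum_(i <- i :: s) (y - x) ord0 i ^+ 2) =
    (fun y => (y ord0 i - x ord0 i) * (y ord0 i - x ord0 i) + \sum_(i <- s) (y - x) ord0 i ^+ 2).
  by apply/funext => z; rewrite big_cons !mxE expr2.
apply: continuousD => //; apply: continuousM; apply: continuousB;
  solve [exact: coord_continuous|exact: cst_continuous].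
Qed.

Lemma near_eball x r : 0 < r -> \forall y \near x, enorm (y - x) < r.
Proof.
move=> r0; apply: open_nbhs_nbhs; split; first exact: open_eball.
by rewrite /eball /= subrr /enorm big1 ?sqrtr0 // => i _; rewrite mxE expr0n.
Qed.

Definition obox (a : 'rV[R]_d) (l e : R) : set 'rV[R]_d :=
  [set y | forall i, a ord0 i - e < y ord0 i < a ord0 i + l + e].

Lemma open_obox a l e : open (obox a l e).
Proof.
have -> : obox a l e = [set y : 'rV[R]_d | forall (i : 'I_1) j, (fun _ j => `](a ord0 j - e), (a ord0 j + l + e)[%classic) i j (y i j)].
  apply/seteqP; split=> y h; first by move=> i j; rewrite (ord1 i) /= in_itv /=; exact: (h j).
  by move=> j; have := h ord0 j; rewrite /= in_itv.
rewrite openE => y h; exists (fun _ j => `](a ord0 j - e), (a ord0 j + l + e)[%classic) => //= i j.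
by apply: open_nbhs_nbhs; split; [exact: interval_open|move: h => /(_ i j)].
Qed.

End EuclideanNorm.

(** * Discretization *)

Section GridGeometry.
Context {R : realType} {d : nat}.
Variables (c0 : 'rV[R]_d) (n : nat).
Local Notation h := ((2 : R) ^- n).
Implicit Types (x y : {ffun 'I_d -> 'I_(2 ^ n)}) (z : 'rV[R]_d).

Lemma mesh_gt0 : 0 < h. Proof. by rewrite invr_gt0 exprn_gt0. Qed.

Definition gpt x : 'rV[R]_d := \row_i (c0 ord0 i + h * (x i)%:R).
Definition gcell x : set 'rV[R]_d := hbox (gpt x) h.
Definition gstep (f : {ffun 'I_d -> 'I_(2 ^ n)} -> R) z : R := \sum_y f y * \1_(gcell y) z.

Lemma gcell_uniq x y z : gcell x z -> gcell y z -> x = y.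
Proof.
move=> hx hy; apply/ffunP => i; apply: val_inj.
have := hx i; have := hy i; rewrite !mxE => /andP[y1 y2] /andP[x1 x2]; have h0 := mesh_gt0.
have l1 : h * (x i)%:R < h * ((y i).+1)%:R by rewrite -natr1; lra.
have l2 : h * (y i)%:R < h * ((x i).+1)%:R by rewrite -natr1; lra.
rewrite ltr_pM2l // ltr_nat ltnS in l1; rewrite ltr_pM2l // ltr_nat ltnS in l2.
by apply/eqP; rewrite eqn_leq l1 l2.
Qed.

Lemma gstep_cell f y z : gcell y z -> gstep f z = f y.
Proof.
move=> yz; rewrite /gstep (bigD1 y) //= indicE mem_set // mulr1 big1 ?addr0 // => y' ne.
rewrite indicE memNset ?mulr0 // => y'z; by rewrite (gcell_uniq y'z yz) eqxx in ne.
Qed.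

Lemma gcell_cover z : hbox c0 1 z -> exists y, gcell y z.
Proof.
move=> hz; have h0 := mesh_gt0; have n0 : 0 < (2 : R) ^+ n by rewrite exprn_gt0.
pose t i := (z ord0 i - c0 ord0 i) * 2 ^+ n.
have t0 i : 0 <= t i by have /andP[z1 _] := hz i; rewrite mulr_ge0 ?subr_ge0 // ltW.
have tl i : (Num.truncn (t i))%:R <= t i by rewrite truncn_le.
have t1 i : (Num.truncn (t i) < 2 ^ n)%N.
  have /andP[_ z2] := hz i; rewrite -(ltr_nat R); apply: le_lt_trans (tl i) _.
  by rewrite natrX /t -[ltRHS]mul1r ltr_pM2r //; lra.
exists [ffun i => Ordinal (t1 i)] => i; rewrite !mxE ffunE /=.
have tr := truncnS_gt (t i).
have -> : z ord0 i = c0 ord0 i + h * t i by rewrite /t mulrCA mulVf ?gt_eqF //; ring.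
have e1 : h * (Num.truncn (t i))%:R <= h * t i by rewrite ler_pM2l.
have e2 : h * t i < h * ((Num.truncn (t i))%:R + 1) by rewrite ltr_pM2l // natr1.
apply/andP; split; lra.
Qed.

Lemma gcell_sub y : gcell y `<=` hbox c0 1.
Proof.
move=> z hz i; have := hz i; rewrite !mxE => /andP[z1 z2]; have h0 := mesh_gt0.
have p : 0 <= h * (y i)%:R by rewrite mulr_ge0 ?ler0n // ltW.
have e : h * ((y i)%:R + 1) <= 1.
  by rewrite natr1 ler_pdivrMl ?exprn_gt0 // mulr1 -natrX ler_nat.
apply/andP; split; lra.
Qed.

Lemma gstep_out f z : ~ hbox c0 1 z -> gstep f z = 0.
Proof.
move=> hz; apply: big1 => y _; rewrite indicE memNset ?mulr0 //.
by move=> /gcell_sub.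
Qed.

Lemma gstep_mul f g z : gstep f z * gstep g z = gstep (fun y => f y * g y) z.
Proof.
have [hz|hz] := pselect (hbox c0 1 z); last by rewrite !gstep_out // mul0r.
by have [y yz] := gcell_cover hz; rewrite !(gstep_cell _ yz).
Qed.

Lemma gcell_obox x : gcell x `<=` obox (gpt x) h h.
Proof. by move=> z hz i; have /andP[z1 z2] := hz i; have h0 := mesh_gt0; apply/andP; split; lra. Qed.

Lemma gpt_obox x : obox (gpt x) h h (gpt x).
Proof. by move=> i; have h0 := mesh_gt0; apply/andP; split; lra. Qed.

Let kap : R := Num.sqrt d%:R + 1.

Lemma gdist_triangle x x0 y : (gdist x y <= gdist x x0 + gdist x0 y)%N.
Proof.
rewrite -ltnS; apply/gdist_ltP => // i.
by have := leq_gdist x x0 i; have := leq_gdist x0 y i; lia.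
Qed.

(** The bounds 8 and 4 absorb the three meshes lost in [obox_sep]: half of a distance of at least 8
    survives, and at least one mesh out of 4. *)
Lemma gdist_far a0 j x x0 y : (3 <= a0)%N -> (gdist x x0 < 2 ^ j)%N ->
  (2 ^ (j + a0) <= gdist x y)%N ->
  [/\ (0 < gdist x y)%N, (8 <= gdist x y)%N & (4 <= gdist x0 y)%N].
Proof.
move=> a3 n0 far; have tri := gdist_triangle x x0 y.
have far8 : (2 ^ j * 8 <= gdist x y)%N.
  by apply: leq_trans far; rewrite expnD leq_mul2l -[8%N]/(2 ^ 3)%N leq_exp2l // a3 orbT.
have j0 : (0 < 2 ^ j)%N by rewrite expn_gt0.
move: (2 ^ j)%N j0 n0 far8 tri => J; move: (gdist x y) (gdist x x0) (gdist x0 y) => a b c j0 n0 far8 tri.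
by split; lia.
Qed.

Lemma obox_gpt_le x x0 z D : (gdist x x0 < D)%N -> obox (gpt x) h h z ->
  enorm (z - gpt x0) <= kap * (2 * h * D%:R).
Proof.
move=> hD hz; have h0 := mesh_gt0.
apply: (@le_trans _ _ (Num.sqrt d%:R * (2 * h * D%:R))); last first.
  by apply: ler_wpM2r; [rewrite !mulr_ge0 // ltW|rewrite /kap lerDl].
apply: enorm_le => i; have := hz i; rewrite !mxE => /andP[z1 z2].
have D0 : (0 < D)%N by apply: leq_ltn_trans hD.
have /(gdist_ltP _ _ D0) /(_ i) hi := hD.
have a1 : (x i)%:R + 1 <= (x0 i)%:R + D%:R :> R by rewrite -natrD natr1 ler_nat; lia.
have a2 : (x0 i)%:R + 1 <= (x i)%:R + D%:R :> R by rewrite -natrD natr1 ler_nat; lia.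
have a3 : 1 <= D%:R :> R by rewrite ler1n.
move: z1 z2 h0 a1 a2 a3; move: h (x i)%:R (x0 i)%:R D%:R (z ord0 i) (c0 ord0 i) => H X X0 D' Z c z1 z2 h0 a1 a2 a3.
rewrite ler_norml; apply/andP; split; nra.
Qed.

(** An enlarged cell reaches one mesh below its corner and two meshes above it, which costs three
    meshes in the coordinate that realizes the distance. *)
Lemma obox_sep x y z z' : obox (gpt x) h h z -> obox (gpt y) h h z' -> (0 < gdist x y)%N ->
  h * (gdist x y)%:R - 3 * h <= enorm (z - z').
Proof.
move=> hz hz' D0; have h0 := mesh_gt0.
have [i ei] : exists i, gdist x y = ((x i - y i) + (y i - x i))%N.
  have [i hi] : exists i, ~ ((x i - y i) + (y i - x i) < gdist x y)%N.
    by apply/existsNP => /(gdist_ltP _ _ D0); rewrite ltnn.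
  exists i; apply/eqP; rewrite eqn_leq leq_gdist andbT; by rewrite leqNgt; apply/negP.
apply: le_trans (coord_le_enorm (z - z') i).
have := hz i; have := hz' i; rewrite !mxE => /andP[a1 a2] /andP[b1 b2].
have [xy|yx] := leqP (x i) (y i).
  have -> : gdist x y = (y i - x i)%N by rewrite ei; lia.
  by rewrite natrB // ler_normr mulrBr; apply/orP; right; lra.
have -> : gdist x y = (x i - y i)%N by rewrite ei; lia.
rewrite natrB; last exact: ltnW.
by rewrite ler_normr mulrBr; apply/orP; left; lra.
Qed.

(** Cubes of the shifted grid lattice become genuine half-open cubes, the sets to which the testing
    hypotheses extend. *)
Lemma gcell_gcube s k (J : {ffun 'I_d -> nat}) y z : gcell y z ->
  (gcube s k y == J) =
  (z \in hbox (\row_i (c0 ord0 i + h * ((2 ^ k * J i)%:R - s%:R))) (h * (2 ^ k)%:R)).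
Proof.
move=> hz; have h0 := mesh_gt0; have k0 : (0 < 2 ^ k)%N by rewrite expn_gt0.
apply/eqP/idP => [<-|].
  rewrite inE => i; have := hz i; rewrite !mxE ffunE => /andP[z1 z2].
  have d1 := leq_trunc_div (y i + s) (2 ^ k); have d2 := ltn_ceil (y i + s) k0.
  have e1 : (2 ^ k * ((y i + s) %/ 2 ^ k))%:R <= (y i)%:R + s%:R :> R.
    by rewrite -natrD ler_nat mulnC.
  have e2 : (y i)%:R + s%:R + 1 <= (2 ^ k * ((y i + s) %/ 2 ^ k))%:R + (2 ^ k)%:R :> R.
    rewrite -!natrD natr1 ler_nat; move: d2; rewrite mulSn [((_ %/ _) * _)%N]mulnC.
    by move: ((y i + s) %/ _)%N => Z; rewrite [(2 ^ k + _)%N]addnC.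
  move: e1 e2 z1 z2; set q := (_ * _)%:R; set b := (2 ^ k)%:R; move: h0; set H := h => *.
  apply/andP; split; nra.
rewrite inE => hz'; apply/ffunP => i; rewrite ffunE.
have := hz i; have := hz' i; rewrite !mxE => /andP[a1 a2] /andP[z1 z2].
have e1 : h * ((2 ^ k * J i)%:R) < h * ((y i)%:R + s%:R + 1) by lra.
have e2 : h * ((y i)%:R + s%:R) < h * ((2 ^ k * J i)%:R + (2 ^ k)%:R) by lra.
rewrite ltr_pM2l // -natrD natr1 ltr_nat ltnS in e1.
rewrite ltr_pM2l // -!natrD ltr_nat in e2.
apply/eqP; rewrite eqn_leq; apply/andP; split.
  by rewrite -ltnS ltn_divLR // mulSn [(J i * _)%N]mulnC [(2 ^ k + _)%N]addnC.
by rewrite leq_divRL // mulnC.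
Qed.

End GridGeometry.

(** The root of [C0] appears because the tests bound squared norms; the next two arguments are the
    constants of [growth_level] and [bnd_le]. *)
Definition Cgrid {R : realType} (d : nat) (m eps C0 : R) (a0 : nat) : R :=
  @Cfin R d (2 `^ (- eps)) (Num.sqrt C0) ((8 * (Num.sqrt d%:R + 1)) `^ m)
    ((2 * (Num.sqrt d%:R + 1)) `^ eps * 2 `^ (m + eps)) a0.

(** * Density of step functions on the grid *)

Section GridApproximation.
Context {R : realType} {d : nat}.
Variable mu : {finite_measure set (borelRd R d) -> \bar R}.
Variable c0 : 'rV[R]_d.
Hypothesis W_full : mu (~` hbox c0 1) = 0%E.
Local Notation E := (borelRd R d).
Implicit Types u v : E -> R.

Lemma measurable_gcell n (y : {ffun 'I_d -> 'I_(2 ^ n)}) : measurable (gcell c0 y : set E).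
Proof. exact: measurable_hbox. Qed.

Lemma dotr_indic1 (S : set E) : measurable S -> dotr mu (\1_S) (cst 1) = fine (mu S).
Proof.
move=> mS; rewrite -dotr_indic //; apply: eq_Rintegral => x _; rewrite indicE.
by case: (x \in S); rewrite ?mulr1 ?mulr0 ?mul0r.
Qed.

Lemma indic_cell_L2 n (y : {ffun 'I_d -> 'I_(2 ^ n)}) : rL2 mu (\1_(gcell c0 y)).
Proof. by apply: rL2_indic; exact: measurable_gcell. Qed.

Lemma gstep_L2 n (f : {ffun 'I_d -> 'I_(2 ^ n)} -> R) : rL2 mu (gstep c0 f).
Proof. by apply: rL2_sum => y; apply: rL2_scale; exact: indic_cell_L2. Qed.

Lemma gstep_lin n a (f g : {ffun 'I_d -> 'I_(2 ^ n)} -> R) (z : 'rV[R]_d) :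
  gstep c0 (fun y => a * f y + g y) z = a * gstep c0 f z + gstep c0 g z.
Proof.
rewrite /gstep mulr_sumr -big_split; apply: eq_bigr => y _ /=; ring.
Qed.

(** Approximation is required on all fine meshes rather than on one, so that two functions can be
    approximated on the same mesh. *)
Definition gridded u := forall e, 0 < e ->
  \forall n \near \oo, exists f, nrmr mu (fun x => u x - gstep c0 (n := n) f x) <= e.

Lemma gridded_lin a u v : rL2 mu u -> rL2 mu v -> gridded u -> gridded v ->
  gridded (fun x => a * u x + v x).
Proof.
move=> lu lv gu gv e e0.
have a1 : 0 < 1 + `|a| by rewrite ltr_pwDl.
have e1 : 0 < e / (2 * (1 + `|a|)) by rewrite divr_gt0 // mulr_gt0.
have e2 : 0 < e / 2 by rewrite divr_gt0.
have gu1 := gu _ e1; have gv1 := gv _ e2; apply: filterS2 gu1 gv1 => n [f hf] [g hg].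
exists (fun y => a * f y + g y).
have lf : rL2 mu (fun x => u x - gstep c0 f x) by apply: rL2_sub => //; exact: gstep_L2.
have lg : rL2 mu (fun x => v x - gstep c0 g x) by apply: rL2_sub => //; exact: gstep_L2.
have -> : (fun x => a * u x + v x - gstep c0 (fun y => a * f y + g y) x) =
    (fun x => a * (u x - gstep c0 f x) + (v x - gstep c0 g x)).
  by apply/funext => x; rewrite gstep_lin; ring.
apply: (le_trans (nrmr_tri (rL2_scale a lf) lg)); rewrite nrmr_scale //.
have : `|a| * nrmr mu (fun x => u x - gstep c0 f x) <= e / 2.
  move: hf; rewrite invfM mulrA ler_pdivlMr //; have := nrmr_ge0 mu (fun x => u x - gstep c0 f x).
  have := normr_ge0 a; nra.
lra.
Qed.

Lemma gridded_cvg (u_ : nat -> E -> R) u : (forall j, rL2 mu (u_ j)) -> rL2 mu u ->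
  (forall j, gridded (u_ j)) -> nrmr mu (fun x => u_ j x - u x) @[j --> \oo] --> (0 : R) ->
  gridded u.
Proof.
move=> l_ lu g_ c e e0; have e2 : 0 < e / 2 by rewrite divr_gt0.
have /cvgrPdist_le /(_ _ e2) [j _ /(_ j (leqnn j))] := c.
rewrite sub0r normrN ger0_norm ?nrmr_ge0 // => hj.
have gj := g_ j _ e2; apply: filterS gj => n [f hf]; exists f.
have lf : rL2 mu (fun x => u_ j x - gstep c0 f x) by apply: rL2_sub => //; exact: gstep_L2.
have ld : rL2 mu (fun x => u_ j x - u x) by apply: rL2_sub.
have -> : (fun x => u x - gstep c0 f x) =
    (fun x => (u_ j x - gstep c0 f x) - (u_ j x - u x)).
  by apply/funext => x; ring.
apply: (le_trans (nrmr_sub lf ld)); lra.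
Qed.

Lemma gridded_ae u v : rL2 mu u -> rL2 mu v -> {ae mu, forall x, u x = v x} ->
  gridded u -> gridded v.
Proof.
move=> lu lv uv gu e e0; have gu1 := gu e e0; apply: filterS gu1 => n [f hf]; exists f.
apply: le_trans hf; rewrite le_eqVlt; apply/orP; left; apply/eqP; apply: ae_nrmr.
- by case: (rL2_sub lv (gstep_L2 f)).
- by case: (rL2_sub lu (gstep_L2 f)).
- by apply: filterS uv => x ->.
Qed.

Lemma gcell_near n y (x z : 'rV[R]_d) : gcell c0 (n := n) y x -> gcell c0 y z ->
  enorm (z - x) <= Num.sqrt d%:R * 2 ^- n.
Proof.
move=> hx hz; apply: enorm_le => i; rewrite !mxE.
have := hx i; have := hz i; rewrite !mxE => /andP[a1 a2] /andP[b1 b2].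
by rewrite ler_norml; apply/andP; split; lra.
Qed.

Lemma open_enorm (U : set 'rV[R]_d) x : open U -> U x ->
  exists2 r, 0 < r & forall z, enorm (z - x) < r -> U z.
Proof.
rewrite openE => oU /oU; rewrite /interior => /nbhs_ballP[r r0 hr]; exists r => // z hz.
apply: hr; split=> // i j; rewrite (ord1 i) /ball /= distrC.
by apply: le_lt_trans hz; have := coord_le_enorm (z - x) j; rewrite !mxE.
Qed.

Lemma gridded_open (U : set 'rV[R]_d) : open U -> gridded (\1_U).
Proof.
move=> oU; have mU := open_measurableRd oU.
have mW : measurable (hbox c0 1 : set E) by exact: measurable_hbox.
have mUW : measurable (U `&` hbox c0 1 : set E) by exact: measurableI.
apply: (@gridded_ae (\1_(U `&` hbox c0 1))); [exact: rL2_indic|exact: rL2_indic| |].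
  exists (~` hbox c0 1); split=> //; first exact: measurableC.
  by move=> z /= nz hz; apply: nz; rewrite !indicE in_setI [z \in hbox c0 1]mem_set ?andbT.
(* The approximation is the union of the cells contained in [U]; a point of [U] in the unit box
   eventually lies in one of them, since the diameters tend to 0. *)
pose f n y : R := `[< gcell c0 (n := n) y `<=` U >]%:R.
have f1 n z : `|gstep c0 (f n) z| <= 1.
  have [hz|hz] := pselect (hbox c0 1 z); last by rewrite gstep_out // normr0.
  have [y yz] := gcell_cover n hz; rewrite (gstep_cell _ yz) /f.
  by case: asbool; rewrite ?normr1 ?normr0.
have c : nrmr mu (fun x => gstep c0 (f n) x - \1_(U `&` hbox c0 1) x) @[n --> \oo] --> (0 : R).
  apply: nrmr_cvg0.
  - by move=> n; case: (gstep_L2 (f n)).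
  - by apply: measurable_indic.
  - exact: f1.
  - exact: indic_le1.
  move=> z; apply: cvg_near_cst.
  have [hz|hz] := pselect (hbox c0 1 z); last first.
    by apply: nearW => n; rewrite gstep_out // indicE memNset // => -[].
  have [Uz|Uz] := pselect (U z); last first.
    apply: nearW => n; have [y yz] := gcell_cover n hz; rewrite (gstep_cell _ yz) /f.
    by rewrite asboolF => [|/(_ z yz) //]; rewrite indicE memNset // => -[].
  have [r r0 hr] := open_enorm oU Uz.
  have k1 : 0 < Num.sqrt d%:R + 1 :> R by rewrite ltr_wpDl ?sqrtr_ge0.
  have p : 0 < r / (Num.sqrt d%:R + 1) by rewrite divr_gt0.
  have := near_infty_natSinv_expn_lt (PosNum p); apply: filterS => n /= hn.
  have [y yz] := gcell_cover n hz; rewrite (gstep_cell _ yz) /f asboolT; last first.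
    move=> z' yz'; apply: hr; apply: le_lt_trans (gcell_near yz yz') _.
    move: hn; rewrite div1r ltr_pdivlMr //; have := @mesh_gt0 R n; have := sqrtr_ge0 (d%:R : R).
    move: (2 ^- n) (Num.sqrt _) => a b; nra.
  by rewrite indicE mem_set.
move=> e e0; have /cvgrPdist_le /(_ _ e0) := c; apply: filterS => n.
rewrite sub0r normrN ger0_norm ?nrmr_ge0 // => hn; exists (f n).
apply: le_trans hn; rewrite le_eqVlt; apply/orP; left; apply/eqP; congr Num.sqrt.
by apply: eq_Rintegral => x _; ring.
Qed.

(** Dynkin's argument: open sets are stable under intersection and generate the Borel sets,
    complements follow by linearity, and countable disjoint unions by dominated convergence. *)
Lemma gridded_set (S : set E) : measurable S -> gridded (\1_S).
Proof.
suff : forall S : set E, <<s @open 'rV[R]_d >> S -> measurable S -> gridded (\1_S) by move=> H mS; exact: H.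
clear S; apply: (@dynkin_induction _ E (@open 'rV[R]_d) (fun S => measurable S -> gridded (\1_S))) => //.
- by move=> A B; exact: openI.
- by move=> _; apply: gridded_open; exact: openT.
- by move=> U oU _; exact: gridded_open.
- move=> S mS gS mCS.
  have -> : \1_(~` S) = (fun x : E => -1 * \1_S x + \1_[set: E] x) :> (E -> R).
    apply/funext => x; rewrite !indicE in_setC in_setT; case: (x \in S) => /=; ring.
  apply: gridded_lin; [exact: rL2_indic|exact: rL2_indic|exact: gS|].
  by apply: gridded_open; exact: openT.
move=> F mF tF gF mU.
pose G n : E -> R := \1_(\big[setU/set0]_(i < n) F i).
have mG n : measurable (\big[setU/set0]_(i < n) F i) by apply: bigsetU_measurable.
have gG n : gridded (G n).
  elim: n => [|n IH]; first by rewrite /G big_ord0; apply: gridded_open; exact: open0.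
  have -> : G n.+1 = (fun x => 1 * G n x + \1_(F n) x).
    apply/funext => x; rewrite /G big_ord_recr /= mul1r !indicE in_setU.
    have [xF|xF] := boolP (x \in F n); last by rewrite orbF addr0.
    suff /negbTE -> : x \notin \big[setU/set0]_(i < n) F i by rewrite add0r.
    rewrite notin_setE -bigcup_mkord => -[i /= ilt Fi].
    rewrite inE in xF; have := tF i n I I (ex_intro _ x (conj Fi xF)) => ein.
    by rewrite ein ltnn in ilt.
  by apply: gridded_lin; [exact: rL2_indic|exact: rL2_indic|exact: IH|exact: gF].
apply: (@gridded_cvg G) => //; [by move=> j; exact: rL2_indic|exact: rL2_indic|].
apply: nrmr_cvg0.
- by move=> n; exact: measurable_indic.
- exact: measurable_indic.
- by move=> n x; exact: indic_le1.
- exact: indic_le1.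
- move=> x; apply: cvg_near_cst.
  have [[i _ Fi]|nF] := pselect ((\bigcup_k F k) x); last first.
    apply: nearW => n; have nG : ~ (\big[setU/set0]_(i < n) F i) x.
      by rewrite -bigcup_mkord => -[i _ Fi]; apply: nF; exists i.
    by rewrite /G !indicE !memNset.
  near=> n; have iG : (\big[setU/set0]_(i < n) F i) x.
    by rewrite -bigcup_mkord; exists i => //=; near: n; exact: nbhs_infty_gt.
  by rewrite /G !indicE !mem_set //; exists i.
Unshelve. all: by end_near. Qed.

Lemma gridded_sum (J : Type) (s : seq J) (c : J -> R) (F : J -> set E) :
  (forall j, measurable (F j)) -> gridded (fun x => \sum_(j <- s) c j * \1_(F j) x).
Proof.
move=> mF; elim: s => [|j s IH].
  have -> : (fun x : E => \sum_(j <- [::]) c j * \1_(F j) x) = \1_(@set0 E) :> (E -> R).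
    by apply/funext => x; rewrite big_nil indic0.
  exact: gridded_set.
have -> : (fun x => \sum_(i <- j :: s) c i * \1_(F i) x) = (fun x => c j * \1_(F j) x + \sum_(i <- s) c i * \1_(F i) x).
  by apply/funext => x; rewrite big_cons.
apply: gridded_lin => //; [exact: rL2_indic| |exact: gridded_set].
by apply: rL2_sum => i; apply: rL2_scale; exact: rL2_indic.
Qed.

Lemma gridded_ge0 u : rL2 mu u -> (forall x, 0 <= u x) -> gridded u.
Proof.
move=> lu u0; have mu1 : measurable_fun [set: E] (EFin \o u) by apply/measurable_EFinP; case: lu.
have f0 x : [set: E] x -> (0 <= (EFin \o u) x)%E by move=> _; rewrite lee_fin.
pose a n : E -> R := approx setT (EFin \o u) n.
have mA n k : measurable (dyadic_approx setT (EFin \o u) n k).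
  rewrite /dyadic_approx; case: ifPn => // _; rewrite -preimage_comp.
  by apply: mu1 => //; apply/measurable_image_EFin; exact: measurable_itv.
have mB n : measurable (integer_approx setT (EFin \o u) n).
  by apply: emeasurable_fun_c_infty.
have ga n : gridded (a n).
  pose c (i : option 'I_(n * 2 ^ n)) : R := if i is Some k then k%:R * 2 ^- n else n%:R.
  pose F (i : option 'I_(n * 2 ^ n)) : set E :=
    if i is Some k then dyadic_approx setT (EFin \o u) n k else integer_approx setT (EFin \o u) n.
  have := @gridded_sum _ (rcons [seq Some k | k <- index_enum 'I_(n * 2 ^ n)] None) c F.
  have -> : (fun x => \sum_(j <- rcons [seq Some k | k <- index_enum 'I_(n * 2 ^ n)] None) c j * \1_(F j) x) = a n.
    by apply/funext => x; rewrite big_rcons big_map.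
  by apply=> -[k|]; [exact: mA|exact: mB].
have la n x : 0 <= a n x <= u x.
  apply/andP; split; last by rewrite -lee_fin; exact: (le_approx n f0 (I : [set: E] x)).
  apply: addr_ge0; last by rewrite mulr_ge0 ?ler0n // indicE ler0n.
  by apply: sumr_ge0 => i _; rewrite !mulr_ge0 ?ler0n // ?indicE ?ler0n // invr_ge0 exprn_ge0.
have ma n : measurable_fun [set: E] (a n).
  apply: measurable_funD; last by apply: measurable_funM => //; exact: measurable_indic.
  by apply: measurable_sum => i; apply: measurable_funM => //; exact: measurable_indic.
have lu2 n : rL2 mu (a n).
  split=> //; apply: (@le_integrable _ _ _ _ _ _ _ (EFin \o (fun x => u x ^+ 2))) => //; last by case: lu.
    by apply/measurable_EFinP; exact: measurable_funX.
  move=> x _; rewrite /= lee_fin !ger0_norm ?sqr_ge0 // lerXn2r ?nnegrE //.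
    by have /andP[] := la n x.
  by have /andP[] := la n x.
apply: (@gridded_cvg a) => //; apply: (nrmr_cvg0_dominated ma _ lu); first by case: lu.
  by move=> n x; have /andP[a1 a2] := la n x; rewrite distrC ger0_norm ?subr_ge0 // lerBlDr lerDl.
by move=> x; have := cvg_approx f0 (I : [set: E] x) (ltry _).
Qed.

Lemma gridded_L2 u : rL2 mu u -> gridded u.
Proof.
move=> lu; have [mu1 iu] := lu.
have lp : rL2 mu (fun x => Num.max (u x) 0).
  split; first by apply: measurable_maxr.
  apply: (@le_integrable _ _ _ _ _ _ _ (EFin \o (fun x => u x ^+ 2))) => //.
    by apply/measurable_EFinP; apply: measurable_funX; exact: measurable_maxr.
  move=> x _; rewrite /= lee_fin !ger0_norm ?sqr_ge0 //.
  by rewrite /Num.max; case: ifP; rewrite // expr0n sqr_ge0.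
have ln := rL2_sub lp lu.
have -> : u = (fun x => -1 * (Num.max (u x) 0 - u x) + Num.max (u x) 0).
  by apply/funext => x; ring.
apply: gridded_lin => //; apply: gridded_ge0 => // x; first by rewrite subr_ge0 le_max lexx.
by rewrite le_max lexx orbT.
Qed.

End GridApproximation.

(** * Real operators with a smooth kernel off the diagonal *)

Section RealOperator.
Context {R : realType} {d : nat}.
Variable mu : {finite_measure set (borelRd R d) -> \bar R}.
Variables (P : ('rV[R]_d -> R) -> 'rV[R]_d -> R) (k : 'rV[R]_d -> 'rV[R]_d -> R).
Variables (A m eps C0 N : R).
Hypothesis P_L2 : forall u, rL2 mu u -> rL2 mu (P u).
Hypothesis P_lin : forall a u v, rL2 mu u -> rL2 mu v ->
  {ae mu, forall x, P (fun z => a * u z + v z) x = a * P u x + P v x}.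
Hypothesis P_ae : forall u v, rL2 mu u -> rL2 mu v ->
  {ae mu, forall x, u x = v x} -> {ae mu, forall x, P u x = P v x}.
Hypothesis N_ge0 : 0 <= N.
Hypothesis C0_ge0 : 0 <= C0.
Hypothesis P_bd : forall u, rL2 mu u -> nrmr mu (P u) <= N * nrmr mu u.
Hypothesis P_test : forall c l, 0 < l ->
  nrmr mu (P (\1_(cube c l))) <= Num.sqrt (C0 * fine (mu (cube c l))).
(** The test of the adjoint is stated in dual form, so that the real operator does not have to carry
    an adjoint of its own. *)
Hypothesis P_adj : forall u c l, rL2 mu u -> 0 < l ->
  `|dotr mu (P u) (\1_(cube c l))| <= nrmr mu u * Num.sqrt (C0 * fine (mu (cube c l))).

Local Notation E := (borelRd R d).

Lemma P_dotr_lin a u v g : rL2 mu u -> rL2 mu v -> rL2 mu g ->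
  dotr mu (P (fun z => a * u z + v z)) g = a * dotr mu (P u) g + dotr mu (P v) g.
Proof.
move=> lu lv lg; rewrite -dotr_linl //; [|exact: P_L2|exact: P_L2].
apply: ae_dotr; [|by have [] := rL2_lin a (P_L2 lu) (P_L2 lv)|by case: lg|exact: P_lin].
by have [] := P_L2 (rL2_lin a lu lv).
Qed.

Lemma P_dotr_sub u v g : rL2 mu u -> rL2 mu v -> rL2 mu g ->
  dotr mu (P (fun z => u z - v z)) g = dotr mu (P u) g - dotr mu (P v) g.
Proof.
move=> lu lv lg; have := P_dotr_lin (-1) lv lu lg.
have -> : (fun z => -1 * v z + u z) = (fun z => u z - v z) by apply/funext => z; ring.
by move=> ->; ring.
Qed.

Lemma P_dotr_sum (J : Type) (s : seq J) (f : J -> R) (F : J -> E -> R) g :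
  (forall j, rL2 mu (F j)) -> rL2 mu g ->
  dotr mu (P (fun z => \sum_(j <- s) f j * F j z)) g = \sum_(j <- s) f j * dotr mu (P (F j)) g.
Proof.
move=> lF lg; elim: s => [|j s IH].
  have -> : (fun z : E => \sum_(j <- [::]) f j * F j z) = (fun=> (0 : R) - 0).
    by apply/funext => z; rewrite big_nil subrr.
  have l0 := rL2_cst mu (0 : R).
  by rewrite big_nil (P_dotr_sub l0 l0 lg) subrr.
rewrite big_cons -IH -P_dotr_lin //.
  by congr (dotr mu (P _) g); apply/funext => z; rewrite big_cons.
by apply: rL2_sum => i; exact: rL2_scale.
Qed.

Lemma P_dotr_bd u g : rL2 mu u -> rL2 mu g ->
  `|dotr mu (P u) g| <= N * (nrmr mu u * nrmr mu g).
Proof.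
move=> lu lg; apply: (le_trans (dotr_cs (P_L2 lu) lg)); rewrite mulrA.
by apply: ler_wpM2r; [exact: nrmr_ge0|exact: P_bd].
Qed.

Lemma P_dotr_ae u v g : rL2 mu u -> rL2 mu v -> rL2 mu g ->
  {ae mu, forall x, u x = v x} -> dotr mu (P u) g = dotr mu (P v) g.
Proof.
move=> lu lv lg uv; apply: ae_dotr; [by case: (P_L2 lu)|by case: (P_L2 lv)|by case: lg|exact: P_ae].
Qed.

Lemma P_dotr_cvg (u_ : nat -> E -> R) (u g : E -> R) :
  (forall n, measurable_fun setT (u_ n)) -> measurable_fun setT u ->
  (forall n x, `|u_ n x| <= 1) -> (forall x, `|u x| <= 1) ->
  (forall x, u_ n x @[n --> \oo] --> u x) -> rL2 mu g ->
  dotr mu (P (u_ n)) g @[n --> \oo] --> dotr mu (P u) g.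
Proof.
move=> mu_ mu1 b_ b cv lg.
have l_ n : rL2 mu (u_ n) by apply: (@rL2_bounded _ _ _ _ _ 1).
have l : rL2 mu u by apply: (@rL2_bounded _ _ _ _ _ 1).
have c0 := nrmr_cvg0 mu mu_ mu1 b_ b cv.
apply/cvgrPdist_le => e e0.
have p : 0 < e / (1 + N * nrmr mu g) by rewrite divr_gt0 // ltr_pwDl ?mulr_ge0 ?nrmr_ge0.
have /cvgrPdist_le /(_ _ p) := c0; apply: filterS => n.
rewrite sub0r normrN ger0_norm ?nrmr_ge0 // => h.
rewrite distrC -P_dotr_sub //; apply: (le_trans (P_dotr_bd (rL2_sub (l_ n) l) lg)).
rewrite ler_pdivlMr in h; last by rewrite ltr_pwDl ?mulr_ge0 ?nrmr_ge0.
apply: le_trans h; have := nrmr_ge0 mu (fun x => u_ n x - u x); nra.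
Qed.

Lemma dotr_cvgr (u_ : nat -> E -> R) (u g : E -> R) :
  (forall n, measurable_fun setT (u_ n)) -> measurable_fun setT u ->
  (forall n x, `|u_ n x| <= 1) -> (forall x, `|u x| <= 1) ->
  (forall x, u_ n x @[n --> \oo] --> u x) -> rL2 mu g ->
  dotr mu g (u_ n) @[n --> \oo] --> dotr mu g u.
Proof.
move=> mu_ mu1 b_ b cv lg.
have l_ n : rL2 mu (u_ n) by apply: (@rL2_bounded _ _ _ _ _ 1).
have l : rL2 mu u by apply: (@rL2_bounded _ _ _ _ _ 1).
have c0 := nrmr_cvg0 mu mu_ mu1 b_ b cv.
apply/cvgrPdist_le => e e0.
have p : 0 < e / (1 + nrmr mu g) by rewrite divr_gt0 // ltr_pwDl ?nrmr_ge0.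
have /cvgrPdist_le /(_ _ p) := c0; apply: filterS => n.
rewrite sub0r normrN ger0_norm ?nrmr_ge0 // => h.
rewrite distrC ![dotr mu g _]dotrC -dotr_subl //; apply: (le_trans (dotr_cs (rL2_sub (l_ n) l) lg)).
rewrite ler_pdivlMr in h; last by rewrite ltr_pwDl ?nrmr_ge0.
apply: le_trans h; have := nrmr_ge0 mu (fun x => u_ n x - u x); nra.
Qed.

(* Only closed cubes are tested; half-open ones are their increasing limits. *)
Definition incube (a : 'rV[R]_d) (l : R) (n : nat) : set 'rV[R]_d :=
  cube (a + const_mx (l * (1 - n.+2%:R^-1) / 2)) (l * (1 - n.+2%:R^-1)).

Lemma incube_side (l : R) n : 0 < l -> 0 < l * (1 - n.+2%:R^-1).
Proof. by move=> l0; rewrite mulr_gt0 // subr_gt0 invf_lt1 ?ltr1n. Qed.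

Lemma incubeP a l n y : incube a l n y <->
  (forall i, a ord0 i <= y ord0 i <= a ord0 i + l * (1 - n.+2%:R^-1)).
Proof.
split=> h i; have := h i; rewrite !mxE ler_distl; set t := l * _.
  by move=> /andP[h1 h2]; apply/andP; split; lra.
by move=> /andP[h1 h2]; apply/andP; split; lra.
Qed.

Lemma incube_sub a l n : 0 < l -> incube a l n `<=` hbox a l.
Proof.
move=> l0 y /incubeP h i; have /andP[-> h2] := h i; apply: (le_lt_trans h2).
rewrite ltrD2l -[ltRHS]mulr1 ltr_pM2l // gtrDl oppr_lt0 invr_gt0 ltr0n //.
Qed.

Lemma incube_cvg a l y : 0 < l ->
  (\1_(incube a l n) y : R) @[n --> \oo] --> (\1_(hbox a l) y : R).
Proof.
move=> l0; apply: cvg_near_cst.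
have [yb|yb] := pselect (hbox a l y); last first.
  apply: nearW => n; rewrite !indicE !memNset //; by move=> /incube_sub h; apply/yb/h.
suff : \forall n \near \oo, forall i, y ord0 i <= a ord0 i + l * (1 - n.+2%:R^-1).
  apply: filterS => n hn; rewrite !indicE !mem_set //; apply/incubeP => i.
  by have /andP[-> _] := yb i; exact: hn.
apply: filter_forall => i; have /andP[_ y2] := yb i.
have p : 0 < (a ord0 i + l - y ord0 i) / l by rewrite divr_gt0 // subr_gt0.
have := near_infty_natSinv_lt (PosNum p); apply: filterS => n /= hn.
have : n.+2%:R^-1 <= n.+1%:R^-1 :> R by rewrite lef_pV2 ?posrE ?ltr0n // ler_nat.
move=> h2; have {h2} : n.+2%:R^-1 <= (a ord0 i + l - y ord0 i) / l by apply: le_trans h2 (ltW hn).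
by rewrite ler_pdivlMr //; set t := _^-1; lra.
Qed.

Lemma mu_incube a l n : 0 < l -> fine (mu (incube a l n)) <= fine (mu (hbox a l)).
Proof.
move=> l0; have m1 : measurable (incube a l n : set E) by exact: measurable_cube.
have m2 : measurable (hbox a l : set E) by exact: measurable_hbox.
apply: fine_le; [exact: fin_num_measure|exact: fin_num_measure|].
by apply: le_measure; rewrite ?inE //; exact: incube_sub.
Qed.

Lemma test_hbox a l g : 0 < l -> rL2 mu g ->
  `|dotr mu (P (\1_(hbox a l))) g| <= Num.sqrt (C0 * fine (mu (hbox a l))) * nrmr mu g.
Proof.
move=> l0 lg.
have c : dotr mu (P (\1_(incube a l n))) g @[n --> \oo] --> dotr mu (P (\1_(hbox a l))) g.
  apply: P_dotr_cvg => //.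
  - by move=> n; apply: measurable_indic; exact: measurable_cube.
  - by apply: measurable_indic; exact: measurable_hbox.
  - by move=> n x; exact: indic_le1.
  - by move=> x; exact: indic_le1.
  - by move=> x; exact: incube_cvg.
have cn : `|dotr mu (P (\1_(incube a l n))) g| @[n --> \oo] --> `|dotr mu (P (\1_(hbox a l))) g|.
  exact: cvg_norm c.
apply: (cvg_le_cst cn).
apply: nearW => n.
have li : rL2 mu (\1_(incube a l n)) by apply: rL2_indic; exact: measurable_cube.
apply: (le_trans (dotr_cs (P_L2 li) lg)); apply: ler_wpM2r; first exact: nrmr_ge0.
apply: (le_trans (P_test _ (incube_side n l0))); apply: ler_wsqrtr.
by apply: ler_wpM2l => //; exact: mu_incube.
Qed.

Lemma adj_hbox a l u : 0 < l -> rL2 mu u ->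
  `|dotr mu (P u) (\1_(hbox a l))| <= Num.sqrt (C0 * fine (mu (hbox a l))) * nrmr mu u.
Proof.
move=> l0 lu.
have c : dotr mu (P u) (\1_(incube a l n)) @[n --> \oo] --> dotr mu (P u) (\1_(hbox a l)).
  apply: dotr_cvgr.
  - by move=> n; apply: measurable_indic; exact: measurable_cube.
  - by apply: measurable_indic; exact: measurable_hbox.
  - by move=> n x; exact: indic_le1.
  - by move=> x; exact: indic_le1.
  - by move=> x; exact: incube_cvg.
  - exact: P_L2.
have cn : `|dotr mu (P u) (\1_(incube a l n))| @[n --> \oo] --> `|dotr mu (P u) (\1_(hbox a l))|.
  exact: cvg_norm c.
apply: (cvg_le_cst cn).
apply: nearW => n.
apply: (le_trans (P_adj _ lu (incube_side n l0))); rewrite mulrC.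
apply: ler_wpM2r; first exact: nrmr_ge0.
by apply: ler_wsqrtr; apply: ler_wpM2l => //; exact: mu_incube.
Qed.

Hypothesis eps_gt0 : 0 < eps.
Hypothesis m_gt0 : 0 < m.
Hypothesis k_size : forall x y, x != y -> `|k x y| <= enorm (x - y) `^ (- m).
Hypothesis k_l : forall x x' y, x != y -> x' != y -> A * enorm (x - x') <= enorm (x - y) ->
  `|k x y - k x' y| <= enorm (x - x') `^ eps / enorm (x - y) `^ (m + eps).
Hypothesis k_r : forall x y y', x != y -> x != y' -> A * enorm (y - y') <= enorm (x - y) ->
  `|k x y - k x y'| <= enorm (y - y') `^ eps / enorm (x - y) `^ (m + eps).
Hypothesis P_ker : forall phi, smooth phi -> compact (supp (fun x => (phi x)%:C%C : R[i])) ->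
  {ae mu, forall x, ~ supp (fun x => (phi x)%:C%C : R[i]) x ->
    P phi x = \int[mu]_y (k x y * phi y)}.

Lemma holder_small (D e : R) : 0 < D -> 0 < e ->
  exists2 r, 0 < r & forall t, 0 <= t -> t < r -> A * t <= D /\ t `^ eps / D `^ (m + eps) <= e.
Proof.
move=> D0 e0; have D1 : 0 < D `^ (m + eps) by rewrite powR_gt0.
pose r1 := D / (1 + `|A|); pose r2 := (e * D `^ (m + eps)) `^ eps^-1.
have A1 : 0 < 1 + `|A| by rewrite ltr_pwDl.
exists (Order.min r1 r2).
  by rewrite lt_min divr_gt0 //= powR_gt0 // mulr_gt0.
move=> t t0; rewrite lt_min => /andP[t1 t2]; split.
  move: t1; rewrite ltr_pdivlMr // => t1; apply: le_trans (ltW t1).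
  by have := ler_norm A; nra.
rewrite ler_pdivrMr //.
have -> : e * D `^ (m + eps) = r2 `^ eps.
  by rewrite -powRrM mulVf ?gt_eqF // powRr1 // mulr_ge0 // ltW.
by apply: ge0_ler_powR; rewrite ?nnegrE ?powR_ge0 // ltW.
Qed.

Lemma k_continuous_r x y : x != y -> {for y, continuous (k x)}.
Proof.
move=> xy; have D0 := enorm_gt0 xy.
apply/(@cvgrPdist_le _ _ _ (nbhs y) (nbhs_filter y)) => e e0; have [r r0 hr] := holder_small D0 e0.
apply: (@filterS2 _ (nbhs y) _ _ _ _ _ (near_eball y D0) (near_eball y r0)) => z h1 h2.
have xz : x != z by apply: contraTneq h1 => <-; rewrite -leNgt.
rewrite enormB in h2; have [a1 a2] := hr _ (enorm_ge0 _) h2.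
exact: le_trans (k_r xy xz a1) a2.
Qed.

Lemma k_continuous_l x y : x != y -> {for x, continuous (fun x => k x y)}.
Proof.
move=> xy; have D0 := enorm_gt0 xy.
apply/(@cvgrPdist_le _ _ _ (nbhs x) (nbhs_filter x)) => e e0; have [r r0 hr] := holder_small D0 e0.
apply: (@filterS2 _ (nbhs x) _ _ _ _ _ (near_eball x D0) (near_eball x r0)) => z h1 h2.
have zy : z != y by apply: contraTneq h1 => ->; rewrite -leNgt enormB.
rewrite enormB in h2; have [a1 a2] := hr _ (enorm_ge0 _) h2.
exact: le_trans (k_l xy zy a1) a2.
Qed.

Lemma k_bound rho x y : 0 < rho -> rho <= enorm (x - y) -> `|k x y| <= (rho `^ m)^-1.
Proof.
move=> r0 h; have xy : x != y.
  apply: contraTneq (lt_le_trans r0 h) => ->; rewrite subrr /enorm big1 ?sqrtr0 ?ltxx //.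
  by move=> i _; rewrite mxE expr0n.
apply: (le_trans (k_size xy)); rewrite powRN lef_pV2 ?posrE ?powR_gt0 //; last first.
  exact: lt_le_trans h.
by apply: ge0_ler_powR; rewrite ?nnegrE ?enorm_ge0 // ltW.
Qed.

Lemma dotr_le_bound (v phi : E -> R) b : rL2 mu v -> rL2 mu phi ->
  (forall x, 0 <= phi x) -> (forall x, `|v x| <= b) ->
  `|dotr mu v phi| <= b * dotr mu phi (cst 1).
Proof.
move=> lv lp p0 vb; have i1 := rL2_mul lv lp; have i2 := rL2_mul lp (rL2_cst mu 1).
have i3 := rL2_mul (rL2_scale b lp) (rL2_cst mu 1).
apply: (le_trans (le_normr_Rintegral measurableT i1)).
rewrite -dotr_scalel //; last exact: rL2_cst.
apply: le_Rintegral => //; first exact: (integrable_norm i1).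
by move=> x _; rewrite normrM (ger0_norm (p0 x)) mulr1; apply: ler_wpM2r.
Qed.

Lemma dotr_ae_bound (v : E -> R) (S : set E) b : rL2 mu v -> measurable S -> 0 <= b ->
  {ae mu, forall x, S x -> `|v x| <= b} ->
  `|dotr mu v (\1_S)| <= b * fine (mu S).
Proof.
move=> lv mS b0 vb; have lS := rL2_indic mu mS.
(* The bound holds only almost everywhere on [S]; clamping to [[- b, b]] makes it hold at every
   point without changing the pairing. *)
pose v' x := Num.max (- b) (Num.min b (v x)).
have mv' : measurable_fun [set: E] v'.
  apply: measurable_maxr; first exact: measurable_cst.
  by apply: measurable_minr; [exact: measurable_cst|case: lv].
have bv' x : `|v' x| <= b.
  rewrite /v' ler_norml le_max lexx /= ge_max ge_min lexx andbT; lra.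
have lv' : rL2 mu v' by apply: rL2_bounded mv' bv'.
have <- : dotr mu v' (\1_S) = dotr mu v (\1_S).
  have e u : measurable_fun [set: E] u -> dotr mu u (\1_S) = dotr mu (fun x => u x * \1_S x) (cst 1).
    by move=> _; apply: eq_Rintegral => x _; rewrite mulr1.
  rewrite !e; [|by case: lv|by []].
  apply: ae_dotr; [by apply: measurable_funM => //; case: lS|
    by apply: measurable_funM; [case: lv|case: lS]|by []|].
  apply: filterS vb => x h; rewrite indicE; case: (boolP (x \in S)) => [/[!inE] /h|]; last by rewrite !mulr0.
  by rewrite ler_norml => /andP[h1 h2]; rewrite /v' (min_r h2) (max_r h1).
apply: (le_trans (dotr_le_bound lv' lS _ bv')); first by move=> x; rewrite indicE ler0n.
rewrite le_eqVlt; apply/orP; left; apply/eqP; congr (_ * _).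
rewrite -dotr_indic //; apply: eq_Rintegral => x _; rewrite indicE.
by case: (x \in S); rewrite ?mulr1 ?mul0r.
Qed.

(** * Kernel representation for pairs of separated cells *)

Section Pairing.
Variables (a : 'rV[R]_d) (l e rho : R) (S : set E).
Hypotheses (l_gt0 : 0 < l) (e_gt0 : 0 < e) (rho_gt0 : 0 < rho) (mS : measurable S).
Local Notation U := (obox a l e).
Local Notation Q := (hbox a l).

Let mU : measurable (U : set E). Proof. by apply: open_measurableRd; exact: open_obox. Qed.

(* The cut-off to a neighbourhood of [Q] makes the truncated kernel bounded. *)
Definition row_of x (c : R) (y : 'rV[R]_d) : R := if y \in U then k x y - c else 0.

Lemma measurable_row x c : (forall y, U y -> rho <= enorm (x - y)) ->
  measurable_fun setT (row_of x c : E -> R).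
Proof.
move=> hx; apply: (@measurable_if_in _ E R U (fun y => k x y - c) mU).
apply: (@continuous_at_measurable _ _ U (fun y => k x y - c)); first exact: open_obox.
move=> y /hx h; apply: continuousB; last exact: cst_continuous.
by apply: k_continuous_r; apply: contraTneq (lt_le_trans rho_gt0 h) => ->; rewrite subrr enorm0 ltxx.
Qed.

Lemma row_L2 x c : (forall y, U y -> rho <= enorm (x - y)) -> rL2 mu (row_of x c).
Proof.
move=> hx; apply: (@rL2_bounded _ _ _ _ _ ((rho `^ m)^-1 + `|c|)); first exact: measurable_row.
move=> y; rewrite /row_of; case: ifPn => [/[!inE] /hx /(k_bound rho_gt0) h|_].
  by apply: le_trans (ler_normB _ _) _; rewrite lerD2r.
by rewrite normr0 addr_ge0 // invr_ge0 powR_ge0.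
Qed.

Let bmp (j : nat) : E -> R := bump j.+1%:R a l.

Let bmp_L2 j : rL2 mu (bmp j).
Proof.
apply: (@rL2_bounded _ _ _ _ _ 1); first by apply: continuous_measurableRd; exact: bump_continuous.
by move=> x; rewrite ger0_norm ?bump_ge0 // bump_le1.
Qed.

Let large j := j.+1%:R^-1 < e.

Let bmp_out j y : large j -> y \notin U -> bmp j y = 0.
Proof.
have K0 : 0 < j.+1%:R :> R by rewrite ltr0n.
move=> lj yU; apply/eqP; apply: contraNT yU => /(bump_support K0) h; rewrite inE => i.
have /andP[h1 h2] := h i; move: lj h1 h2 e_gt0; rewrite /large; move: (j.+1%:R^-1) => t *; apply/andP; split; lra.
Qed.

Lemma dotr_row x c j : large j -> (forall y, U y -> rho <= enorm (x - y)) ->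
  dotr mu (row_of x c) (bmp j) = dotr mu (row_of x 0) (bmp j) - c * dotr mu (bmp j) (cst 1).
Proof.
move=> lj hx; rewrite -dotr_scalel //; last exact: rL2_cst.
rewrite /dotr -RintegralB //; last exact: (rL2_mul (rL2_scale c (bmp_L2 j)) (rL2_cst mu 1)).
  apply: eq_Rintegral => y _; rewrite /row_of; rewrite /cst; case: (boolP (y \in U)) => yU; first by ring.
  by rewrite (bmp_out lj yU) !mulr0 mul0r subrr.
exact: (rL2_mul (row_L2 0 hx) (bmp_L2 j)).
Qed.

Hypothesis S_sep : forall x y, S x -> U y -> rho <= enorm (x - y).

(** For large [j] the support of the bump stays in [U], and separation keeps [S] out of [U]; hence
    the kernel formula for smooth functions applies on [S]. *)
Lemma P_bump j : large j ->
  {ae mu, forall x, S x -> P (bmp j) x = dotr mu (row_of x 0) (bmp j)}.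
Proof.
have K0 : 0 < j.+1%:R :> R by rewrite ltr0n.
move=> lj; have ae := P_ker (@bump_smooth _ _ j.+1%:R a l) (@bump_compact _ _ j.+1%:R a l K0).
apply: (@filterS E (almost_everywhere mu) _ _ _ _ ae) => x h Sx; rewrite -[LHS]/(P (bump j.+1%:R a l) x) h.
  apply: eq_Rintegral => y _; rewrite /row_of; case: (boolP (y \in U)) => yU; first by rewrite subr0.
  by rewrite -/(bmp j y) (bmp_out lj yU) !mulr0.
move=> /(bump_supp K0) /= hs.
have Ux : U x by move=> i; have /andP[h1 h2] := hs i; move: lj h1 h2 e_gt0; rewrite /large; move: (j.+1%:R^-1) => t *; apply/andP; split; lra.
by have := lt_le_trans rho_gt0 (S_sep Sx Ux); rewrite subrr enorm0 ltxx.
Qed.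

Let near_large : \forall j \near \oo, large j.
Proof. exact: near_infty_natSinv_lt (PosNum e_gt0). Qed.

Let cvg_bmp_r g : rL2 mu g -> dotr mu g (bmp j) @[j --> \oo] --> dotr mu g (\1_Q).
Proof.
move=> lg; apply: dotr_cvgr => //.
- by move=> j; case: (bmp_L2 j).
- by apply: measurable_indic; exact: measurable_hbox.
- by move=> j x; rewrite ger0_norm ?bump_ge0 // bump_le1.
- exact: indic_le1.
- by move=> x; exact: bump_cvg.
Qed.

Let cvg_P_bmp g : rL2 mu g -> dotr mu (P (bmp j)) g @[j --> \oo] --> dotr mu (P (\1_Q)) g.
Proof.
move=> lg; apply: P_dotr_cvg => //.
- by move=> j; case: (bmp_L2 j).
- by apply: measurable_indic; exact: measurable_hbox.
- by move=> j x; rewrite ger0_norm ?bump_ge0 // bump_le1.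
- exact: indic_le1.
- by move=> x; exact: bump_cvg.
Qed.

Let mass_bmp : dotr mu (bmp j) (cst 1) @[j --> \oo] --> fine (mu Q).
Proof.
have c := cvg_bmp_r (rL2_cst mu 1).
have mQ : measurable (Q : set E) by exact: measurable_hbox.
have <- : dotr mu (cst 1) (\1_Q) = fine (mu Q).
  rewrite -dotr_indic //; apply: eq_Rintegral => x _; rewrite indicE.
  by case: (x \in Q); rewrite ?mulr1 ?mulr0.
by under eq_cvg do rewrite dotrC.
Qed.

(** The kernel formula is available only for smooth functions, so [1_Q] is replaced by bumps, for
    which the estimate is pointwise almost everywhere on [S]. All terms converge, the operator term
    thanks to the a priori bound. *)
Lemma pairing_l x0 b : (forall y, U y -> rho <= enorm (x0 - y)) -> 0 <= b ->
  (forall x y, S x -> U y -> `|k x y - k x0 y| <= b) ->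
  `|dotr mu (P (\1_Q)) (\1_S) - fine (mu S) * dotr mu (row_of x0 0) (\1_Q)|
    <= b * (fine (mu S) * fine (mu Q)).
Proof.
move=> hx0 b0 hb; have lS := rL2_indic mu mS; have l0 := row_L2 0 hx0.
pose X j := dotr mu (P (bmp j)) (\1_S) - fine (mu S) * dotr mu (row_of x0 0) (bmp j).
have cX : X j @[j --> \oo] --> dotr mu (P (\1_Q)) (\1_S) - fine (mu S) * dotr mu (row_of x0 0) (\1_Q).
  apply: cvgB; first exact: cvg_P_bmp.
  by apply: cvgM; [exact: cvg_cst|exact: cvg_bmp_r].
have cY : `|X j| - b * (fine (mu S) * dotr mu (bmp j) (cst 1)) @[j --> \oo] -->
    `|dotr mu (P (\1_Q)) (\1_S) - fine (mu S) * dotr mu (row_of x0 0) (\1_Q)| - b * (fine (mu S) * fine (mu Q)).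
  apply: cvgB; first exact: cvg_norm cX.
  by apply: cvgM; [exact: cvg_cst|apply: cvgM; [exact: cvg_cst|exact: mass_bmp]].
rewrite -subr_le0; apply: (cvg_le_cst cY); apply: filterS near_large => j lj.
rewrite subr_le0 mulrCA mulrC /X.
set c := dotr mu (row_of x0 0) (bmp j).
have lv : rL2 mu (fun x => P (bmp j) x - c) by apply: rL2_sub; [exact: P_L2|exact: rL2_cst].
have -> : dotr mu (P (bmp j)) (\1_S) - fine (mu S) * c = dotr mu (fun x => P (bmp j) x - c) (\1_S).
  rewrite dotr_subl //; [|exact: P_L2|exact: rL2_cst].
  congr (_ - _); rewrite -dotr_indic // mulrC -dotr_scalel //.
  apply: eq_Rintegral => x _; rewrite indicE; case: (x \in S); rewrite ?mulr1 ?mulr0 //.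
apply: dotr_ae_bound => //.
  rewrite mulr_ge0 //; apply: Rintegral_ge0 => x _; rewrite mulr1; exact: bump_ge0.
apply: filterS (P_bump lj) => x h Sx; rewrite h // /c -dotr_subl //; last exact: row_L2 0 (fun y => @S_sep x y Sx).
  apply: dotr_le_bound => //.
  - by apply: rL2_sub => //; exact: row_L2 _ (fun y => @S_sep x y Sx).
  - exact: bump_ge0.
  - move=> y; rewrite /row_of; case: (boolP (y \in U)) => [/[!inE] yU|_]; last by rewrite subrr normr0.
    by rewrite !subr0; exact: hb.
Qed.

Definition column (y0 x : 'rV[R]_d) : R := if x \in S then k x y0 else 0.

Lemma column_L2 y0 : (forall x, S x -> rho <= enorm (x - y0)) -> rL2 mu (column y0).
Proof.
move=> hy; apply: (@rL2_bounded _ _ _ _ _ (rho `^ m)^-1); last first.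
  move=> y; rewrite /column; case: ifPn => [/[!inE] /hy /(k_bound rho_gt0) h //|_].
  by rewrite normr0 invr_ge0 powR_ge0.
apply: (@measurable_if_in _ E R S (k^~ y0) mS).
have oy : open (~` [set y0] : set 'rV[R]_d).
  by apply: closed_openC; apply: (accessible_closed_set1 (hausdorff_accessible _)); exact: norm_hausdorff.
apply: (@measurable_funS _ _ E R (~` [set y0])); first exact: open_measurableRd.
  by move=> x /hy h /= e0; move: (lt_le_trans rho_gt0 h); rewrite e0 subrr enorm0 ltxx.
apply: (@continuous_at_measurable _ _ (~` [set y0]) (fun x => k x y0)) => // x /eqP xy.
exact: k_continuous_l.
Qed.

Lemma pairing_r y0 b : (forall x, S x -> rho <= enorm (x - y0)) -> 0 <= b ->
  (forall x y, S x -> U y -> `|k x y - k x y0| <= b) ->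
  `|dotr mu (P (\1_Q)) (\1_S) - fine (mu Q) * dotr mu (column y0) (\1_S)|
    <= b * (fine (mu S) * fine (mu Q)).
Proof.
move=> hy0 b0 hb; have lS := rL2_indic mu mS; have l0 := column_L2 hy0.
pose X j := dotr mu (P (bmp j)) (\1_S) - dotr mu (bmp j) (cst 1) * dotr mu (column y0) (\1_S).
have cX : X j @[j --> \oo] --> dotr mu (P (\1_Q)) (\1_S) - fine (mu Q) * dotr mu (column y0) (\1_S).
  apply: cvgB; first exact: cvg_P_bmp.
  by apply: cvgM; [exact: mass_bmp|exact: cvg_cst].
have cY : `|X j| - b * (fine (mu S) * dotr mu (bmp j) (cst 1)) @[j --> \oo] -->
    `|dotr mu (P (\1_Q)) (\1_S) - fine (mu Q) * dotr mu (column y0) (\1_S)| - b * (fine (mu S) * fine (mu Q)).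
  apply: cvgB; first exact: cvg_norm cX.
  by apply: cvgM; [exact: cvg_cst|apply: cvgM; [exact: cvg_cst|exact: mass_bmp]].
rewrite -subr_le0; apply: (cvg_le_cst cY); apply: filterS near_large => j lj.
rewrite subr_le0 mulrCA mulrC /X.
set c := dotr mu (bmp j) (cst 1).
rewrite -dotr_scalel // -dotr_subl //; [|exact: P_L2|exact: rL2_scale].
apply: dotr_ae_bound => //.
- by apply: rL2_sub; [exact: P_L2|exact: rL2_scale].
- rewrite mulr_ge0 //; apply: Rintegral_ge0 => x _; rewrite mulr1; exact: bump_ge0.
apply: filterS (P_bump lj) => x h Sx; rewrite h // /column mem_set // mulrC -dotr_row //; last by move=> y; exact: S_sep.
apply: dotr_le_bound => //.
- exact: row_L2 _ (fun y => @S_sep x y Sx).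
- exact: bump_ge0.
- move=> y; rewrite /row_of; case: (boolP (y \in U)) => [/[!inE] yU|_]; last by rewrite normr0.
  exact: hb.
Qed.

End Pairing.

Hypothesis growth : forall x r, 0 < r -> (mu (eball x r) <= (r `^ m)%:E)%E.
Variable c0 : 'rV[R]_d.
Hypothesis W_full : mu (~` hbox c0 1) = 0%E.

Section Level.
Variable n : nat.
Local Notation h := ((2 : R) ^- n).
Local Notation cell := (gcell c0 (n := n)).
Local Notation step := (gstep c0 (n := n)).

Lemma dotr_gstep f g : dotr mu (step f) (step g) = \sum_y f y * g y * fine (mu (cell y)).
Proof.
transitivity (dotr mu (step (fun y => f y * g y)) (cst 1)).
  by apply: eq_Rintegral => x _; rewrite gstep_mul mulr1.
rewrite /gstep dotr_suml; [|by move=> y; apply: rL2_scale; exact: indic_cell_L2|exact: rL2_cst].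
apply: eq_bigr => y _; rewrite dotr_scalel; [|exact: indic_cell_L2|exact: rL2_cst].
by rewrite dotr_indic1 //; exact: measurable_gcell.
Qed.

(** Dividing masses and pairings by [h ^ m] turns the growth of [mu] into a bound in mesh units that
    does not depend on [n]. *)
Let hm : R := h `^ m.
Let hm_gt0 : 0 < hm. Proof. by rewrite powR_gt0 // mesh_gt0. Qed.
Let w y : R := fine (mu (cell y)) / hm.
Let w_ge0 y : 0 <= w y. Proof. by rewrite divr_ge0 ?fine_ge0 // ltW. Qed.
Let B x y : R := dotr mu (P (\1_(cell y))) (\1_(cell x)) / hm.

Lemma nrmr_gstep f : nrmr mu (step f) = Num.sqrt hm * wnorm w f.
Proof.
rewrite /wnorm -sqrtrM ?(ltW hm_gt0) //; congr Num.sqrt.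
rewrite dotr_gstep mulr_sumr; apply: eq_bigr => y _; rewrite /w expr2.
by rewrite mulrA [hm * _]mulrCA divff ?gt_eqF // mulr1 mulrC.
Qed.

Lemma bil_gstep g f : bil B g f = dotr mu (P (step f)) (step g) / hm.
Proof.
rewrite /gstep P_dotr_sum; [|exact: indic_cell_L2|exact: gstep_L2].
rewrite mulr_suml /bil exchange_big /=; apply: eq_bigr => y _.
rewrite dotrC dotr_suml; [|by move=> x; apply: rL2_scale; exact: indic_cell_L2|by apply: P_L2; exact: indic_cell_L2].
rewrite mulr_sumr mulr_suml; apply: eq_bigr => x _.
rewrite dotr_scalel; [|exact: indic_cell_L2|by apply: P_L2; exact: indic_cell_L2].
by rewrite dotrC /B; ring.
Qed.

Let qbox s j (J : {ffun 'I_d -> nat}) : set 'rV[R]_d :=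
  hbox (\row_i (c0 ord0 i + h * ((2 ^ j * J i)%:R - s%:R))) (h * (2 ^ j)%:R).

(** A translated cube may stick out of the unit box, where step functions vanish; the identity holds
    only almost everywhere because [mu] lives inside the box. *)
Lemma gstep_gcube s j J :
  {ae mu, forall z, step (fun y => (gcube s j y == J)%:R) z = \1_(qbox s j J) z}.
Proof.
exists (~` hbox c0 1); split=> //; first by apply: measurableC; exact: measurable_hbox.
move=> z /= nz hz; apply: nz; have [y yz] := gcell_cover n hz.
by rewrite (gstep_cell _ yz) (gcell_gcube s j J yz) indicE.
Qed.

Lemma nrmr_qbox s j J : Num.sqrt (fine (mu (qbox s j J))) =
  Num.sqrt hm * Num.sqrt (\sum_(y | gcube s j y == J) w y).
Proof.
have mq : measurable (qbox s j J : set E) by exact: measurable_hbox.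
rewrite -nrmr_indic // -(ae_nrmr _ _ (gstep_gcube s j J)).
- rewrite nrmr_gstep /wnorm; congr (_ * Num.sqrt _); rewrite [RHS]big_mkcond.
  by apply: eq_bigr => y _; case: eqP => _; rewrite ?expr1n ?expr0n ?mulr1 ?mulr0.
- by case: (gstep_L2 mu c0 (fun y : {ffun 'I_d -> 'I_(2 ^ n)} => (gcube s j y == J)%:R)).
- exact: measurable_indic.
Qed.

Lemma testing_level s j J g :
  `|bil B g (fun y => (gcube s j y == J)%:R)| <=
    Num.sqrt C0 * Num.sqrt (\sum_(y | gcube s j y == J) w y) * wnorm w g.
Proof.
have mq : measurable (qbox s j J : set E) by exact: measurable_hbox.
have lq := rL2_indic mu mq.
rewrite bil_gstep (P_dotr_ae (gstep_L2 mu c0 _) lq (gstep_L2 mu c0 _) (gstep_gcube s j J)).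
rewrite normrM [`|hm^-1|]ger0_norm ?invr_ge0 ?(ltW hm_gt0) // ler_pdivrMr //.
apply: (le_trans (test_hbox _ _ (gstep_L2 mu c0 _))); first by rewrite mulr_gt0 ?mesh_gt0 // ltr0n expn_gt0.
rewrite sqrtrM // nrmr_qbox nrmr_gstep -{3}[hm]sqr_sqrtr ?(ltW hm_gt0) //.
by rewrite le_eqVlt; apply/orP; left; apply/eqP; ring.
Qed.

Lemma testing_adj_level s j J g :
  `|bil B (fun y => (gcube s j y == J)%:R) g| <=
    Num.sqrt C0 * Num.sqrt (\sum_(y | gcube s j y == J) w y) * wnorm w g.
Proof.
have mq : measurable (qbox s j J : set E) by exact: measurable_hbox.
have lq := rL2_indic mu mq.
rewrite bil_gstep dotrC (ae_dotr _ _ _ (gstep_gcube s j J)); last first.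
- by case: (P_L2 (gstep_L2 mu c0 g)).
- by case: lq.
- by case: (gstep_L2 mu c0 (fun y : {ffun 'I_d -> 'I_(2 ^ n)} => (gcube s j y == J)%:R)).
rewrite dotrC normrM [`|hm^-1|]ger0_norm ?invr_ge0 ?(ltW hm_gt0) // ler_pdivrMr //.
apply: (le_trans (adj_hbox _ _ (gstep_L2 mu c0 _))); first by rewrite mulr_gt0 ?mesh_gt0 // ltr0n expn_gt0.
rewrite sqrtrM // nrmr_qbox nrmr_gstep -{3}[hm]sqr_sqrtr ?(ltW hm_gt0) //.
by rewrite le_eqVlt; apply/orP; left; apply/eqP; ring.
Qed.

Lemma apriori_level f g : `|bil B g f| <= N * (wnorm w g * wnorm w f).
Proof.
rewrite bil_gstep normrM [`|hm^-1|]ger0_norm ?invr_ge0 ?(ltW hm_gt0) // ler_pdivrMr //.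
apply: (le_trans (P_dotr_bd (gstep_L2 mu c0 f) (gstep_L2 mu c0 g))).
rewrite !nrmr_gstep -{3}[hm]sqr_sqrtr ?(ltW hm_gt0) //.
by rewrite le_eqVlt; apply/orP; left; apply/eqP; ring.
Qed.

Let kap : R := Num.sqrt d%:R + 1.
Let kap_ge1 : 1 <= kap. Proof. by rewrite lerDr. Qed.

Lemma powR_pow2 (b : nat) (p : R) : (2 ^+ b) `^ p = (2 `^ p) ^+ b.
Proof. by rewrite -powR_mulrn ?ler0n // -powRrM mulrC powRrM powR_mulrn // powR_ge0. Qed.

Lemma growth_level x b :
  \sum_(y | (gdist x y < 2 ^ b.+1)%N) w y <= (8 * kap) `^ m * (2 `^ m) ^+ b.
Proof.
have h0 := @mesh_gt0 R n; have k0 : 0 < kap by apply: lt_le_trans kap_ge1.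
(* Cells at grid distance below [2 ^ b.+1] lie within [4 * kap * h * 2 ^ b] of the corner; the
   factor 8 leaves room for the strict inequality of the open ball. *)
pose r := 8 * kap * h * 2 ^+ b.
have r0 : 0 < r by rewrite !mulr_gt0 ?exprn_gt0.
have mb : measurable (eball (gpt c0 x) r : set E) by apply: open_measurableRd; exact: open_eball.
pose f y : R := (gdist x y < 2 ^ b.+1)%N%:R.
have le_nrm : nrmr mu (step f) <= nrmr mu (\1_(eball (gpt c0 x) r)).
  apply: ler_nrmr; [exact: gstep_L2|exact: rL2_indic|move=> z].
  have [hz|hz] := pselect (hbox c0 1 z); last by rewrite gstep_out // normr0.
  have [y yz] := gcell_cover n hz; rewrite (gstep_cell _ yz) /f.
  case: (boolP (gdist x y < _)%N) => [xy|_]; last by rewrite normr0.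
  rewrite indicE mem_set // /eball /=; rewrite gdistC in xy.
  apply: (le_lt_trans (obox_gpt_le xy (gcell_obox yz))).
  rewrite /r natrX exprS.
  have p : 0 < kap * h * 2 ^+ b by rewrite !mulr_gt0 ?exprn_gt0.
  rewrite -/kap; move: p; move: (2 ^+ b) (kap) (h) => X Y Z; nra.
have sum_le : \sum_(y | (gdist x y < 2 ^ b.+1)%N) fine (mu (cell y)) <= r `^ m.
  have -> : \sum_(y | (gdist x y < 2 ^ b.+1)%N) fine (mu (cell y)) = nrmr mu (step f) ^+ 2.
    rewrite nrmr_sqr dotr_gstep big_mkcond; apply: eq_bigr => y _; rewrite /f.
    by case: ifP; rewrite ?mulr1 ?mul1r ?mul0r.
  apply: (@le_trans _ _ (nrmr mu (\1_(eball (gpt c0 x) r)) ^+ 2)).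
    by rewrite lerXn2r ?nnegrE ?nrmr_ge0.
  rewrite nrmr_sqr dotr_indic // -lee_fin fineK; first exact: growth.
  exact: fin_num_measure.
rewrite -mulr_suml ler_pdivrMr //; apply: (le_trans sum_le).
rewrite /r /hm !powRM ?mulr_ge0 ?exprn_ge0 ?(ltW h0) ?(ltW k0) // powR_pow2.
by rewrite le_eqVlt; apply/orP; left; apply/eqP; ring.
Qed.

Let q : R := 2 `^ (- eps).
Let M : R := 2 `^ m.
Let C3 : R := (2 * kap) `^ eps * 2 `^ (m + eps).
Let bnd (j D : nat) : R := (kap * (2 * h * (2 ^ j)%:R)) `^ eps / (h * D%:R / 2) `^ (m + eps).

(** The mesh cancels, as [h ^ m * h ^ eps = h ^ (m + eps)]. Rounding [D] down to a power of 2 yields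
    the dyadic form of the kernel decay used on the grid. *)
Lemma bnd_le j D : (0 < D)%N -> hm * bnd j D <= q ^- j * (C3 * (q / M) ^+ trunc_log 2 D).
Proof.
move=> D0; have h0 := @mesh_gt0 R n; have k0 : 0 < kap by apply: lt_le_trans kap_ge1.
set t := trunc_log 2 D.
have tD : (2 : R) ^+ t <= D%:R by rewrite -natrX ler_nat; exact: trunc_logP.
have -> : q ^- j = (2 `^ eps) ^+ j by rewrite /q powRN exprVn invrK.
have -> : (q / M) ^+ t = ((2 `^ (m + eps)) ^+ t)^-1.
  by rewrite -exprVn; congr (_ ^+ t); rewrite /q /M powRN powRD ?pnatr_eq0 ?implybT // invfM mulrC.
rewrite /bnd mulrA ler_pdivrMr ?powR_gt0 ?mulr_gt0 ?ltr0n //.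
have -> : kap * (2 * h * (2 ^ j)%:R) = (2 * kap) * h * 2 ^+ j by rewrite natrX; ring.
have le1 : (h * 2 ^+ t / 2) `^ (m + eps) <= (h * D%:R / 2) `^ (m + eps).
  apply: ge0_ler_powR; rewrite ?nnegrE ?mulr_ge0 ?exprn_ge0 ?(ltW h0) //; first by rewrite addr_ge0 ?(ltW m_gt0) ?(ltW eps_gt0).
  by rewrite ler_pM2r // ler_pM2l.
have p2 : 0 < (2 `^ (m + eps) : R) by rewrite powR_gt0.
apply: (@le_trans _ _ ((2 `^ eps) ^+ j * (C3 * ((2 `^ (m + eps)) ^+ t)^-1) * (h * 2 ^+ t / 2) `^ (m + eps))); last first.
  by rewrite ler_wpM2l // !mulr_ge0 ?exprn_ge0 ?powR_ge0 ?invr_ge0 // exprn_ge0 // powR_ge0.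
rewrite !powRM ?mulr_ge0 ?exprn_ge0 ?(ltW h0) ?(ltW k0) ?invr_ge0 //.
rewrite !powR_pow2 /hm /C3 -[2^-1]powR_inv1 // -powRrM mulN1r powRN.
rewrite [h `^ (m + eps)]powRD ?(gt_eqF h0) ?implybT //.
rewrite powRM ?(ltW k0) //.
set X := 2 `^ (m + eps); rewrite le_eqVlt; apply/orP; left; apply/eqP.
have X0 : X != 0 by rewrite gt_eqF.
by field; rewrite X0 expf_neq0.
Qed.

Variable a0 : nat.
Hypothesis a0_ge3 : (3 <= a0)%N.
(** Points at grid distance at least [2 ^ (j + a0)] then satisfy the condition with factor [A] in
    the smoothness of the kernel: the displacement is at most [2 * kap * h * 2 ^ j] and the
    separation at least half the grid distance. *)
Hypothesis a0_ge : 4 * `|A| * kap <= 2 ^+ a0.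

Section Separated.
Variables (j : nat) (x x0 y : {ffun 'I_d -> 'I_(2 ^ n)}).
Hypotheses (near0 : (gdist x x0 < 2 ^ j)%N) (far : (2 ^ (j + a0) <= gdist x y)%N).

Lemma sep_xy x' y' : obox (gpt c0 x) h h x' -> obox (gpt c0 y) h h y' ->
  h * (gdist x y)%:R / 2 <= enorm (x' - y').
Proof.
move=> hx hy; have h0 := @mesh_gt0 R n; have [D0 D8 _] := gdist_far a0_ge3 near0 far.
apply: le_trans (obox_sep hx hy D0).
have : 8 <= (gdist x y)%:R :> R by rewrite (ler_nat _ 8).
nra.
Qed.

Lemma sep_h x' y' : obox (gpt c0 x) h h x' -> obox (gpt c0 y) h h y' -> h <= enorm (x' - y').
Proof.
move=> hx hy; apply: le_trans (sep_xy hx hy); have h0 := @mesh_gt0 R n.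
have [_ D8 _] := gdist_far a0_ge3 near0 far.
have : 8 <= (gdist x y)%:R :> R by rewrite (ler_nat _ 8).
nra.
Qed.

Lemma sep_x0 y' : obox (gpt c0 y) h h y' -> h <= enorm (gpt c0 x0 - y').
Proof.
move=> hy; have h0 := @mesh_gt0 R n; have [_ _ D4] := gdist_far a0_ge3 near0 far.
apply: le_trans (obox_sep (gpt_obox c0 x0) hy (leq_trans _ D4)) => //.
have : 4 <= (gdist x0 y)%:R :> R by rewrite (ler_nat _ 4).
nra.
Qed.

Lemma near_x0 x' : obox (gpt c0 x) h h x' -> enorm (x' - gpt c0 x0) <= kap * (2 * h * (2 ^ j)%:R).
Proof. by move=> hx; exact: obox_gpt_le near0 hx. Qed.

Lemma A_near x' y' : obox (gpt c0 x) h h x' -> obox (gpt c0 y) h h y' ->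
  A * enorm (x' - gpt c0 x0) <= enorm (x' - y').
Proof.
move=> hx hy; apply: le_trans (sep_xy hx hy); have h0 := @mesh_gt0 R n.
apply: (@le_trans _ _ (`|A| * (kap * (2 * h * (2 ^ j)%:R)))).
  apply: le_trans (_ : `|A| * enorm (x' - gpt c0 x0) <= _).
    by rewrite ler_wpM2r ?enorm_ge0 // ler_norm.
  by rewrite ler_wpM2l // near_x0.
have e : 4 * `|A| * kap * 2 ^+ j <= (gdist x y)%:R.
  apply: (@le_trans _ _ (2 ^+ a0 * 2 ^+ j)); first by rewrite ler_pM2r ?exprn_gt0.
  by rewrite -exprD -natrX ler_nat addnC.
have := ler_wpM2l (ltW h0) e; rewrite natrX; lra.
Qed.

Lemma bnd_quot x' y' : obox (gpt c0 x) h h x' -> obox (gpt c0 y) h h y' ->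
  enorm (x' - gpt c0 x0) `^ eps / enorm (x' - y') `^ (m + eps) <= bnd j (gdist x y).
Proof.
move=> hx hy; have h0 := @mesh_gt0 R n; have D0 : (0 < gdist x y)%N.
  by apply: leq_trans far; rewrite expn_gt0.
have p0 : 0 < h * (gdist x y)%:R / 2 by rewrite !mulr_gt0 ?ltr0n.
have me : 0 <= m + eps by rewrite addr_ge0 ?(ltW m_gt0) ?(ltW eps_gt0).
apply: ler_pM; rewrite ?invr_ge0 ?powR_ge0 //.
  apply: ge0_ler_powR; rewrite ?nnegrE ?enorm_ge0 ?(ltW eps_gt0) //; last exact: near_x0.
  by apply: le_trans (near_x0 hx); exact: enorm_ge0.
rewrite lef_pV2 ?posrE ?powR_gt0 //; last by apply: lt_le_trans (sep_xy hx hy).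
by apply: ge0_ler_powR; rewrite ?nnegrE ?enorm_ge0 ?(ltW p0) //; exact: sep_xy.
Qed.

Lemma neq_of_sep (u v : 'rV[R]_d) : h <= enorm (u - v) -> u != v.
Proof. by apply: contraTneq => ->; rewrite subrr enorm0 -ltNge mesh_gt0. Qed.

Let ker_scale (S Q X Y b : R) : `|X - S * Y| <= b * (S * Q) ->
  `|X / hm - S / hm * Y| <= S / hm * (Q / hm) * (hm * b).
Proof.
move=> H; have -> : X / hm - S / hm * Y = (X - S * Y) / hm by ring.
rewrite normrM [`|hm^-1|]ger0_norm ?invr_ge0 ?(ltW hm_gt0) //.
apply: (le_trans (ler_wpM2r _ H)); first by rewrite invr_ge0 (ltW hm_gt0).
by rewrite le_eqVlt; apply/orP; left; apply/eqP; field; rewrite gt_eqF.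
Qed.

Lemma bnd_ge0 : 0 <= bnd j (gdist x y).
Proof. by rewrite /bnd mulr_ge0 ?invr_ge0 ?powR_ge0. Qed.

Lemma smooth_l_level :
  `|B x y - w x * dotr mu (row_of (gpt c0 y) h h (gpt c0 x0) 0) (\1_(cell y))| <=
  w x * w y * (q ^- j * gth q M C3 x y).
Proof.
have h0 := @mesh_gt0 R n; have D0 : (0 < gdist x y)%N.
  by apply: leq_trans far; rewrite expn_gt0.
apply: (@le_trans _ _ (w x * w y * (hm * bnd j (gdist x y)))); last first.
  by apply: ler_wpM2l; [exact: mulr_ge0|exact: bnd_le].
apply: ker_scale.
apply: (pairing_l h0 h0 (measurable_gcell c0 x)) => //.
- by move=> x' y' /gcell_obox hx hy; exact: sep_h.
- by move=> y' hy; exact: sep_x0.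
- exact: bnd_ge0.
- move=> x' y' /gcell_obox hx hy; apply: le_trans (bnd_quot hx hy).
  by apply: k_l; [exact: neq_of_sep (sep_h hx hy)|exact: neq_of_sep (sep_x0 hy)|exact: A_near].
Qed.

Lemma smooth_r_level :
  `|B y x - w x * dotr mu (column (cell y) (gpt c0 x0)) (\1_(cell y))| <=
  w x * w y * (q ^- j * gth q M C3 x y).
Proof.
have h0 := @mesh_gt0 R n; have D0 : (0 < gdist x y)%N.
  by apply: leq_trans far; rewrite expn_gt0.
apply: (@le_trans _ _ (w x * w y * (hm * bnd j (gdist x y)))); last first.
  by apply: ler_wpM2l; [exact: mulr_ge0|exact: bnd_le].
apply: ker_scale.
rewrite [X in _ <= _ * X]mulrC.
apply: (pairing_r h0 h0 (measurable_gcell c0 y)) => //.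
- by move=> y' x' /gcell_obox hy hx; rewrite enormB; exact: sep_h.
- by move=> y' /gcell_obox hy; rewrite enormB; exact: sep_x0.
- exact: bnd_ge0.
- move=> y' x' /gcell_obox hy hx; apply: le_trans (bnd_quot hx hy).
  rewrite [enorm (x' - y')]enormB; apply: k_r; rewrite ?[enorm (y' - x')]enormB.
  + by rewrite eq_sym; exact: neq_of_sep (sep_h hx hy).
  + by rewrite eq_sym; exact: neq_of_sep (sep_x0 hy).
  + exact: A_near.
Qed.

End Separated.

Lemma level_bound f g :
  `|dotr mu (P (step f)) (step g)| <=
  Cgrid d m eps C0 a0 * (nrmr mu (step f) * nrmr mu (step g)).
Proof.
have q01 : 0 < q < 1.
  rewrite powR_gt0 //= /q /powR pnatr_eq0 /= expR_lt1 nmulr_rlt0 ?oppr_lt0 //.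
  by rewrite ln_gt0 // ltr1n.
have M0 : 0 < M by rewrite powR_gt0.
have C30 : 0 <= C3 by rewrite mulr_ge0 ?powR_ge0.
set C := Cgrid _ _ _ _ _.
have key i : `|bil B g f| <= (C + N / 2 ^+ i) * (wnorm w g * wnorm w f).
  apply: (finite_T1 (M := M) q01 M0 (sqrtr_ge0 C0) (powR_ge0 _ _) C30) => //.
  - by move=> x b _; exact: growth_level.
  - by move=> j x x0 y n1 n2; exact: smooth_l_level n1 n2.
  - by move=> j x x0 y n1 n2; exact: smooth_r_level n1 n2.
  - by move=> s j J g' _; exact: testing_level.
  - by move=> s j J g' _; exact: testing_adj_level.
  - by move=> f' g'; exact: apriori_level.
(* The number of improvement rounds tends to infinity with [n] fixed, which is where the a priori
   norm [N] disappears. *)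
have lim : `|bil B g f| <= C * (wnorm w g * wnorm w f).
  have c : (C + N / 2 ^+ i) * (wnorm w g * wnorm w f) @[i --> \oo] --> (C + N * 0) * (wnorm w g * wnorm w f).
    apply: cvgM; last exact: cvg_cst.
    apply: cvgD; first exact: cvg_cst.
    apply: cvgM; first exact: cvg_cst.
    under eq_cvg do rewrite -exprVn.
    by apply: cvg_expr; rewrite ger0_norm ?invr_ge0 // invf_lt1 // ltr1n.
  rewrite mulr0 addr0 in c; rewrite -(cvg_lim _ c) //.
  by apply: limr_ge; [apply/cvg_ex; eexists; exact: c|apply: nearW].
rewrite !nrmr_gstep; move: lim; rewrite bil_gstep normrM [`|hm^-1|]ger0_norm ?invr_ge0 ?(ltW hm_gt0) //.
rewrite ler_pdivrMr // => /le_trans; apply.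
rewrite -{1}[hm]sqr_sqrtr ?(ltW hm_gt0) //.
by rewrite le_eqVlt; apply/orP; left; apply/eqP; ring.
Qed.

End Level.

Lemma P_dotr_le a0 u v : (3 <= a0)%N -> 4 * `|A| * (Num.sqrt d%:R + 1) <= 2 ^+ a0 ->
  rL2 mu u -> rL2 mu v ->
  `|dotr mu (P u) v| <= `|Cgrid d m eps C0 a0| * (nrmr mu u * nrmr mu v).
Proof.
move=> a03 a0A lu lv; set C := `|Cgrid d m eps C0 a0|.
have C_ge0 : 0 <= C by rewrite normr_ge0.
set X := nrmr mu u; set Y := nrmr mu v.
have X0 : 0 <= X by exact: nrmr_ge0.
have Y0 : 0 <= Y by exact: nrmr_ge0.
(* [K] collects the approximation errors. It may contain [N], because it is multiplied by the
   accuracy [e], which tends to 0. *)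
pose K := N * Y + N * (X + 1) + C * (X + Y + 1).
have K0 : 0 <= K by rewrite /K !addr_ge0 ?mulr_ge0 ?addr_ge0.
have step e : 0 < e -> e <= 1 -> `|dotr mu (P u) v| <= C * (X * Y) + K * e.
  move=> e0 e1; have gu := gridded_L2 W_full lu e0; have gv := gridded_L2 W_full lv e0.
  have guv : \forall n \near \oo, (exists f, nrmr mu (fun x => u x - gstep c0 (n := n) f x) <= e) /\
      (exists g, nrmr mu (fun x => v x - gstep c0 (n := n) g x) <= e).
    by apply: filterS2 gu gv => n h1 h2; split.
  have [n [[f hf] [g hg]]] := filter_ex guv.
  have lf := gstep_L2 mu c0 f; have lg := gstep_L2 mu c0 g.
  have ldu := rL2_sub lu lf; have ldv := rL2_sub lv lg.
  have nf : nrmr mu (gstep c0 f) <= X + e.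
    have -> : gstep c0 f = (fun x => u x - (u x - gstep c0 f x)).
      by apply/funext => x; ring.
    by apply: (le_trans (nrmr_sub lu ldu)); rewrite lerD2l.
  have ng : nrmr mu (gstep c0 g) <= Y + e.
    have -> : gstep c0 g = (fun x => v x - (v x - gstep c0 g x)).
      by apply/funext => x; ring.
    by apply: (le_trans (nrmr_sub lv ldv)); rewrite lerD2l.
  have -> : dotr mu (P u) v = dotr mu (P (fun x => u x - gstep c0 f x)) v +
      dotr mu (P (gstep c0 f)) (fun x => v x - gstep c0 g x) +
      dotr mu (P (gstep c0 f)) (gstep c0 g).
    rewrite P_dotr_sub // [dotr mu _ (fun x => v x - _)]dotrC dotr_subl //; last exact: P_L2.
    by rewrite [dotr mu v _]dotrC [dotr mu (gstep c0 g) _]dotrC; ring.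
  have b1 := P_dotr_bd ldu lv; have b2 := P_dotr_bd lf ldv.
  have b3 := level_bound a03 a0A f g.
  have Xe : 0 <= X + e by rewrite addr_ge0 // ltW.
  have c1 : N * (nrmr mu (fun x => u x - gstep c0 f x) * Y) <= N * (e * Y).
    by apply: ler_wpM2l => //; apply: ler_wpM2r.
  have c2 : N * (nrmr mu (gstep c0 f) * nrmr mu (fun x => v x - gstep c0 g x)) <= N * ((X + 1) * e).
    apply: ler_wpM2l => //; apply: ler_pM; rewrite ?nrmr_ge0 //.
    by apply: le_trans nf _; rewrite lerD2l.
  have c3 : Cgrid d m eps C0 a0 * (nrmr mu (gstep c0 f) * nrmr mu (gstep c0 g)) <= C * ((X + e) * (Y + e)).
    apply: (@le_trans _ _ (C * (nrmr mu (gstep c0 f) * nrmr mu (gstep c0 g)))).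
      by apply: ler_wpM2r; [rewrite mulr_ge0 ?nrmr_ge0|exact: ler_norm].
    by apply: ler_wpM2l => //; apply: ler_pM; rewrite ?nrmr_ge0.
  have c4 : C * ((X + e) * (Y + e)) <= C * (X * Y) + C * (X + Y + 1) * e.
    by rewrite -mulrA -mulrDr; apply: ler_wpM2l => //; nra.
  apply: (le_trans (ler_normD _ _)).
  apply: (@le_trans _ _ (N * (e * Y) + N * ((X + 1) * e) + C * ((X + e) * (Y + e)))).
    apply: lerD; last exact: le_trans b3 c3.
    apply: (le_trans (ler_normD _ _)); apply: lerD; first exact: le_trans b1 c1.
    exact: le_trans b2 c2.
  move: c4; rewrite /K; move: (C * ((X + e) * (Y + e))) (C * (X + Y + 1)) => s t; lra.
apply/ler_addgt0Pr => e e0.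
have K1 : 0 < 1 + K by rewrite ltr_pwDl.
have p : 0 < e / (1 + K) by rewrite divr_gt0.
apply: (le_trans (step (Num.min 1 (e / (1 + K))) _ _)); [by rewrite lt_min ltr01|by rewrite ge_min lexx|].
rewrite lerD2l; apply: (@le_trans _ _ (K * (e / (1 + K)))).
  by apply: ler_wpM2l => //; rewrite ge_min lexx orbT.
rewrite mulrA ler_pdivrMr //; nra.
Qed.

(** The bilinear bound is applied with [P u] itself as the second function, and one factor of its
    norm cancels. *)
Lemma P_norm_le a0 u : (3 <= a0)%N -> 4 * `|A| * (Num.sqrt d%:R + 1) <= 2 ^+ a0 ->
  rL2 mu u -> nrmr mu (P u) <= `|Cgrid d m eps C0 a0| * nrmr mu u.
Proof.
move=> a03 a0A lu; have lP := P_L2 lu.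
have := P_dotr_le a03 a0A lu lP; rewrite -nrmr_sqr (ger0_norm (sqr_ge0 _)) expr2 mulrA.
have := nrmr_ge0 mu (P u); rewrite le_eqVlt => /orP[/eqP <-|p]; last by rewrite ler_pM2r.
by rewrite mulr_ge0 ?nrmr_ge0.
Qed.

End RealOperator.

(** * Complex-valued functions *)

Section ComplexNorm.
Context {d0 : measure_display} {T : measurableType d0} {R : realType}.
Variable mu : {finite_measure set T -> \bar R}.
Local Notation Re := complex.Re.
Local Notation Im := complex.Im.

Lemma nrmr0 : nrmr mu (fun=> 0) = 0.
Proof.
by rewrite /nrmr /dotr mul0r Rintegral_cst // mul0r sqrtr0.
Qed.

Lemma Lnorm2_nrmr (g : T -> R) : rL2 mu g -> ('N[mu]_2%:E [EFin \o g])%E = (nrmr mu g)%:E.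
Proof.
move=> lg; rewrite unlock.
have -> : (\int[mu]_x (`|(EFin \o g) x| `^ 2))%E = (dotr mu g g)%:E.
  rewrite /dotr /Rintegral fineK; last exact: (integrable_fin_num measurableT (rL2_mul lg lg)).
  apply: eq_integral => x _; rewrite /= powR_mulrn // real_normK ?num_real //; exact: expr2.
by rewrite poweR12_sqrt ?lee_fin ?dotr_ge0.
Qed.

Lemma Lfun2_rL2 (g : T -> R) : g \in Lfun mu 2%:E <-> rL2 mu g.
Proof.
split=> [lg|lg].
  split; last exact: Lfun2_integrable_sqr.
  by move: lg; rewrite inE => /andP[]; rewrite inE.
rewrite inE; apply/andP; split; rewrite inE /=; first by case: lg.
by rewrite /finite_norm Lnorm2_nrmr // ltry.
Qed.

Lemma in_L2_rL2 (f : T -> R[i]) :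
  in_L2 mu f <-> rL2 mu (fun x => Re (f x)) /\ rL2 mu (fun x => Im (f x)).
Proof. by rewrite /in_L2 !Lfun2_rL2. Qed.

Lemma normc_sqr (z : R[i]) : Normc.normc z ^+ 2 = Re z ^+ 2 + Im z ^+ 2.
Proof. by case: z => a b /=; rewrite sqr_sqrtr // addr_ge0 ?sqr_ge0. Qed.

Lemma L2normE (f : T -> R[i]) : in_L2 mu f ->
  L2norm mu f = (Num.sqrt (nrmr mu (fun x => Re (f x)) ^+ 2 + nrmr mu (fun x => Im (f x)) ^+ 2))%:E.
Proof.
move=> /in_L2_rL2[lr li]; have [mr ir] := lr; have [mi ii] := li.
have ms : measurable_fun [set: T] (fun x => Re (f x) ^+ 2 + Im (f x) ^+ 2).
  by apply: measurable_funD; exact: measurable_funX.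
have ln : rL2 mu (@Normc.normc R \o f).
  split.
    have -> : @Normc.normc R \o f = Num.sqrt \o (fun x => Re (f x) ^+ 2 + Im (f x) ^+ 2).
      by apply/funext => x /=; case: (f x).
    apply: measurableT_comp => //; apply: continuous_measurable_fun; exact: sqrt_continuous.
  have -> : EFin \o (fun x => (@Normc.normc R \o f) x ^+ 2) =
     (fun x => (Re (f x) ^+ 2)%:E + (Im (f x) ^+ 2)%:E)%E.
    by apply/funext => x /=; rewrite normc_sqr EFinD.
  exact: integrableD.
rewrite /L2norm Lnorm2_nrmr //; congr (Num.sqrt _)%:E.
rewrite !nrmr_sqr /dotr -(RintegralD measurableT (rL2_mul lr lr) (rL2_mul li li)).
by apply: eq_Rintegral => x _ /=; rewrite -expr2 normc_sqr !expr2.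
Qed.

Lemma L2norm_real (u : T -> R) : rL2 mu u -> L2norm mu (fun x => (u x)%:C%C) = (nrmr mu u)%:E.
Proof.
move=> lu; rewrite L2normE; last by apply/in_L2_rL2; split => //=; exact: rL2_cst.
have -> : nrmr mu (fun x => Im (u x)%:C%C) = 0.
  exact: nrmr0.
by rewrite expr0n addr0 sqrtr_sqr ger0_norm ?nrmr_ge0.
Qed.

Definition part (b : bool) (z : R[i]) : R := if b then Re z else Im z.

Lemma part_lin b (a : R) z1 z2 : part b (a%:C%C * z1 + z2) = a * part b z1 + part b z2.
Proof. by case: b; case: z1 => x1 y1; case: z2 => x2 y2 /=; ring. Qed.

Lemma part_sub b z1 z2 : part b (z1 - z2) = part b z1 - part b z2.
Proof. by case: b; case: z1 => x1 y1; case: z2 => x2 y2. Qed.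

Lemma part_mulr b (a : R) z : part b (z * a%:C%C) = part b z * a.
Proof. by case: b; case: z => x y /=; ring. Qed.

Lemma part_mulr_conj b (a : R) z : part b (z * (a%:C^*)%C) = part b z * a.
Proof. by case: b; case: z => x y /=; ring. Qed.

Lemma part_conj b (a : R) z :
  part b (a%:C%C * (z^*)%C) = (-1) ^+ (~~ b) * (a * part b z).
Proof. by case: b; case: z => x y /=; ring. Qed.

Lemma part_le b z : `|part b z| <= Normc.normc z.
Proof.
by case: b; case: z => x y /=; rewrite -sqrtr_sqr; apply: ler_wsqrtr; rewrite ?lerDl ?lerDr sqr_ge0.
Qed.

Lemma part_Cintegral b (f : T -> R[i]) : part b (Cintegral mu f) = \int[mu]_x part b (f x).
Proof. by case: b. Qed.

Lemma part_rL2 b (f : T -> R[i]) : in_L2 mu f -> rL2 mu (fun x => part b (f x)).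
Proof. by move=> /in_L2_rL2[]; case: b. Qed.

Lemma nrmr_part b (f : T -> R[i]) : in_L2 mu f -> ((nrmr mu (fun x => part b (f x)))%:E <= L2norm mu f)%E.
Proof.
move=> lf; rewrite L2normE // lee_fin -[leLHS]ger0_norm ?nrmr_ge0 // -sqrtr_sqr.
by apply: ler_wsqrtr; case: b; rewrite ?lerDl ?lerDr sqr_ge0.
Qed.

Lemma nrmr_part_test b (f : T -> R[i]) (C0 C : R) (Q : set T) : in_L2 mu f -> measurable Q -> C0 <= C ->
  (L2norm mu f ^+ 2 <= C0%:E * mu Q)%E ->
  nrmr mu (fun x => part b (f x)) <= Num.sqrt (C * fine (mu Q)).
Proof.
move=> lf mQ hC; have := nrmr_part b lf; rewrite L2normE //; set t := Num.sqrt _; rewrite lee_fin => h1.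
rewrite -(fineK (fin_num_measure mu Q mQ)) -EFin_expe -EFinM lee_fin => h2.
apply: (le_trans h1); rewrite -[t]ger0_norm ?sqrtr_ge0 // -sqrtr_sqr; apply: ler_wsqrtr.
by apply: (le_trans h2); apply: ler_wpM2r => //; exact: fine_ge0.
Qed.

Lemma L2norm_le (f : T -> R[i]) : in_L2 mu f ->
  (L2norm mu f <= (nrmr mu (fun x => Re (f x)) + nrmr mu (fun x => Im (f x)))%:E)%E.
Proof.
move=> lf; rewrite L2normE // lee_fin; set a := nrmr _ _; set b := nrmr _ _.
have a0 : 0 <= a by exact: nrmr_ge0.
have b0 : 0 <= b by exact: nrmr_ge0.
rewrite -[leRHS]ger0_norm ?addr_ge0 // -sqrtr_sqr; apply: ler_wsqrtr; nra.
Qed.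

End ComplexNorm.

(** * Real and imaginary parts of a complex operator on real functions *)

Section RealPart.
Context {R : realType} {d : nat}.
Variable mu : {finite_measure set (borelRd R d) -> \bar R}.
Variables (b : bool) (U : ('rV[R]_d -> R[i]) -> 'rV[R]_d -> R[i]).
Hypothesis U_bounded : L2_bounded_operator mu U.
Local Notation E := (borelRd R d).

Definition real_part (u : 'rV[R]_d -> R) (x : 'rV[R]_d) : R := part b (U (fun z => (u z)%:C%C) x).

Lemma in_L2_real (u : E -> R) : rL2 mu u -> in_L2 mu (fun z : E => (u z)%:C%C).
Proof. by move=> lu; apply/in_L2_rL2; split => //=; exact: rL2_cst. Qed.

Lemma real_part_L2 (u : E -> R) : rL2 mu u -> rL2 mu (real_part u).
Proof. by move=> /in_L2_real lu; apply: part_rL2; apply: (L2op_stable U_bounded). Qed.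

Lemma real_part_ae (u v : E -> R) : rL2 mu u -> rL2 mu v ->
  {ae mu, forall x, u x = v x} -> {ae mu, forall x, real_part u x = real_part v x}.
Proof.
move=> /in_L2_real lu /in_L2_real lv uv.
have uvC : {ae mu, forall x : E, (u x)%:C%C = (v x)%:C%C} by apply: filterS uv => x ->.
have ae := L2op_ae U_bounded lu lv uvC.
by apply: (@filterS E (almost_everywhere mu) _ _ _ _ ae) => x; rewrite /real_part => ->.
Qed.

Lemma real_part_lin a (u v : E -> R) : rL2 mu u -> rL2 mu v ->
  {ae mu, forall x, real_part (fun z => a * u z + v z) x = a * real_part u x + real_part v x}.
Proof.
move=> /in_L2_real lu /in_L2_real lv.
have ae := L2op_linear U_bounded a%:C%C lu lv.
apply: (@filterS E (almost_everywhere mu) _ _ _ _ ae) => x; rewrite /real_part -part_lin => <-.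
by congr (part b (U _ x)); apply/funext => z; rewrite rmorphD rmorphM.
Qed.

Lemma real_part_bounded : exists2 N, 0 <= N &
  forall u : E -> R, rL2 mu u -> nrmr mu (real_part u) <= N * nrmr mu u.
Proof.
have Ub := L2op_bounded U_bounded.
have l0 := rL2_cst mu (0 : R); have c0 := in_L2_real l0.
have n0 := nrmr0 mu.
have le_op (u : E -> R) : rL2 mu u -> nrmr mu u <= 1 -> ((nrmr mu (real_part u))%:E <= L2opnorm mu U)%E.
  move=> lu u1; have cu := in_L2_real lu.
  apply: (le_trans (nrmr_part b (L2op_stable U_bounded cu))); apply: ereal_sup_ubound.
  by exists (fun z => (u z)%:C%C) => //; split=> //; rewrite L2norm_real // lee_fin.
have op0 : (0 <= L2opnorm mu U)%E.
  by apply: le_trans (le_op _ l0 _); rewrite ?lee_fin ?nrmr_ge0 // n0.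
have opf : L2opnorm mu U \is a fin_num by rewrite ge0_fin_numE.
pose N := fine (L2opnorm mu U); have N0 : 0 <= N by exact: fine_ge0.
exists N => // u lu.
have bnd s : 0 <= s -> s * nrmr mu u <= 1 -> s * nrmr mu (real_part u) <= N.
  move=> s0 su; have ls := rL2_scale s lu; have lr := real_part_L2 lu.
  have lz := real_part_L2 l0.
  have z0 : {ae mu, forall x, real_part (fun=> 0) x = 0}.
    have ae := real_part_lin 1 l0 l0.
    apply: (@filterS E (almost_everywhere mu) _ _ _ _ ae) => x.
    have -> : (fun z : 'rV[R]_d => 1 * 0 + 0) = (fun=> 0 : R) by apply/funext => z; rewrite mulr0 addr0.
    by lra.
  have sc : {ae mu, forall x, real_part (fun z => s * u z) x = s * real_part u x}.
    have ae := real_part_lin s lu l0.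
    apply: (@filterS2 E (almost_everywhere mu) _ _ _ _ _ z0 ae) => x.
    have -> : (fun z : 'rV[R]_d => s * u z + 0) = (fun z => s * u z) by apply/funext => z; rewrite addr0.
    by move=> ->; rewrite addr0.
  have -> : s * nrmr mu (real_part u) = nrmr mu (real_part (fun z => s * u z)).
    rewrite (ae_nrmr _ _ sc); [by rewrite nrmr_scale // ger0_norm|by case: (real_part_L2 ls)|].
    by case: (rL2_scale s lr).
  have := le_op _ ls; rewrite nrmr_scale // ger0_norm // => /(_ su).
  by rewrite -(fineK opf) lee_fin.
(* If [u] has norm 0, all its multiples lie in the unit ball; the factor
   [(N + 1) / nrmr mu (real_part u)] would contradict the bound [N] unless the image also has norm
   0. *)
have := nrmr_ge0 mu u; rewrite le_eqVlt => /orP[/eqP u0|u0].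
  rewrite -u0 mulr0 leNgt; apply/negP => p.
  have := bnd ((N + 1) / nrmr mu (real_part u)).
  rewrite -u0 mulr0 ler01 divfK ?gt_eqF // => /(_ _ isT).
  suff h : 0 <= (N + 1) / nrmr mu (real_part u) by move=> /(_ h); lra.
  by rewrite divr_ge0 ?addr_ge0 // ltW.
have := bnd (nrmr mu u)^-1; rewrite invr_ge0 (ltW u0) mulVf ?gt_eqF // lexx => /(_ isT isT).
by rewrite mulrC ler_pdivrMr.
Qed.

Lemma real_part_test (C0 C : R) (Q : set E) : measurable Q -> C0 <= C ->
  (L2norm mu (U (Cindic Q)) ^+ 2 <= C0%:E * mu Q)%E ->
  nrmr mu (real_part (\1_Q)) <= Num.sqrt (C * fine (mu Q)).
Proof.
move=> mQ; apply: nrmr_part_test => //.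
by apply: (L2op_stable U_bounded); apply: in_L2_real; exact: rL2_indic.
Qed.

(** The indicator and [u] are real, so taking a part commutes with the pairing; conjugation on the
    adjoint side only changes the sign of imaginary parts. *)
Lemma real_part_adjoint (V : ('rV[R]_d -> R[i]) -> 'rV[R]_d -> R[i]) (C0 C : R) (u : E -> R) (Q : set E) :
  L2_adjoint mu U V -> rL2 mu u -> measurable Q -> C0 <= C ->
  (L2norm mu (V (Cindic Q)) ^+ 2 <= C0%:E * mu Q)%E ->
  `|dotr mu (real_part u) (\1_Q)| <= nrmr mu u * Num.sqrt (C * fine (mu Q)).
Proof.
move=> [V_L2 UV] lu mQ hC vQ; have lQ : in_L2 mu (Cindic Q : E -> R[i]).
  by apply: in_L2_real; exact: rL2_indic.
have e : dotr mu (real_part u) (\1_Q) =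
    (-1) ^+ (~~ b) * dotr mu u (fun x => part b (V (Cindic Q) x)).
  transitivity (part b (L2dot mu (U (fun z => (u z)%:C%C)) (Cindic Q))).
    rewrite part_Cintegral; apply: eq_Rintegral => x _.
    exact/esym/part_mulr_conj.
  rewrite (UV _ _ (in_L2_real lu) lQ) part_Cintegral.
  rewrite [dotr mu u _]dotrC -dotr_scalel //; last exact: part_rL2 (V_L2 _ lQ).
  by apply: eq_Rintegral => x _; rewrite part_conj; ring.
rewrite e normrM normrX normrN1 expr1n mul1r.
apply: (le_trans (dotr_cs lu (part_rL2 b (V_L2 _ lQ)))).
by apply: ler_wpM2l; [exact: nrmr_ge0|exact: nrmr_part_test (V_L2 _ lQ) mQ hC vQ].
Qed.

Lemma real_part_kernel (K : 'rV[R]_d -> 'rV[R]_d -> R[i]) (phi : 'rV[R]_d -> R) :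
  (forall f, test_function f ->
    {ae mu, forall x, ~ supp f x -> U f x = Cintegral mu (fun y => K x y * f y)}) ->
  smooth phi -> compact (supp (fun x => (phi x)%:C%C : R[i])) ->
  {ae mu, forall x, ~ supp (fun x => (phi x)%:C%C : R[i]) x ->
    real_part phi x = \int[mu]_y (part b (K x y) * phi y)}.
Proof.
move=> UK sphi cphi; have tf : test_function (fun x => (phi x)%:C%C : R[i]).
  by split=> //; move=> n; exact: cd_cst.
have ae := UK _ tf; apply: (@filterS E (almost_everywhere mu) _ _ _ _ ae) => x h nx.
rewrite /real_part h // part_Cintegral; apply: eq_Rintegral => y _; exact: part_mulr.
Qed.

End RealPart.

Theorem corollary2p2 (R : realType) (d : nat) (A m eps C0 : R) :
  (0 < d)%N -> 0 < m -> 0 < eps ->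
  exists C : R,
    forall (q0 : 'rV[R]_d)
           (mu : {finite_measure set (borelRd R d) -> \bar R})
           (T Tadj : ('rV[R]_d -> R[i]) -> 'rV[R]_d -> R[i]),
      (exists F : set 'rV[R]_d,
         [/\ compact F, F `<=` cube q0 (1 / 2) & mu (~` F) = 0%E]) ->
      (forall (x : 'rV[R]_d) (r : R), 0 < r ->
         (mu (eball x r) <= (r `^ m)%:E)%E) ->
      calderon_zygmund_operator A m eps mu T ->
      L2_adjoint mu T Tadj ->
      (forall (c : 'rV[R]_d) (l : R), 0 < l ->
         (L2norm mu (T (Cindic (cube c l))) ^+ 2
            <= C0%:E * mu (cube c l))%E /\
         (L2norm mu (Tadj (Cindic (cube c l))) ^+ 2
            <= C0%:E * mu (cube c l))%E) ->
      (L2opnorm mu T <= C%:E)%E.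
Proof.
move=> _ m_gt0 eps_gt0; pose X : R := 4 * `|A| * (Num.sqrt d%:R + 1).
(* The offset 3 provides [3 <= a0], while [2 ^ a0 >= X] expresses the dependence on [A]. No sign is
   assumed for [C0], hence the maximum with 0. *)
pose a0 := (Num.truncn X).+3; pose Cr := Num.max C0 0.
have a0_ge : X <= 2 ^+ a0.
  apply: (@le_trans _ _ (Num.truncn X).+1%:R); first exact: ltW (truncnS_gt X).
  rewrite -natrX ler_nat; apply: leq_trans (ltnW (ltn_expl _ (ltnSn 1))) _.
  by rewrite leq_exp2l // /a0 ltnS !leqW.
(* A complex function has two real components and the operator two real parts on each, which makes
   four pieces bounded by [C]. *)
pose C := `|Cgrid d m eps Cr a0|; exists (4 * C).
move=> q0 mu T Tadj [F [cF Fq muF]] growth [Tb [K [ks kl kr] Tk]] TT test.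
have Cr0 : 0 <= Cr by rewrite le_max lexx orbT.
have C0r : C0 <= Cr by rewrite le_max lexx.
(* The half-open unit box with this corner is centred at [q0] and contains the closed cube of side
   1/2 that carries [mu]. *)
pose c0 := q0 - const_mx (1 / 2) : 'rV[R]_d.
have W_full : mu (~` hbox c0 1) = 0%E.
  have mF : measurable (F : set (borelRd R d)).
    by apply: closed_measurableRd; apply: compact_closed => //; exact: norm_hausdorff.
  have mW : measurable (hbox c0 1 : set (borelRd R d)) by exact: measurable_hbox.
  apply/eqP; rewrite -measure_le0 -muF; apply: le_measure; rewrite ?inE; [exact: measurableC|exact: measurableC|].
  apply: subsetC => z /Fq Fz i; have := Fz i; rewrite ler_distl !mxE => /andP[z1 z2].
  by apply/andP; split; lra.
have bound b u : rL2 mu u -> nrmr mu (real_part b T u) <= C * nrmr mu u.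
  move=> lu; have [N N0 hN] := real_part_bounded b Tb.
  apply: (@P_norm_le _ _ mu (real_part b T) (fun x y => part b (K x y)) A m eps Cr N _ _ _ N0 Cr0 hN _ _ eps_gt0 m_gt0 _ _ _ _ growth c0 W_full a0 u) => //.
  - by move=> v; exact: real_part_L2.
  - by move=> a v1 v2; exact: real_part_lin.
  - by move=> v1 v2; exact: real_part_ae.
  - by move=> c l l0; apply: (real_part_test b Tb _ C0r); [exact: measurable_cube|case: (test c l l0)].
  - by move=> v c l lv l0; apply: (real_part_adjoint b TT lv _ C0r); [exact: measurable_cube|case: (test c l l0)].
  - by move=> x y xy; apply: le_trans (part_le _ _) _; exact: ks.
  - by move=> x x' y h1 h2 h3; rewrite -part_sub; apply: le_trans (part_le _ _) _; exact: kl.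
  - by move=> x y y' h1 h2 h3; rewrite -part_sub; apply: le_trans (part_le _ _) _; exact: kr.
  - by move=> phi; exact: real_part_kernel.
have C_ge0 : 0 <= C by rewrite normr_ge0.
apply: ge_ereal_sup => _ [f [lf f1] <-].
pose u (z : borelRd R d) := complex.Re (f z); pose v (z : borelRd R d) := complex.Im (f z).
have [lu lv] : rL2 mu u /\ rL2 mu v by apply/in_L2_rL2.
have u1 : nrmr mu u <= 1 by rewrite -lee_fin; exact: le_trans (nrmr_part true lf) f1.
have v1 : nrmr mu v <= 1 by rewrite -lee_fin; exact: le_trans (nrmr_part false lf) f1.
(* Complex linearity with scalar [i] reduces [T f] to [T] on the real functions [v] and [u]; its
   real part mixes the real part on [u] with the imaginary part on [v], and conversely for its
   imaginary part. *)
have Tf : {ae mu, forall x, T f x = (0 +i* 1)%C * T (fun z => (v z)%:C%C) x + T (fun z => (u z)%:C%C) x}.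
  pose g z := (0 +i* 1)%C * (v z)%:C%C + (u z)%:C%C.
  have -> : T f = T g.
    congr T; apply/funext => z; rewrite /g /u /v; case: (f z) => x y.
    by apply/eqP; rewrite eq_complex /=; apply/andP; split; apply/eqP; ring.
  exact: (L2op_linear Tb (0 +i* 1)%C (in_L2_real lv) (in_L2_real lu)).
have small b w : rL2 mu w -> nrmr mu w <= 1 -> nrmr mu (real_part b T w) <= C.
  by move=> lw w1; apply: (le_trans (bound b w lw)); rewrite ler_piMr.
have lTf := L2op_stable Tb lf.
have lP b w : rL2 mu w -> rL2 mu (real_part b T w) by move=> lw; exact: real_part_L2.
apply: (le_trans (L2norm_le lTf)); rewrite lee_fin.
have [lre lim] : rL2 mu (fun x => complex.Re (T f x)) /\ rL2 mu (fun x => complex.Im (T f x)).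
  exact/in_L2_rL2.
have re_le : nrmr mu (fun x => complex.Re (T f x)) <= 2 * C.
  have ae : {ae mu, forall x, complex.Re (T f x) = real_part true T u x - real_part false T v x}.
    apply: (@filterS (borelRd R d) (almost_everywhere mu) _ _ _ _ Tf) => x ->.
    by rewrite /real_part /=; case: (T _ x) => x1 y1; case: (T _ x) => x2 y2 /=; ring.
  have ld := rL2_sub (lP true u lu) (lP false v lv).
  rewrite (ae_nrmr _ _ ae); [|by case: lre|by case: ld].
  apply: (le_trans (nrmr_sub (lP true u lu) (lP false v lv))).
  have := small true u lu u1; have := small false v lv v1; lra.
have im_le : nrmr mu (fun x => complex.Im (T f x)) <= 2 * C.
  have ae : {ae mu, forall x, complex.Im (T f x) = real_part true T v x + real_part false T u x}.
    apply: (@filterS (borelRd R d) (almost_everywhere mu) _ _ _ _ Tf) => x ->.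
    by rewrite /real_part /=; case: (T _ x) => x1 y1; case: (T _ x) => x2 y2 /=; ring.
  have ld := rL2_add (lP true v lv) (lP false u lu).
  rewrite (ae_nrmr _ _ ae); [|by case: lim|by case: ld].
  apply: (le_trans (nrmr_tri (lP true v lv) (lP false u lu))).
  have := small true v lv v1; have := small false u lu u1; lra.
lra.
Qed.
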